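(* Let $S^6\subset\mathbb{R}^7$ be the unit sphere with its standard round metric $\langle -,-\rangle$ and Levi-Civita connection $\nabla$, and let $J$ be an almost complex structure on $S^6$. Let $m$ be the tangent algebra associated to $J$ and $\nabla$, and let $(-,-)$ be the $J$-compatible inner product on tangent spaces induced by $J$ and $\langle-,-\rangle$ (defined in the context), with norm $\|\cdot\|$. If $$\sum_k \big((\nabla_XJ)Z_k,\;J\,m(Z_k,X)\big)\;\neq\;\sum_k\|(\nabla_XJ)Z_k\|^2+\|X\|^2$$ for all non-zero tangent vectors $X$, then $J$ is not integrable. Here, at each point, the sums are over any real tangent vectors $Z_k$ such that $\{Z_k+iJZ_k\}$ is an orthonormal basis of $T^{0,1}$. In particular, if $$\big((\nabla_XJ)Z,\;J\,m(Z,X)\big)\le\|(\nabla_XJ)Z\|^2$$ for all $X$ and $Z$ (tangent vectors at a common point), or if the condition $$\|m(Z,X)\|\le\|(\nabla_XJ)Z\|$$ holds for all $X$ and $Z$, then $J$ is not integrable.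
   Context: An almost complex structure on a smooth manifold $M$ is a smooth section $J$ of $\operatorname{End}(TM)$ with $J^2=-\operatorname{Id}$. It is integrable if it is induced by a complex structure, equivalently (Newlander--Nirenberg) if $N(X,Y)=J[X,JY]+J[JX,Y]+[X,Y]-[JX,JY]$ vanishes identically. The induced connection on $\operatorname{End}(TM)$ is $(\nabla_X J)Y=\nabla_X(JY)-J\nabla_XY$. The tangent algebra associated to $J$ and $\nabla$ is the tensor $m(X,Y)=(\nabla_{JX}J-J\nabla_XJ)Y$. $T^{0,1}_x=\{v\in T_xM\otimes\mathbb{C}: Jv=-iv\}$. The metric is extended to a complex inner product on $T_xM\otimes\mathbb{C}$ (conjugate linear in the second variable); orthonormality of $\{Z_k+iJZ_k\}$ refers to it. Let $Q:T_xM\otimes\mathbb{C}\to T_xM\otimes\mathbb{C}$ be the orthogonal projection onto $T^{0,1}_x$ and write $Q=R+iM$ with $R,M$ real linear operators on $T_xM$. Define $\nu(X,Y)=\langle MX,Y\rangle$, which is a $2$-form, and $(X,Y)=\nu(X,JY)=\langle MX,JY\rangle$, which is a positive definite inner product for which $J$ is orthogonal; $\|X\|^2=(X,X)$. *)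

(* Defs.v *)
From HB Require Import structures.
From mathcomp Require Import all_boot all_order all_algebra.
From mathcomp Require Import spectral.
From mathcomp Require Import complex.
From mathcomp Require Import all_classical all_reals all_analysis.
Set Implicit Arguments.
Unset Strict Implicit.
Unset Printing Implicit Defensive.
Import Order.TTheory GRing.Theory Num.Theory.
Import numFieldNormedType.Exports.
Local Open Scope classical_set_scope.
Local Open Scope ring_scope.

Section Smooth.
Variables (R : realType) (V W : normedModType R).

(* Meant for open U and finite-dimensional V; all directions v are allowed, so
   that no basis of V has to be chosen. *)
Fixpoint Ck (k : nat) (U : set V) (f : V -> W) : Prop :=
  (forall x, U x -> {for x, continuous f}) /\
  match k with
  | 0%N => True
  | k'.+1 => forall v : V,
      (forall x, U x -> derivable f x v) /\ Ck k' U (fun x => 'D_v f x)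
  end.

Definition smooth (U : set V) (f : V -> W) : Prop := forall k, Ck k U f.

End Smooth.

Section Sphere.
Variable R : realType.

(* S^6 is the unit sphere of R^7, whose points are row vectors; operators act
   on row vectors from the right.  Functions on S^6 are represented by functions
   on all of R^7, of which only the values on S^6 are ever used. *)
Notation E := 'rV[R]_7.

Definition dot (u v : E) : R := (u *m v^T) 0 0.

Definition sphere6 : set E := [set x | dot x x = 1].

Definition tangent (x v : E) : Prop := dot v x = 0.

Definition radial (y : E) : E := (Num.sqrt (dot y y))^-1 *: y.

(* Smoothness on the open subset U `&` sphere6 of S^6 (U open in R^7), tested on
   the extension of f that is constant along rays.  As the radial retraction is
   smooth, this holds iff f has a smooth extension near each point. *)
Definition smooth_sphere (W : normedModType R) (U : set E) (f : E -> W) : Prop :=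
  smooth [set y | y != 0 /\ U (radial y)] (f \o radial).

(* The derivative of f : S^6 -> W at x in S^6 along v in T_x S^6. *)
Definition Dsphere (W : normedModType R) (f : E -> W) (x v : E) : W :=
  'D_v (f \o radial) x.

Definition vector_field (X : E -> E) : Prop :=
  (forall x, sphere6 x -> tangent x (X x)) /\ smooth_sphere setT X.

Definition smooth_fun (f : E -> R^o) : Prop := smooth_sphere setT f.

Record Levi_Civita (nabla : (E -> E) -> (E -> E) -> (E -> E)) : Prop := {
  LC_field : forall X Y, vector_field X -> vector_field Y ->
    vector_field (nabla X Y);
  LC_addl : forall X X' Y,
    vector_field X -> vector_field X' -> vector_field Y ->
    forall x, sphere6 x ->
    nabla (fun y => X y + X' y) Y x = nabla X Y x + nabla X' Y x;
  LC_scalel : forall (f : E -> R^o) X Y,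
    smooth_fun f -> vector_field X -> vector_field Y ->
    forall x, sphere6 x -> nabla (fun y => f y *: X y) Y x = f x *: nabla X Y x;
  LC_addr : forall X Y Y',
    vector_field X -> vector_field Y -> vector_field Y' ->
    forall x, sphere6 x ->
    nabla X (fun y => Y y + Y' y) x = nabla X Y x + nabla X Y' x;
  LC_leibniz : forall (f : E -> R^o) X Y,
    smooth_fun f -> vector_field X -> vector_field Y ->
    forall x, sphere6 x ->
    nabla X (fun y => f y *: Y y) x =
      Dsphere f x (X x) *: Y x + f x *: nabla X Y x;
  LC_metric : forall X Y Z,
    vector_field X -> vector_field Y -> vector_field Z ->
    forall x, sphere6 x ->
    Dsphere (fun y => dot (Y y) (Z y) : R^o) x (X x) =
      dot (nabla X Y x) (Z x) + dot (Y x) (nabla X Z x);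
  (* nabla X Y - nabla Y X = [X, Y], both sides acting as derivations *)
  LC_torsion_free : forall X Y (f : E -> R^o),
    vector_field X -> vector_field Y -> smooth_fun f ->
    forall x, sphere6 x ->
    Dsphere f x (nabla X Y x) - Dsphere f x (nabla Y X x) =
      Dsphere (fun y => Dsphere f y (Y y)) x (X x) -
      Dsphere (fun y => Dsphere f y (X y)) x (Y x)
}.

(* An endomorphism of T_x S^6 is encoded by the 7 x 7 matrix that extends it by
   0 on the normal line. *)
Record almost_complex (J : E -> 'M[R]_7) : Prop := {
  ac_normal : forall x, sphere6 x -> x *m J x = 0;
  ac_tangent : forall x v, sphere6 x -> tangent x v -> tangent x (v *m J x);
  ac_square : forall x v, sphere6 x -> tangent x v -> v *m J x *m J x = - v;
  ac_smooth : smooth_sphere setT J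
}.

(* C^3 as pairs (real part, imaginary part), to have it as a real normed space *)
Notation C3 := ('rV[R]_3 * 'rV[R]_3)%type.

Definition mul_i (w : C3) : C3 := (- w.2, w.1).

(* z is a diffeomorphism from U `&` sphere6 onto an open subset of C^3 whose
   differential intertwines J with multiplication by i.  Changes of coordinates
   between two such charts then have complex linear differentials, so they are
   holomorphic. *)
Definition complex_chart (J : E -> 'M[R]_7) (U : set E) (z : E -> C3) : Prop :=
  [/\ open U, smooth_sphere U z,
      (exists w : C3 -> E,
         [/\ open (z @` (U `&` sphere6)),
             smooth (z @` (U `&` sphere6)) w
           & forall x, U x -> sphere6 x -> w (z x) = x])
    & forall x v, U x -> sphere6 x -> tangent x v ->
        Dsphere z x (v *m J x) = mul_i (Dsphere z x v)].

(* J is induced by a complex structure: complex charts as above cover S^6. *)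
Definition integrable_acs (J : E -> 'M[R]_7) : Prop :=
  forall p, sphere6 p -> exists U z, U p /\ complex_chart J U z.

Definition tproj (v : E) : E -> E := fun y => v - dot v y *: y.

(* (nabla_v J) w at x, for v and w in T_x S^6.  It is tensorial in v and w, so
   any extension of them to vector fields may be used; tproj v is one. *)
Definition nablaJ (nabla : (E -> E) -> (E -> E) -> (E -> E))
    (J : E -> 'M[R]_7) (x v w : E) : E :=
  nabla (tproj v) (fun y => tproj w y *m J y) x
  - nabla (tproj v) (tproj w) x *m J x.

Definition tangent_algebra (nabla : (E -> E) -> (E -> E) -> (E -> E))
    (J : E -> 'M[R]_7) (x v w : E) : E :=
  nablaJ nabla J x (v *m J x) w - nablaJ nabla J x v w *m J x.

Definition complexify m n (A : 'M[R]_(m, n)) : 'M[R[i]]_(m, n) :=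
  map_mx (real_complex R) A.

(* The subspace T^{0,1}_x of C^7, as a row space: the vectors of the
   complexified tangent space on which J acts as - i. *)
Definition T01 (J : E -> 'M[R]_7) (x : E) : 'M[R[i]]_7 :=
  (kermx (complexify x)^T :&: eigenspace (complexify (J x)) (- 'i%C))%MS.

(* The real operator M, where Q = R + iM is the orthogonal projection onto
   T^{0,1}_x. *)
Definition imQ (J : E -> 'M[R]_7) (x : E) : 'M[R]_7 :=
  map_mx (@complex.Im R) (proj_ortho (T01 J x)).

Definition ipJ (J : E -> 'M[R]_7) (x u v : E) : R :=
  dot (u *m imQ J x) (v *m J x).

Definition normJ (J : E -> 'M[R]_7) (x u : E) : R := Num.sqrt (ipJ J x u u).

(* The Z_k are real tangent vectors at x such that the Z_k + i J Z_k form an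
   orthonormal basis of T^{0,1}_x. *)
Definition T01_frame (J : E -> 'M[R]_7) (x : E) (Z : 'I_3 -> E) : Prop :=
  let B : 'M[R[i]]_(3, 7) := \matrix_(k < 3)
    (complexify (Z k) + 'i%C *: complexify (Z k *m J x)) in
  [/\ forall k, tangent x (Z k), B \is unitarymx & (B == T01 J x)%MS].

End Sphere.

(* Main.v *)
From mathcomp Require Import fingroup perm.
Require Import Defs.
From HB Require Import structures.
From mathcomp Require Import all_boot all_order all_algebra.
From mathcomp Require Import zify ring lra spectral complex.
From mathcomp Require Import all_classical all_reals all_analysis.
Set Implicit Arguments.
Unset Strict Implicit.
Unset Printing Implicit Defensive.
Import Order.TTheory GRing.Theory Num.Theory.
Import numFieldNormedType.Exports.
Local Open Scope classical_set_scope.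
Local Open Scope sesquilinear_scope.
Local Open Scope ring_scope.

(** Let Q_x be the orthogonal projection onto T^{0,1}_x.  To a smooth family of
    projections belongs the closed two-form
      omega (X, Y) = 2 Re tr (i Q [D_X Q, D_Y Q]),
    up to a constant the trace of the curvature of the bundle of images.  On S^6
    such a form is never nondegenerate: it is exact, so omega^3 is exact, and it is not a volume
    form.  The plan is to show that an integrable J satisfying the hypothesis
    would make omega nondegenerate.

    For a unitary frame Z_k + i J Z_k of T^{0,1}, the derivative of Q along X is
    determined by (nabla_X J) Z_k and by the scalar products of Z_k and J Z_k with X
    ([frame_derivative]).  Along JX the derivative of J is
    J (nabla_X J) Z_k + m (X, Z_k), and for integrable J the tangent algebra is
    symmetric, its antisymmetric part being the Nijenhuis tensor
    ([tangent_algebra_sym]).  Hence ([proj_form_frame])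
      omega (X, JX) = -4 (sum_k ((nabla_X J) Z_k, J m (Z_k, X))
                          - sum_k |(nabla_X J) Z_k|^2 - |X|^2),
    which the hypothesis makes nonzero for all X <> 0: omega is nondegenerate.
    The two particular cases follow, as |X|^2 > 0 makes the inequality between
    the sums strict, and by the Cauchy-Schwarz inequality and the invariance of the
    norm under J.

    That no such form exists on the sphere ([no_nondegenerate_proj_form]) is proved
    with explicit maps.  A smooth map from [0,1]^6 to S^6 collapses the
    boundary to a point and is a diffeomorphism from the interior onto the rest of
    the sphere; a homotopy of this map to a constant is defined on [0,1]^7.  If A
    and B are the pullbacks of omega by the homotopy and by its final map, then
    the vector field dual to A /\ B /\ B is divergence-free, and tangent to all faces
    of the cube but the one where the homotopy ends.  There its normal component is
    B /\ B /\ B, of constant sign and not zero, against the divergence theorem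
    ([no_positive_outflow]), which is proved by averaging increments over grids.

    On the other side, smoothness of Q comes from a rational formula for the
    orthogonal projection in terms of J ([realify_projection]); the Levi-Civita
    connection is identified with the tangential derivative in R^7 ([nablaE]); and
    symmetry of the tangent algebra results from differentiating the
    Cauchy-Riemann equations of a complex chart ([nijenhuis_killed]). *)

(** * Directional derivatives and differentiability *)
Section Lines.
Variables (R : realType) (V : normedModType R).

Lemma is_derive_line (W : normedModType R) (f : V -> W) x v (t : R) :
  derivable f (x + t *: v) v ->
  is_derive t 1 (fun s : R => f (x + s *: v)) ('D_v f (x + t *: v)).
Proof.
have E : (fun h : R => h^-1 *: (((fun s : R => f (x + s *: v)) \o shift t) (h *: 1)
            - f (x + t *: v)))
       = (fun h => h^-1 *: ((f \o shift (x + t *: v)) (h *: v)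
            - f (x + t *: v))).
  apply/funext => h /=; congr (_ *: (f _ - _)).
  by rewrite [h *: 1]mulr1 scalerDl addrCA.
by move=> df; split; rewrite /derivable /derive E.
Qed.

Lemma MVT_line (f : V -> R^o) x v :
  (forall t : R, 0 <= t <= 1 -> derivable f (x + t *: v) v) ->
  exists2 t, 0 < t < 1 & f (x + v) - f x = 'D_v f (x + t *: v).
Proof.
move=> df; have dg (t : R) : 0 <= t <= 1 -> is_derive t 1
    (fun s : R => f (x + s *: v) : R) ('D_v f (x + t *: v) : R).
  by move=> t01; apply: is_derive_line; exact: df.
have [||t] := @MVT R (fun s => f (x + s *: v)) (fun s => 'D_v f (x + s *: v)) 0 1 ltr01.
- by move=> t; rewrite in_itv /= => /andP[/ltW t0 /ltW t1]; apply: dg; rewrite t0.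
- apply: derivable_within_continuous => t; rewrite in_itv /= => t01.
  by have [] := dg _ t01.
rewrite in_itv /= => t01 E; exists t => //.
by move: E; rewrite scale1r scale0r addr0 subr0 mulr1.
Qed.

Lemma derive_along (W : normedModType R) (f : V -> W) x v :
  'D_v f x = 'D_1 (fun h : R => f (h *: v + x)) 0.
Proof.
rewrite /derive; set g1 := fun h => h^-1 *: _; set g2 := fun h => h^-1 *: _.
suff -> : g1 = g2 by [].
by rewrite funeqE /g1 /g2 => h /=; rewrite addr0 scale0r add0r [_%:A]mulr1.
Qed.

Lemma is_derive_scale (W : normedModType R) (f : V -> W) x v (a : R) :
  derivable f x v -> is_derive x (a *: v) f (a *: 'D_v f x).
Proof.
move=> df.
have dg : differentiable (fun h : R => f (h *: v + x)) 0.
  exact/derivable1_diffP/(derivable1P _ _ _).1.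
have [dl El] := is_diff_scalel (0 : R) (a : R^o).
have E : (fun h : R => f (h *: (a *: v) + x)) =
         (fun h : R => f (h *: v + x)) \o (fun h : R => h *: (a : R^o)).
  by apply/funext => h /=; rewrite scalerA.
have dg0 : differentiable (fun h : R => f (h *: v + x)) (0 *: (a : R^o)).
  by rewrite scale0r.
have dc : differentiable (fun h : R => f (h *: (a *: v) + x)) 0.
  by rewrite E; apply: differentiable_comp.
split; first exact/(derivable1P _ _ _).2/derivable1_diffP.
rewrite !derive_along !deriveE // E diff_comp //= El /= scale0r scale1r.
by rewrite -[a in LHS]mulr1 -[a * 1]/(a *: (1:R)) linearZ.
Qed.

End Lines.

Section Differentiable.
Variables (R : realType).

Lemma mx_entry_le_norm m n (A : 'M[R]_(m, n)) i j : `|A i j| <= `|A|.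
Proof.
by rewrite [leRHS]/Num.Def.normr/= mx_normrE; exact: (le_bigmax _ _ (i, j)).
Qed.

Lemma mx_norm_le m n (A : 'M[R]_(m, n)) c :
  0 <= c -> (forall i j, `|A i j| <= c) -> `|A| <= c.
Proof.
move=> c0 Ac.
by rewrite [leLHS]/Num.Def.normr/= mx_normrE bigmax_le // => -[i j] _; exact: Ac.
Qed.

(** The increment along h is telescoped through the points whose first k
    coordinates are those of h; the mean value theorem turns each step into a
    partial derivative at a point close to x. *)
Lemma partials_differentiable n (f : 'rV[R]_n -> R^o) x :
  (\near x, forall i, derivable f x (delta_mx 0 i)) ->
  (forall i, {for x, continuous (fun y => 'D_(delta_mx 0 i) f y)}) ->
  differentiable f x.
Proof.
move=> df cf; pose d i : R := 'D_(delta_mx 0 i) f x.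
pose L (h : 'rV[R]_n) : R^o := \sum_i h 0 i * d i.
have Llin : linear L.
  move=> a u v; rewrite /L scaler_sumr -big_split /=; apply: eq_bigr => i _.
  by rewrite !mxE mulrDl [in RHS]/(_ *: _) /= mulrA.
pose LM := GRing.isLinear.Build _ _ _ _ _ Llin.
pose Ll : {linear 'rV[R]_n -> R^o} := HB.pack L LM.
have Lc : continuous Ll.
  have -> : (Ll : _ -> _) = \sum_i (fun h : 'rV[R]_n => h 0 i * d i).
    by apply/funext => h; rewrite fct_sumE.
  move=> y; apply: differentiable_continuous; apply: differentiable_sum => i.
  by apply: differentiableM => //; exact: differentiable_coord.
have ex : f \o shift x = cst (f x) + Ll +o_ 0 id.
  apply/eqaddoP => _/posnumP[e].
  pose e' := e%:num / n.+1%:R.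
  have e'0 : 0 < e' by rewrite divr_gt0.
  have : \near x, forall i, derivable f x (delta_mx 0 i) /\ `|'D_(delta_mx 0 i) f x - d i| <= e'.
    have cd : \forall y \near x, forall i, `|'D_(delta_mx 0 i) f y - d i| <= e'.
      have FF := @filter_forall 'rV[R]_n 'I_n (fun i y => `|'D_(delta_mx 0 i) f y - d i| <= e') (nbhs x) (nbhs_filter x).
      apply: FF => i.
      have /cvgrPdist_le /(_ _ e'0) := cf i.
      by apply: filterS => y; rewrite distrC.
    by apply: filterS2 df cd => y df cd i; split.
  move=> /nbhs_ballP[r /= r0 Hr].
  near=> h.
  (* h truncated to its first k coordinates *)
  pose p k : 'rV[R]_n := \row_i (if (i < k)%N then h 0 i else 0).
  have hr : `|h| < r by near: h; exact: (@nbhs0_lt R 'rV[R]_n r r0).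
  have step (k : 'I_n) : `|f (x + p k.+1) - f (x + p k) - h 0 k * d k| <= `|h| * e'.
    have Ep : p k.+1 = p k + h 0 k *: delta_mx 0 k.
      apply/rowP => i; rewrite !mxE eqxx /= ltnS leq_eqVlt val_eqE.
      by case: (eqVneq i k) => [->|_]; rewrite ?ltnn ?mulr1 ?add0r ?mulr0 ?addr0.
    have inb t : 0 <= t <= 1 -> ball x r (x + p k + t *: (h 0 k *: delta_mx 0 k)).
      move=> /andP[t0 t1]; rewrite -ball_normE /= -addrA opprD addrA subrr sub0r normrN.
      apply: le_lt_trans hr; apply: mx_norm_le => // i j; rewrite ord1 !mxE eqxx /=.
      case: (eqVneq j k) => [->|_]; rewrite ?ltnn ?mulr1 ?add0r ?mulr0 ?addr0.
        rewrite normrM ger0_norm // (le_trans _ (mx_entry_le_norm h 0 k)) //.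
        by rewrite ler_piMl.
      by case: ifP => _; rewrite ?normr0 ?mx_entry_le_norm.
    have [t|t t01] := @MVT_line R _ f (x + p k) (h 0 k *: delta_mx 0 k).
      by move=> t01; have [dk _] := Hr _ (inb _ t01) k; have [] := is_derive_scale (h 0 k) dk.
    have t01' : 0 <= t <= 1 by case/andP: t01 => /ltW -> /ltW ->.
    have [dk ek] := Hr _ (inb _ t01') k.
    have [_ ->] := is_derive_scale (h 0 k) dk.
    rewrite -addrA -Ep => ->; rewrite -mulrBr normrM.
    by rewrite ler_pM // mx_entry_le_norm.
  have -> : (f \o shift x - (cst (f x) + Ll)) h =
     \sum_(k < n) (f (x + p k.+1) - f (x + p k) - h 0 k * d k).
    rewrite sumrB -(big_mkord xpredT (fun k => f (x + p k.+1) - f (x + p k))).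
    rewrite telescope_sumr //.
    have -> : p n = h by apply/rowP => i; rewrite mxE ltn_ord.
    have -> : p 0%N = 0 by apply/rowP => i; rewrite !mxE ltn0.
    by rewrite addr0 -[LHS]/(f (h + x) - (f x + L h)) opprD addrA addrC [h + x]addrC addrC.
  apply: le_trans (ler_norm_sum _ _ _) _.
  apply: le_trans (ler_sum _ (fun k _ => step k)) _.
  rewrite sumr_const card_ord -mulr_natr -mulrA mulrC ler_wpM2r //.
  by rewrite /e' -mulrA ler_piMr // mulrC ler_pdivrMr // mul1r ler_nat.
apply/diff_locallyP; have E := diff_unique Lc ex.
by rewrite E.
Unshelve. all: by end_near.
Qed.

End Differentiable.

(** * Calculus of maps of class C^k *)
Section CkTheory.
Variables (R : realType) (V : normedModType R).
Implicit Types (U : set V) (k : nat).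

Section General.
Variable W : normedModType R.
Implicit Types (f g : V -> W).

Lemma Ck_cont k U f x : Ck k U f -> U x -> {for x, continuous f}.
Proof. by case: k => [|k] [c _]; exact: c. Qed.

Lemma Ck_D k U f v : Ck k.+1 U f -> Ck k U ('D_v f).
Proof. by move=> [_ /(_ v)[]]. Qed.

Lemma Ck_derivable k U f x v : Ck k.+1 U f -> U x -> derivable f x v.
Proof. by move=> [_ /(_ v)[+ _]]; apply. Qed.

Lemma CkS k U f : Ck k.+1 U f -> Ck k U f.
Proof.
elim: k f => [|k IH] f [cf df]; split => // v; split; first exact: (df v).1.
exact: IH (df v).2.
Qed.

Lemma Ck_sub k U U' f : U' `<=` U -> Ck k U f -> Ck k U' f.
Proof.
move=> sU; elim: k f => [|k IH] f [cf df]; split=> //; try by move=> x /sU; exact: cf.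
by move=> v; split; [move=> x /sU; exact: (df v).1|apply: IH; exact: (df v).2].
Qed.

(** The class depends only on the values on the open set U, since derivatives at
    points of U are local. *)
Lemma Ck_ext k U f g : open U -> (forall x, U x -> f x = g x) ->
  Ck k U f -> Ck k U g.
Proof.
move=> oU; have near_eq (f1 f2 : V -> W) x : (forall x, U x -> f1 x = f2 x) ->
    U x -> {near x, f1 =1 f2}.
  by move=> E Ux; near=> y; apply: E; near: y; exact: open_nbhs_nbhs.
have cont (f1 f2 : V -> W) x : (forall x, U x -> f1 x = f2 x) -> U x ->
    {for x, continuous f1} -> {for x, continuous f2}.
  move=> E Ux c; apply: cvg_trans (_ : f1 @ x --> f2 x); last by rewrite -E.
  by apply: near_eq_cvg; exact: near_eq.
elim: k f g => [|k IH] f g E [cf df].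
  by split=> // x Ux; apply: cont E Ux (cf x Ux).
split=> [x Ux|v]; first by apply: cont E Ux (cf x Ux).
have Edf x : U x -> 'D_v f x = 'D_v g x.
  by move=> Ux; apply: near_eq_derive; exact: near_eq.
split=> [x Ux|]; first by apply: (near_eq_derivable (near_eq f g x E Ux)); exact: (df v).1.
exact: IH Edf (df v).2.
Unshelve. all: by end_near.
Qed.

Lemma Ck_cst k U (c : W) : Ck k U (fun=> c).
Proof.
elim: k c => [|k IH] c; split=> //; try by move=> x _; exact: cvg_cst.
move=> v; split=> [x _|]; first exact: derivable_cst.
by rewrite (_ : 'D_v (fun=> c) = fun=> 0); [exact: IH|apply/funext => x; exact: derive_cst].
Qed.

Lemma Ck_add k U f g : open U -> Ck k U f -> Ck k U g ->
  Ck k U (fun x => f x + g x).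
Proof.
move=> oU; elim: k f g => [|k IH] f g [cf df] [cg dg]; split=> //;
  try by move=> x Ux; apply: cvgD; [exact: cf|exact: cg].
move=> v; split=> [x Ux|].
  by apply: derivableD; [exact: (df v).1|exact: (dg v).1].
apply: (Ck_ext oU _ (IH _ _ (df v).2 (dg v).2)) => x Ux.
by rewrite -deriveD //; [exact: (df v).1|exact: (dg v).1].
Qed.

Lemma Ck_opp k U f : open U -> Ck k U f -> Ck k U (fun x => - f x).
Proof.
move=> oU; elim: k f => [|k IH] f [cf df]; split=> //;
  try by move=> x Ux; apply: cvgN; exact: cf.
move=> v; split=> [x Ux|]; first by apply: derivableN; exact: (df v).1.
apply: (Ck_ext oU _ (IH _ (df v).2)) => x Ux.
by rewrite -deriveN //; exact: (df v).1.
Qed.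

Lemma Ck_sum k U (I : Type) (r : seq I) (P : pred I) (F : I -> V -> W) : open U ->
  (forall i, P i -> Ck k U (F i)) -> Ck k U (fun x => \sum_(i <- r | P i) F i x).
Proof.
move=> oU HF; elim: r => [|i r IH].
  by rewrite (_ : (fun x => _) = fun=> 0); [exact: Ck_cst|apply/funext => x; rewrite big_nil].
case Pi : (P i); last first.
  by rewrite (_ : (fun x => _) = (fun x => \sum_(i <- r | P i) F i x)) //;
     apply/funext => x; rewrite big_cons Pi.
rewrite (_ : (fun x => _) = (fun x => F i x + \sum_(i <- r | P i) F i x)); last first.
  by apply/funext => x; rewrite big_cons Pi.
by apply: Ck_add => //; exact: HF.
Qed.

End General.

Lemma Ck_id k U : Ck k U (@id V).
Proof.
case: k => [|k]; first by split=> // x _.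
split=> [x _|w]; first by [].
split=> [x _|]; first exact: derivable_id.
rewrite (_ : 'D_w id = fun=> w); first exact: Ck_cst.
by apply/funext => x; exact: derive_id.
Qed.

Section PostLinear.
Variables (W W' : normedModType R) (L : {linear W -> W'}).
Hypothesis cL : continuous L.

Lemma is_derive_lin (f : V -> W) x v : derivable f x v ->
  is_derive x v (fun y => L (f y)) (L ('D_v f x)).
Proof.
move=> df.
have H : (h^-1 *: (L (f (h *: v + x)) - L (f x)) @[h --> 0^'] --> L ('D_v f x)).
  rewrite (_ : (fun h : R => _) = L \o (fun h => h^-1 *: (f (h *: v + x) - f x))).
    by apply: (cvg_comp _ _ df); exact: cL.
  by apply/funext => h /=; rewrite [RHS]linearZ_LR (linearB L).
split; first exact: (cvgP _ H).
exact: (cvg_lim _ H).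
Qed.

Lemma Ck_lin k U (f : V -> W) : open U -> Ck k U f -> Ck k U (fun x => L (f x)).
Proof.
move=> oU; elim: k f => [|k IH] f [cf df]; split=> //;
  try by move=> x Ux; apply: (@continuous_comp _ _ _ f L); [exact: cf|exact: cL].
move=> v; split=> [x Ux|]; first by have [] := is_derive_lin ((df v).1 x Ux).
apply: (Ck_ext oU _ (IH _ (df v).2)) => x Ux.
by have [_ ->] := is_derive_lin ((df v).1 x Ux).
Qed.

End PostLinear.

Section Scalar.
Implicit Types (f g : V -> R^o).

Lemma Ck_mul k U f g : open U -> Ck k U f -> Ck k U g ->
  Ck k U (fun x => (f x * g x : R^o)).
Proof.
move=> oU; elim: k f g => [|k IH] f g Cf Cg.
  by split=> // x Ux; apply: cvgM; [exact: Ck_cont Cf Ux|exact: Ck_cont Cg Ux].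
split=> [x Ux|v]; first by apply: cvgM; [exact: Ck_cont Cf Ux|exact: Ck_cont Cg Ux].
have df x := @Ck_derivable _ _ _ _ x v Cf; have dg x := @Ck_derivable _ _ _ _ x v Cg.
split=> [x Ux|]; first by apply: derivableM; [exact: df|exact: dg].
have := Ck_add oU (IH _ _ (CkS Cf) (Ck_D v Cg)) (IH _ _ (CkS Cg) (Ck_D v Cf)).
apply: Ck_ext => // x Ux.
exact: (esym (deriveM (df x Ux) (dg x Ux))).
Qed.

Lemma Ck_prod k U (I : Type) (r : seq I) (F : I -> V -> R^o) : open U ->
  (forall i, Ck k U (F i)) -> Ck k U (fun x => (\prod_(i <- r) F i x : R^o)).
Proof.
move=> oU HF; elim: r => [|i r IH].
  by rewrite (_ : (fun x => _) = fun=> 1); [exact: Ck_cst|apply/funext => x; rewrite big_nil].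
rewrite (_ : (fun x => _) = (fun x => F i x * \prod_(i <- r) F i x)); last first.
  by apply/funext => x; rewrite big_cons.
exact: Ck_mul.
Qed.

Lemma Ck_inv k U f : open U -> (forall x, U x -> f x != 0) -> Ck k U f ->
  Ck k U (fun x => ((f x)^-1 : R^o)).
Proof.
move=> oU nz; elim: k => [|k IH] Cf.
  by split=> // x Ux; apply: cvgV; [exact: nz|exact: Ck_cont Cf Ux].
split=> [x Ux|v]; first by apply: cvgV; [exact: nz|exact: Ck_cont Cf Ux].
have df x := @Ck_derivable _ _ _ _ x v Cf.
have Ci := IH (CkS Cf).
split=> [x Ux|]; first by apply: derivableV; [exact: nz|exact: df].
have := Ck_opp oU (Ck_mul oU (Ck_mul oU Ci Ci) (Ck_D v Cf)).
apply: Ck_ext => // x Ux; rewrite [RHS](deriveV (nz x Ux) (df x Ux)).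
by rewrite scaleNr expr2 invfM.
Qed.

End Scalar.

Section MatrixValued.
Variables (m n : nat).

Definition entry (i : 'I_m) (j : 'I_n) (A : 'M[R]_(m, n)) : R^o := A i j.

Lemma entry_is_linear i j : linear (entry i j).
Proof. by move=> a A B; rewrite /entry !mxE. Qed.
HB.instance Definition _ i j := GRing.isLinear.Build _ _ _ _ _ (entry_is_linear i j).

Lemma Ck_entry k U (F : V -> 'M[R]_(m, n)) i j : open U -> Ck k U F ->
  Ck k U (fun x => (F x i j : R^o)).
Proof. by move=> oU; apply: (Ck_lin (L := entry i j)) => //; exact: coord_continuous. Qed.

Lemma Ck_mx k U (F : V -> 'M[R]_(m, n)) : open U ->
  (forall i j, Ck k U (fun x => (F x i j : R^o))) -> Ck k U F.
Proof.
move=> oU; have cont (G : V -> 'M[R]_(m, n)) x :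
    (forall i j, {for x, continuous (fun x => (G x i j : R^o))}) -> {for x, continuous G}.
  move=> cG; apply/cvgrPdist_le => /= e e0.
  near=> y; apply: mx_norm_le; first exact: ltW.
  move=> i j; rewrite !mxE; move: i j; near: y.
  apply: (@filter_forall _ _ _ (nbhs x) (nbhs_filter x)) => i.
  apply: (@filter_forall _ _ _ (nbhs x) (nbhs_filter x)) => j.
  by have /cvgrPdist_le /(_ _ e0) := cG i j.
elim: k F => [|k IH] F CF.
  by split=> // x Ux; apply: cont => i j; exact: Ck_cont (CF i j) Ux.
split=> [x Ux|v]; first by apply: cont => i j; exact: Ck_cont (CF i j) Ux.
have dF x : U x -> derivable F x v.
  by move=> Ux; apply/derivable_mxP => i j; exact: Ck_derivable (CF i j) Ux.
split=> //; apply: IH => i j.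
apply: (Ck_ext oU _ (Ck_D v (CF i j))) => x Ux.
by rewrite (derive_mx (dF x Ux)) mxE.
Unshelve. all: by end_near.
Qed.

End MatrixValued.

Lemma Ck_mulmx k U m n p (A : V -> 'M[R]_(m, n)) (B : V -> 'M[R]_(n, p)) :
  open U -> Ck k U A -> Ck k U B -> Ck k U (fun x => A x *m B x).
Proof.
move=> oU CA CB; apply: Ck_mx => // i j.
rewrite (_ : (fun x => _) = (fun x => \sum_k A x i k * B x k j)); last first.
  by apply/funext => x; rewrite mxE.
by apply: Ck_sum => // l _; apply: Ck_mul => //; apply: Ck_entry.
Qed.

Lemma Ck_trmx k U m n (A : V -> 'M[R]_(m, n)) :
  open U -> Ck k U A -> Ck k U (fun x => (A x)^T).
Proof.
move=> oU CA; apply: Ck_mx => // i j.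
rewrite (_ : (fun x => _) = (fun x => A x j i)); first exact: Ck_entry.
by apply/funext => x; rewrite mxE.
Qed.

Lemma Ck_scalemx k U m n (a : V -> R^o) (A : V -> 'M[R]_(m, n)) :
  open U -> Ck k U a -> Ck k U A -> Ck k U (fun x => a x *: A x).
Proof.
move=> oU Ca CA; apply: Ck_mx => // i j.
rewrite (_ : (fun x => _) = (fun x => a x * A x i j)).
  by apply: Ck_mul => //; exact: Ck_entry.
by apply/funext => x; rewrite mxE.
Qed.

Lemma Ck_det k U n (A : V -> 'M[R]_n) :
  open U -> Ck k U A -> Ck k U (fun x => (\det (A x) : R^o)).
Proof.
move=> oU CA; apply: Ck_sum => // s _; apply: Ck_mul => //; first exact: Ck_cst.
by apply: Ck_prod => // i; exact: Ck_entry.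
Qed.

(** By Cramer's rule the entries of the inverse are quotients of polynomials in
    the entries. *)
Lemma Ck_invmx k U n (A : V -> 'M[R]_n) : open U ->
  (forall x, U x -> A x \in unitmx) -> Ck k U A -> Ck k U (fun x => invmx (A x)).
Proof.
move=> oU uA CA.
have : Ck k U (fun x => (\det (A x))^-1 *: \adj (A x)).
  apply: Ck_scalemx => //.
    by apply: Ck_inv => //; [move=> x /uA; rewrite unitmxE unitfE|exact: Ck_det].
  apply: Ck_mx => // i j.
  rewrite (_ : (fun x => _) = (fun x => cofactor (A x) j i)); last first.
    by apply/funext => x; rewrite mxE.
  apply: Ck_mul => //; first exact: Ck_cst.
  apply: Ck_det => //; apply: Ck_mx => // a b.
  rewrite (_ : (fun x => _) = (fun x => A x (lift j a) (lift i b))); first exact: Ck_entry.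
  by apply/funext => x; rewrite !mxE.
by apply: Ck_ext => // x /uA uAx; rewrite /invmx uAx.
Qed.

End CkTheory.

(** * Chain rule and symmetry of second derivatives *)
Section Chain.
Variable R : realType.

Lemma is_derive_chain (V W W' : normedModType R) (g : V -> W) (f : W -> W') x v :
  differentiable f (g x) -> derivable g x v ->
  is_derive x v (f \o g) ('d f (g x) ('D_v g x)).
Proof.
move=> df dg.
have dgl : differentiable (fun h : R => g (h *: v + x)) 0.
  exact/derivable1_diffP/(derivable1P _ _ _).1.
have df0 : differentiable f ((fun h : R => g (h *: v + x)) 0).
  by rewrite scale0r add0r.
have dfg : differentiable (fun h : R => f (g (h *: v + x))) 0.
  exact: (differentiable_comp dgl df0).
split; first exact/(derivable1P _ _ _).2/derivable1_diffP.
rewrite derive_along (derive_along g) !deriveE //.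
have -> : (fun h : R => (f \o g) (h *: v + x)) = f \o (fun h : R => g (h *: v + x)) by [].
by rewrite diff_comp //= scale0r add0r.
Qed.

(** Membership in C^1 only speaks of directional derivatives; in finite dimension
    their continuity gives a total differential, hence the chain rule. *)
Lemma C1_differentiable n U (f : 'rV[R]_n -> R^o) x :
  open U -> Ck 1 U f -> U x -> differentiable f x.
Proof.
move=> oU Cf Ux; apply: partials_differentiable.
  have : \forall y \near x, U y by apply: open_nbhs_nbhs; split.
  by apply: filterS => y Uy i; exact: (Ck_derivable Cf).
by move=> i; exact: Ck_cont (Ck_D _ Cf) Ux.
Qed.

Section MatrixValued.
Variables (n m p : nat) (U : set 'rV[R]_n) (F : 'rV[R]_n -> 'M[R]_(m, p)).
Hypotheses (oU : open U) (CF : Ck 1 U F).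

Lemma derive_entry x v i j : U x -> 'D_v F x i j = 'D_v (fun y => F y i j : R^o) x.
Proof. by move=> Ux; rewrite derive_mx ?mxE //; exact: Ck_derivable CF Ux. Qed.

Lemma entry_differentiable x i j : U x -> differentiable (fun y => F y i j : R^o) x.
Proof. by move=> Ux; apply: C1_differentiable Ux => //; exact: Ck_entry. Qed.

Lemma derive_linear x : U x -> linear (fun v => 'D_v F x).
Proof.
move=> Ux a u v; apply/matrixP => i j; rewrite !mxE !derive_entry //.
have d := entry_differentiable i j Ux.
by rewrite !deriveE // linearP.
Qed.

Lemma derive_chain (V : normedModType R) (g : V -> 'rV[R]_n) x v : U (g x) ->
  derivable g x v -> is_derive x v (F \o g) ('D_('D_v g x) F (g x)).
Proof.
move=> Ux dg.
have H i j : is_derive x v (fun y => F (g y) i j : R^o) ('D_('D_v g x) F (g x) i j).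
  have [d1 d2] := is_derive_chain (entry_differentiable i j Ux) dg.
  have d := entry_differentiable i j Ux.
  split; first exact: d1.
  by apply: etrans d2 _; rewrite derive_entry // (deriveE _ d).
have dF : derivable (F \o g) x v by apply/derivable_mxP => i j; have [] := H i j.
split=> //; apply/matrixP => i j; rewrite derive_mx // mxE.
by have [_ ->] := H i j.
Qed.

Lemma derive_coords x v : U x -> 'D_v F x = \sum_a v 0 a *: 'D_(delta_mx 0 a) F x.
Proof.
move=> Ux; pose LM := GRing.isLinear.Build _ _ _ _ _ (derive_linear Ux).
pose L : {linear 'rV[R]_n -> 'M[R]_(m, p)} := HB.pack (fun v => 'D_v F x) LM.
have -> : 'D_v F x = L v by [].
by rewrite {1}(row_sum_delta v) linear_sum; apply: eq_bigr => i _; rewrite linearZ.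
Qed.

End MatrixValued.

Lemma Ck_comp (V : normedModType R) k n m p (U : set 'rV[R]_n) (F : 'rV[R]_n -> 'M[R]_(m, p))
  (U' : set V) (g : V -> 'rV[R]_n) :
  open U -> open U' -> (forall x, U' x -> U (g x)) -> Ck k U F -> Ck k U' g ->
  Ck k U' (F \o g).
Proof.
move=> oU oU' gU; elim: k F => [|k IH] F CF Cg.
  split; last by [].
  move=> x Ux; apply: continuous_comp; first exact: Ck_cont Cg Ux.
  exact: Ck_cont CF (gU _ Ux).
split=> [x Ux|v].
  apply: continuous_comp; first exact: Ck_cont Cg Ux.
  exact: Ck_cont CF (gU _ Ux).
have C1F : Ck 1 U F.
  by clear -CF; elim: k CF => // k IH /CkS.
have D x : U' x -> is_derive x v (F \o g) ('D_('D_v g x) F (g x)).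
  by move=> Ux; apply: (derive_chain oU C1F (gU _ Ux)); exact: Ck_derivable Cg Ux.
split=> [x Ux|]; first by have [] := D x Ux.
have : Ck k U' (fun x => \sum_a ('D_v g x) 0 a *: ('D_(delta_mx 0 a) F \o g) x).
  apply: Ck_sum => // a _; apply: Ck_scalemx => //.
    by apply: Ck_entry => //; exact: Ck_D.
  by apply: IH; [exact: Ck_D|exact: CkS].
apply: Ck_ext => // x Ux; have [_ ->] := D x Ux.
by rewrite (derive_coords oU C1F) //; exact: gU.
Qed.

End Chain.

Section Schwarz.
Variables (R : realType) (V : normedModType R).

Lemma is_derive_translate (W : normedModType R) (f : V -> W) x v w :
  derivable f (x + w) v -> is_derive x v (fun y => f (y + w)) ('D_v f (x + w)).
Proof.
have E : (fun h : R => h^-1 *: (((fun y => f (y + w)) \o shift x) (h *: v)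
            - f (x + w))) = (fun h => h^-1 *: ((f \o shift (x + w)) (h *: v) - f (x + w))).
  by apply/funext => h /=; rewrite addrA.
by move=> df; split; rewrite /derivable /derive E.
Qed.

(** The mean value theorem, first for y |-> f (y + v) - f y along u and then for
    the derivative of f along u, in the direction v. *)
Lemma second_difference (U : set V) (f : V -> R^o) x u v : open U -> Ck 2 U f ->
  (forall a b : R, 0 <= a <= 1 -> 0 <= b <= 1 -> U (x + a *: u + b *: v)) ->
  exists a b : R, [/\ 0 <= a <= 1, 0 <= b <= 1 &
    f (x + u + v) - f (x + u) - f (x + v) + f x = 'D_v ('D_u f) (x + a *: u + b *: v)].
Proof.
move=> oU Cf HU; pose g y : R^o := f (y + v) - f y.
have i0 : 0 <= (0 : R) <= 1 by rewrite lexx ler01.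
have i1 : 0 <= (1 : R) <= 1 by rewrite lexx ler01.
have dg t : 0 <= t <= 1 -> is_derive (x + t *: u) u g
    ('D_u f (x + t *: u + v) - 'D_u f (x + t *: u)).
  move=> t01; apply: is_deriveB.
    apply: is_derive_translate; apply: (Ck_derivable (CkS Cf)).
    by rewrite -[v]scale1r; exact: HU.
  apply: derivableP; apply: (Ck_derivable (CkS Cf)).
  by rewrite -[_ + _]addr0 -(scale0r v); exact: HU.
have [t|a /andP[/ltW a0 /ltW a1]] := @MVT_line R V g x u.
  by move=> t01; have [] := dg t t01.
have a01 : 0 <= a <= 1 by rewrite a0.
have [_ ->] := dg a a01.
have [t t01|b /andP[/ltW b0 /ltW b1] ->] := @MVT_line R V ('D_u f) (x + a *: u) v.
  by apply: (Ck_derivable (Ck_D u Cf)); exact: HU.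
move=> E; exists a, b; split=> //; first by rewrite b0.
by rewrite -E /g; ring.
Qed.

Lemma close_of_scaled (a A B C D e : R) : a != 0 -> a * C = a * D ->
  `|A - D| <= e / 2 -> `|B - C| <= e / 2 -> `|A - B| <= e.
Proof.
move=> a0 /(mulfI a0) -> H1 H2; have -> : A - B = (A - D) - (B - D) by ring.
by rewrite (splitr e) (le_trans (ler_normB _ _)) // lerD.
Qed.

Lemma near_pair (U : set V) (g h : V -> R^o) x (e : R) : open U -> U x ->
  {for x, continuous g} -> {for x, continuous h} -> 0 < e ->
  exists2 r : R, 0 < r & forall y, ball x r y ->
    [/\ U y, `|g x - g y| <= e & `|h x - h y| <= e].
Proof.
move=> oU Ux cg ch e0.
have N1 : \forall y \near x, U y by apply: open_nbhs_nbhs; split.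
have /cvgrPdist_le /(_ _ e0) N2 := cg.
have /cvgrPdist_le /(_ _ e0) N3 := ch.
have : \forall y \near x, [/\ U y, `|g x - g y| <= e & `|h x - h y| <= e].
  by apply: filterS3 N1 N2 N3 => y Uy y2 y3; split.
by move=> /nbhs_ballP[r /= r0 Hr]; exists r.
Qed.

(** The second difference of f is symmetric in u and v.  At scale s it is s^2
    times either mixed derivative at some point near x, and these tend to the
    two mixed derivatives at x. *)
Lemma derive_comm (U : set V) (f : V -> R^o) x u v : open U -> Ck 2 U f -> U x ->
  'D_u ('D_v f) x = 'D_v ('D_u f) x.
Proof.
move=> oU Cf Ux; apply/eqP; rewrite -subr_eq0 -normr_eq0; apply/eqP/le_anti.
rewrite normr_ge0 andbT; apply/ler_addgt0Pr => e e0; rewrite add0r.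
have e20 : 0 < e / 2 by rewrite divr_gt0.
have cuv := Ck_cont (Ck_D u (Ck_D v Cf)) Ux.
have cvu := Ck_cont (Ck_D v (Ck_D u Cf)) Ux.
have [r r0 Hr] := near_pair oU Ux cuv cvu e20.
pose s := r / (2 * (`|u| + `|v| + 1)).
have c0 : 0 < `|u| + `|v| + 1 by rewrite ltr_wpDl // addr_ge0.
have s0 : 0 < s by rewrite divr_gt0 // mulr_gt0.
have inb a b : 0 <= a <= 1 -> 0 <= b <= 1 -> ball x r (x + a *: (s *: u) + b *: (s *: v)).
  move=> /andP[a0 a1] /andP[b0 b1]; rewrite -ball_normE /= -addrA opprD addrA subrr sub0r normrN.
  apply: le_lt_trans (ler_normD _ _) _; rewrite !normrZ !ger0_norm ?(ltW s0) //.
  have H1 : a * (s * `|u|) <= s * `|u| by rewrite ler_piMl // mulr_ge0 // ltW.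
  have H2 : b * (s * `|v|) <= s * `|v| by rewrite ler_piMl // mulr_ge0 // ltW.
  apply: le_lt_trans (lerD H1 H2) _; rewrite -mulrDr /s mulrAC ltr_pdivrMr ?mulr_gt0 //.
  rewrite ltr_pM2l //; have := normr_ge0 u; have := normr_ge0 v; lra.
  exact: ltW.
have sc (w w' y : V) : U y -> 'D_(s *: w) ('D_(s *: w') f) y = s ^+ 2 * 'D_w ('D_w' f) y.
  move=> Uy.
  rewrite (@near_eq_derive _ _ _ _ (s *: 'D_w' f)); last first.
    near=> z; have Uz : U z by near: z; exact: open_nbhs_nbhs.
    have d : derivable f z w' := Ck_derivable (CkS Cf) Uz.
    by have [_ ->] := is_derive_scale s d.
  have dd : derivable ('D_w' f) y w := Ck_derivable (Ck_D w' Cf) Uy.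
  have [dd' E] := is_derive_scale s dd.
  rewrite (deriveZ s dd') E expr2; exact: mulrA.
have Huv a b : 0 <= a <= 1 -> 0 <= b <= 1 -> U (x + a *: (s *: u) + b *: (s *: v)).
  by move=> a01 b01; have [] := Hr _ (inb a b a01 b01).
have Hvu a b : 0 <= a <= 1 -> 0 <= b <= 1 -> U (x + a *: (s *: v) + b *: (s *: u)).
  by move=> a01 b01; rewrite addrAC; exact: Huv.
have [a [b [a01 b01 E1]]] := second_difference oU Cf Huv.
have [b' [a' [b01' a01' E2]]] := second_difference oU Cf Hvu.
have s2 : s ^+ 2 != 0 by rewrite sqrf_eq0 gt_eqF.
have U1 := Huv _ _ a01 b01; have U2 := Huv _ _ a01' b01'.
have E3 : s ^+ 2 * 'D_v ('D_u f) (x + a *: (s *: u) + b *: (s *: v)) =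
    s ^+ 2 * 'D_u ('D_v f) (x + a' *: (s *: u) + b' *: (s *: v)).
  apply: etrans (esym (sc v u _ U1)) _; apply: etrans _ (sc u v _ U2).
  rewrite -E1.
  rewrite [x + a' *: _ + _]addrAC -E2 [x + s *: v + _]addrAC.
  congr (_ + _); exact: addrAC.
have [_ _ H1] := Hr _ (inb a b a01 b01).
have [_ H2 _] := Hr _ (inb a' b' a01' b01').
exact: close_of_scaled s2 E3 H2 H1.
Unshelve. all: by end_near.
Qed.

End Schwarz.

Lemma derive_eq_open (R : realType) (V W : normedModType R) (U : set V) (f g : V -> W) x v :
  open U -> U x -> (forall y, U y -> f y = g y) -> 'D_v f x = 'D_v g x.
Proof.
move=> oU Ux fg; apply: near_eq_derive; near=> y; apply: fg; near: y.
by apply: open_nbhs_nbhs; split.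
Unshelve. all: by end_near.
Qed.

Section SchwarzMatrix.
Variables (R : realType) (n m p : nat).
Notation E := 'rV[R]_n.
Notation M := 'M[R]_(m, p).
Variables (V : set E) (x : E).
Hypotheses (oV : open V) (Vx : V x).

Lemma derive_comm_mx (F : E -> M) u v : Ck 2 V F ->
  'D_u (fun y => 'D_v F y) x = 'D_v (fun y => 'D_u F y) x.
Proof.
move=> CF; apply/matrixP => i j.
have E w y : V y -> 'D_w F y i j = 'D_w (fun y => F y i j : R^o) y.
  by move=> Vy; exact: (derive_entry (CkS CF) w i j Vy).
have E2 w w' : ('D_w (fun y => 'D_w' F y) x) i j = 'D_w (fun y => 'D_w' (fun y => F y i j : R^o) y) x.
  have CD : Ck 1 V (fun y => 'D_w' F y) := Ck_D w' CF.
  have H := @derive_entry R n m p V (fun y => 'D_w' F y) CD x w i j Vx.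
  apply: etrans H _; exact: (derive_eq_open w oV Vx (E w')).
apply: etrans (E2 u v) _; apply: etrans _ (esym (E2 v u)).
exact: (derive_comm u v oV (Ck_entry i j oV CF) Vx).
Qed.

End SchwarzMatrix.

(** * Grid averages on the cube *)
Section Averages.
Variables (R : realType) (n : nat).
Notation E := 'rV[R]_n.
Notation e i := (delta_mx 0 i : E).
Implicit Types (a b i : 'I_n) (s : seq 'I_n) (x y : E) (f g : E -> R).
Variable N : nat.
Hypothesis N0 : (0 < N)%N.

(** Averages over the grid of mesh 1/N replace integrals: increments along an
    edge telescope exactly, and only mean values have to be estimated. *)
Definition step (j : nat) : R := j%:R / N%:R.

Definition avg (a : 'I_n) (f : E -> R) (x : E) : R :=
  N%:R^-1 * \sum_(0 <= j < N) f (x + step j *: e a).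

Definition avgs (s : seq 'I_n) (f : E -> R) : E -> R := foldr avg f s.

(** The box that contains the grid points met by an average over s when the
    coordinates of x in s are 0; unlike the grid it does not depend on N. *)
Definition slice (s : seq 'I_n) (x y : E) :=
  forall i, if i \in s then is_true (0 <= y 0 i < 1) else y 0 i = x 0 i.

Let NR : 0 < N%:R :> R. Proof. by rewrite ltr0n. Qed.

Lemma step_itv j : (j < N)%N -> 0 <= step j < 1.
Proof.
by move=> jN; rewrite /step divr_ge0 //= ltr_pdivrMr // mul1r ltr_nat.
Qed.

Lemma slice_cons a s x y j : a \notin s -> x 0 a = 0 -> (j < N)%N ->
  slice s (x + step j *: e a) y -> slice (a :: s) x y.
Proof.
move=> as_ xa jN Hy i; have := Hy i; rewrite inE !mxE eqxx /=.
have [->|ia] := eqVneq i a; last by rewrite mulr0 addr0.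
by rewrite (negbTE as_) xa add0r mulr1 => ->; exact: step_itv.
Qed.

Lemma avgs_le s (f g : E -> R) x : uniq s -> {in s, forall i, x 0 i = 0} ->
  (forall y, slice s x y -> f y <= g y) -> avgs s f x <= avgs s g x.
Proof.
elim: s x => [|a s IH] x /=; first by move=> _ _; apply => i; rewrite in_nil.
move=> /andP[as_ us] x0 fg; rewrite /avg ler_wpM2l ?invr_ge0 //.
apply: ler_sum_nat => j /andP[_ jN]; apply: IH => // [i si|y Hy].
  rewrite !mxE x0 ?inE ?si ?orbT //; have [ia|ia] := eqVneq i a.
    by move: as_; rewrite -ia si.
  by rewrite mulr0 addr0.
by apply: fg; apply: slice_cons Hy => //; apply: x0; rewrite inE eqxx.
Qed.

Lemma avgs_ext s (f g : E -> R) x : uniq s -> {in s, forall i, x 0 i = 0} ->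
  (forall y, slice s x y -> f y = g y) -> avgs s f x = avgs s g x.
Proof.
by move=> us x0 fg; apply/le_anti/andP; split; apply: avgs_le => // y /fg ->.
Qed.

Lemma avgs_cst s (c : R) x : avgs s (fun=> c) x = c.
Proof.
elim: s x => //= a s IH x; rewrite /avg (eq_bigr (fun=> c)) => [|j _]; last exact: IH.
by rewrite sumr_const_nat subn0 -[c *+ _]mulr_natr mulrCA mulVf ?mulr1 // gt_eqF.
Qed.

Lemma avgs_sum (I : finType) s (f : I -> E -> R) x :
  avgs s (fun y => \sum_i f i y) x = \sum_i avgs s (f i) x.
Proof.
elim: s x => //= a s IH x; rewrite /avg -mulr_sumr exchange_big /=; congr (_ * _).
by apply: eq_bigr => j _; exact: IH.
Qed.

Lemma avgs_scale s (c : R) f x : avgs s (fun y => c * f y) x = c * avgs s f x.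
Proof.
elim: s x => //= a s IH x; rewrite /avg [RHS]mulrCA; congr (_ * _).
rewrite mulr_sumr; by apply: eq_bigr => j _; exact: IH.
Qed.

Lemma avgC a b f : avg a (avg b f) = avg b (avg a f).
Proof.
apply/funext => x; rewrite /avg -!mulr_sumr exchange_big /=; congr (_ * (_ * _)).
by apply: eq_bigr => j _; apply: eq_bigr => k _; rewrite addrAC.
Qed.

Lemma avgs_rem a s f : a \in s -> avgs s f = avgs (rem a s) (avg a f).
Proof.
have C t : avg a (avgs t f) = avgs t (avg a f).
  by elim: t => //= b t <-; rewrite avgC.
elim: s => //= b s IH; rewrite inE eq_sym; case: eqVneq => [->|_] /= ab; first exact: C.
by rewrite IH.
Qed.

(** The discrete fundamental theorem of calculus: the flux through the two faces
    orthogonal to a is the average of the increments. *)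
Lemma avg_telescope a (f : E -> R) x :
  N%:R * avg a (fun y => f (y + N%:R^-1 *: e a) - f y) x = f (x + e a) - f x.
Proof.
rewrite /avg mulrA divff ?gt_eqF // mul1r.
rewrite (eq_big_nat _ _ (F2 := fun j => f (x + step j.+1 *: e a) - f (x + step j *: e a))).
  by rewrite telescope_sumr // /step divff ?gt_eqF // scale1r mul0r scale0r addr0.
move=> j _; congr (f _ - _); rewrite -addrA -scalerDl /step -[in RHS]natr1 mulrDl mul1r //.
Qed.

End Averages.

Section LowerBound.
Variables (R : realType) (n : nat) (m K : nat).
Hypotheses (m0 : (0 < m)%N) (K0 : (0 < K)%N).
Notation N := (2 * m * K)%N.
Notation theta := ((2 * m)%:R^-1 : R).

(** In every direction a fraction theta of the grid points lies in
    [1/2, 1/2 + theta], because N is a multiple of 2 m; so a function that is at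
    least kappa on the small box keeps this proportion of kappa in the mean, for
    all such N at once. *)
Lemma avgs_lower (s : seq 'I_n) (f : 'rV[R]_n -> R) (kappa : R) (x : 'rV[R]_n) :
  0 <= kappa -> uniq s -> {in s, forall i, x 0 i = 0} ->
  (forall y, slice s x y -> 0 <= f y) ->
  (forall y, slice s x y -> {in s, forall i, 1/2 <= y 0 i <= 1/2 + theta} ->
     kappa <= f y) ->
  kappa * theta ^+ size s <= avgs N s f x.
Proof.
have N0 : (0 < N)%N by rewrite !muln_gt0 m0 K0.
have NR : 0 < N%:R :> R by rewrite ltr0n.
move=> k0; elim: s x => [|a s IH] x /=.
  by move=> _ _ _; rewrite expr0 mulr1; apply => // i; rewrite in_nil.
move=> /andP[as_ us] x0 f0 fk; rewrite /avg.
have x0' j : {in s, forall i, (x + step R N j *: delta_mx 0 a) 0 i = 0}.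
  move=> i si; rewrite !mxE x0 ?inE ?si ?orbT //; have [ia|ia] := eqVneq i a.
    by move: as_; rewrite -ia si.
  by rewrite mulr0 addr0.
have xa : x 0 a = 0 by apply: x0; rewrite inE eqxx.
pose h j := avgs N s f (x + step R N j *: delta_mx 0 a).
have h0 j : (j < N)%N -> 0 <= h j.
  move=> jN; rewrite -(avgs_cst N0 s 0 (x + step R N j *: delta_mx 0 a)).
  by apply: avgs_le => // y Hy; apply: f0; exact: slice_cons Hy.
have hk j : (m * K <= j < m * K + K)%N -> kappa * theta ^+ size s <= h j.
  move=> /andP[j1 j2]; have jN : (j < N)%N.
    by apply: leq_trans j2 _; rewrite -mulnA mul2n -addnn leq_add2l leq_pmull.
  apply: IH => // y Hy; first by apply: f0; exact: slice_cons Hy.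
  move=> Hs; apply: fk; first exact: slice_cons Hy.
  move=> i; rewrite inE => /predU1P[->|/Hs //].
  have := Hy a; rewrite (negbTE as_) !mxE !eqxx xa add0r mulr1 => ->.
  have mK : (0 : R) < (m * K)%:R by rewrite ltr0n muln_gt0 m0.
  have e1 : 1 / 2 * N%:R = (m * K)%:R :> R.
    by rewrite -mulnA natrM mulrA div1r mulVf ?pnatr_eq0 // mul1r.
  have e2 : theta * N%:R = K%:R.
    by rewrite [(_ * K)%:R]natrM mulKf // pnatr_eq0 muln_eq0 -lt0n m0.
  rewrite /step; apply/andP; split.
    by rewrite ler_pdivlMr // e1 ler_nat.
  by rewrite ler_pdivrMr // mulrDl e1 e2 -natrD ler_nat ltnW.
have le1 : (m * K + K <= N)%N.
  by rewrite -mulnA mul2n -addnn leq_add2l leq_pmull.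
rewrite -[X in _ <= _^-1 * X]/(\sum_(0 <= j < N) h j).
rewrite (@big_cat_nat _ _ _ (m * K + K) 0 N) //=.
rewrite (@big_cat_nat _ _ _ (m * K) 0 (m * K + K)) ?leq_addr //=.
have H1 : 0 <= \sum_(0 <= j < m * K) h j.
  rewrite big_nat_cond sumr_ge0 // => j /andP[/andP[_ j1] _]; apply: h0.
  by apply: leq_trans j1 _; rewrite -mulnA mul2n -addnn leq_addr.
have H3 : 0 <= \sum_(m * K + K <= j < N) h j.
  by rewrite big_nat_cond sumr_ge0 // => j /andP[/andP[_ j1] _]; apply: h0.
have H2 : K%:R * (kappa * theta ^+ size s) <= \sum_(m * K <= j < m * K + K) h j.
  apply: le_trans (ler_sum_nat hk).
  by rewrite sumr_const_nat addKn -[leRHS]mulr_natl.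
rewrite ler_pdivlMl // exprS.
apply: le_trans (_ : K%:R * (kappa * theta ^+ size s) <= _); last first.
  by rewrite -[leLHS]add0r -[leLHS]addr0 !lerD.
rewrite natrM (mulrC (2 * m)%:R) -mulrA ler_wpM2l //.
by rewrite mulrCA mulVKf ?pnatr_eq0 ?muln_eq0 -?lt0n ?m0.
Qed.

End LowerBound.

(** * Divergence-free fields on the cube have no one-sided outflow *)
Section Uniform.
Variables (R : realType) (n : nat).
Notation E := 'rV[R]_n.

Definition cube : set E := [set y | forall i, 0 <= y 0 i <= 1].

Lemma cube_compact : compact cube.
Proof.
have -> : cube = [set v : E | forall i, `[0, 1]%classic (v ord0 i)].
  by apply/seteqP; split=> v Hv i; have := Hv i; rewrite /= in_itv.
apply: (@rV_compact R n (fun=> `[0, 1]%classic)) => _.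
exact: segment_compact.
Qed.

(** Only y is confined to the cube: the differences of the grid reach points
    outside of it. *)
Lemma uniform_on_cube (g : E -> R) (eps : R) : continuous g -> 0 < eps ->
  exists2 d : R, 0 < d & forall y z, cube y -> `|z - y| < d -> `|g z - g y| <= eps.
Proof.
move=> cg e0; have e2 : 0 < eps / 2 by rewrite divr_gt0.
have := cube_compact; rewrite compact_near_coveringP => cov.
have H : \forall d \near at_right (0 : R), cube `<=`
    (fun y => forall z, `|z - y| < d -> `|g z - g y| <= eps).
  apply: cov.
  move=> x _; have /cvgrPdist_le /(_ _ e2) := cg x.
  move=> /nbhs_ballP[r /= r0 Hr]; have r2 : 0 < r / 2 by rewrite divr_gt0.
  exists (ball x (r / 2), [set d | d < r / 2]) => /=.
    by split; [exact: nbhsx_ballx|exact: nbhs_right_lt].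
  move=> [y d] [/= xy dr] z zy.
  rewrite (splitr eps); apply: le_trans (_ : `|g x - g y| + `|g x - g z| <= _).
    have -> : g z - g y = (g x - g y) - (g x - g z) by ring.
    exact: ler_normB.
  rewrite lerD //; apply: Hr; first by apply: le_ball xy; rewrite ler_pdivrMr // ler_pMr // ler1n.
  move: xy; rewrite -!ball_normE /= => xy.
  rewrite (splitr r) [x - z](_ : _ = (x - y) - (z - y)); last by rewrite opprB addrA subrK.
  by apply: le_lt_trans (ler_normB _ _) _; rewrite ltrD // (lt_trans zy).
have [d [d0 Hd]] : exists d : R, 0 < d /\ (cube `<=`
    (fun y => forall z, `|z - y| < d -> `|g z - g y| <= eps)).
  have := @filter_ex _ (at_right (0:R)) _ _ (filterI (nbhs_right_gt 0) H).
  by move=> [d [d0 Hd]]; exists d.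
by exists d => // y z cy; exact: Hd.
Qed.

End Uniform.

Section Stokes.
Variables (R : realType) (n : nat).
Notation E := 'rV[R]_n.
Notation e i := (delta_mx 0 i : E).
Variable G : 'I_n -> E -> R^o.
Hypothesis CG : forall a, Ck 1 setT (G a).

Definition increment (N : nat) a (y : E) : R := G a (y + N%:R^-1 *: e a) - G a y.

(** By the mean value theorem the rescaled increment is a partial derivative at
    distance at most 1/N, and the partial derivatives are uniformly continuous. *)
Lemma increments_near_divergence (eps : R) : 0 < eps ->
  exists N0 : nat, forall N : nat, (N0 <= N)%N -> (0 < N)%N -> forall y, cube y -> forall a,
    `|N%:R * increment N a y - 'D_(e a) (G a) y| <= eps.
Proof.
move=> e0.
have H a : exists N0 : nat, forall N : nat, (N0 <= N)%N -> (0 < N)%N -> forall y, cube y ->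
    `|N%:R * increment N a y - 'D_(e a) (G a) y| <= eps.
  have cD : continuous ('D_(e a) (G a) : E -> R).
    by move=> x; exact: (Ck_cont (Ck_D (e a) (CG a))).
  have [d d0 Hd] := uniform_on_cube cD e0.
  exists (Num.bound d^-1) => N NN N0 y cy.
  have N0' : 0 < N%:R :> R by rewrite ltr0n.
  have Nd : N%:R^-1 < d.
    rewrite invf_plt ?posrE //; apply: lt_le_trans (_ : (Num.bound d^-1)%:R <= _).
      by apply: archi_boundP; rewrite invr_ge0 ltW.
    by rewrite ler_nat.
  have df z v : derivable (G a) z v by exact: (Ck_derivable (CG a)).
  have [t _|t /andP[/ltW t0 /ltW t1]] := @MVT_line R E (G a) y (N%:R^-1 *: e a).
    exact: df.
  have [_ ->] := is_derive_scale N%:R^-1 (df (y + t *: (N%:R^-1 *: e a)) (e a)).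
  rewrite /increment => ->.
  rewrite [X in `|X - _|](_ : _ = 'D_(e a) (G a) (y + t *: (N%:R^-1 *: e a))); last first.
    by apply: mulVKf; rewrite gt_eqF.
  apply: Hd => //; rewrite [y + _]addrC addrK !normrZ.
  apply: le_lt_trans Nd; rewrite ger0_norm // ger0_norm ?invr_ge0 ?ler0n //.
  have : `|e a| <= 1 :> R.
    by apply: mx_norm_le => // i j; rewrite !mxE; case: (_ && _); rewrite ?normr1 ?normr0.
  move=> ea; rewrite mulrCA ler_piMr ?invr_ge0 ?ler0n // mulr_ile1 //.
exists (\max_a sval (cid (H a)))%N => N NN N0 y cy a.
apply: (svalP (cid (H a))) => //; apply: leq_trans NN.
exact: (leq_bigmax a).
Qed.

End Stokes.

(** The grid average of the divergence is small, and it is that of the flux through the faces,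
    of which only the top one contributes.  There the flux is nonnegative, and
    bounded below near the centre of the face independently of the mesh. *)
Theorem no_positive_outflow (R : realType) n (G : 'I_n.+1 -> 'rV[R]_n.+1 -> R^o) :
  (forall a, Ck 1 setT (G a)) ->
  (forall y, \sum_a 'D_(delta_mx 0 a) (G a) y = 0) ->
  (forall a y, a != 0 -> cube y -> y 0 a = 0 \/ y 0 a = 1 -> G a y = 0) ->
  (forall y, cube y -> y 0 0 = 0 -> G 0 y = 0) ->
  (forall y, cube y -> y 0 0 = 1 -> 0 <= G 0 y) ->
  ~ 0 < G 0 (\row_i if i == 0 then 1 else 1 / 2).
Proof.
move=> CG div0 side bottom top; set c := (\row_i _) => Gc.
pose kappa := (G 0 c : R) / 2.
have k0 : 0 < kappa by rewrite divr_gt0.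
have [m m0 Hm] : exists2 m : nat, (0 < m)%N &
    forall y : 'rV[R]_n.+1, `|y - c| <= (2 * m)%:R^-1 -> kappa <= G 0 y.
  have cG : {for c, continuous (G 0 : _ -> R)} by exact: (Ck_cont (CG 0)).
  have /cvgrPdist_le /(_ _ k0) /nbhs_ballP[r /= r0 Hr] := cG.
  exists (Num.bound r^-1).+1 => // y yc.
  have : ball c r y.
    rewrite -ball_normE /= distrC; apply: le_lt_trans yc _.
    rewrite invf_plt ?posrE ?ltr0n //.
    apply: lt_le_trans (archi_boundP _) _; first by rewrite invr_ge0 ltW.
    by rewrite ler_nat mul2n -addnn addSn leqW // leq_addr.
  by move=> /Hr; rewrite ler_norml => /andP[_]; rewrite /kappa; lra.
pose theta : R := (2 * m)%:R^-1.
have th0 : 0 < theta by rewrite invr_gt0 ltr0n muln_gt0 m0.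
(* L bounds the outflow of the top face from below, for every mesh; eps is such
   that the n.+1 approximation errors add up to L / 2. *)
pose L := kappa * theta ^+ n.
have L0 : 0 < L by rewrite mulr_gt0 // exprn_gt0.
pose eps := L / (2 * n.+1%:R).
have eps0 : 0 < eps by rewrite divr_gt0 // mulr_gt0.
have [K0 HK] := increments_near_divergence CG eps0.
pose N := (2 * m * K0.+1)%N.
have N0 : (0 < N)%N by rewrite !muln_gt0 m0.
have NK : (K0 <= N)%N by apply: leq_trans (leqnSn _) _; rewrite leq_pmull // muln_gt0 m0.
pose s := enum 'I_n.+1.
have us : uniq s by exact: enum_uniq.
have ins a : a \in s by rewrite mem_enum.
have z0 (s' : seq 'I_n.+1) : {in s', forall i, (0 : 'rV[R]_n.+1) 0 i = 0}.
  by move=> i _; rewrite mxE.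
have slice_cube s' (y : 'rV[R]_n.+1) : slice s' 0 y -> cube y.
  move=> Hy i; have := Hy i; case: ifP => _; first by move=> /andP[-> /ltW].
  by rewrite mxE => ->; rewrite lexx ler01.
have upper : avgs N s (fun y => \sum_a N%:R * increment G N a y) 0 <= n.+1%:R * eps.
  rewrite -[leRHS](avgs_cst N0 s _ 0); apply: avgs_le => // y /slice_cube cy.
  have -> : \sum_a N%:R * increment G N a y =
      \sum_a (N%:R * increment G N a y - ('D_(delta_mx 0 a) (G a) y : R)).
    by rewrite sumrB [X in _ - X](div0 y) subr0.
  apply: le_trans (_ : \sum_(a < n.+1) eps <= _); last by rewrite sumr_const card_ord mulr_natl.
  by apply: ler_sum => a _; apply: le_trans (ler_norm _) _; exact: HK.
have flux a : avgs N s (fun y => N%:R * increment G N a y) 0 =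
    avgs N (rem a s) (fun y => G a (y + delta_mx 0 a) - G a y) 0.
  rewrite (avgs_rem N _ (ins a)).
  congr (avgs _ _ _ _); apply/funext => y.
  by rewrite -(avg_telescope N0) -(avgs_scale N [:: a]).
have flux0 a : a != 0 -> avgs N s (fun y => N%:R * increment G N a y) 0 = 0.
  move=> a0; rewrite flux -[RHS](avgs_cst N0 (rem a s) 0 0).
  apply: avgs_ext; rewrite ?rem_uniq // => y Hy.
  have cy := slice_cube _ _ Hy.
  have ya : y 0 a = 0 by have := Hy a; rewrite mem_rem_uniq // !inE eqxx /= mxE.
  rewrite (side a y a0 cy); last by left.
  rewrite (side a _ a0) ?subr0 //; last by right; rewrite !mxE !eqxx ya add0r.
  move=> i; rewrite !mxE eqxx /=; case: eqVneq => [->|_]; first by rewrite ya add0r ler01 lexx.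
  by rewrite addr0; exact: cy.
have lower : L <= avgs N s (fun y => N%:R * increment G N 0 y) 0.
  rewrite flux /L.
  rewrite (_ : theta ^+ n = theta ^+ size (rem 0 s)); last first.
    by rewrite size_rem // size_enum_ord.
  have ur : uniq (rem 0 s) by rewrite rem_uniq.
  have H y : slice (rem 0 s) 0 y -> [/\ cube (y + delta_mx 0 0),
      (y + delta_mx 0 0) 0 0 = 1 & G 0 y = 0].
    move=> Hy; have cy := slice_cube _ _ Hy.
    have y0 : y 0 0 = 0 by have := Hy 0; rewrite mem_rem_uniq // !inE eqxx /= mxE.
    split; [|by rewrite !mxE y0 add0r|exact: bottom].
    move=> i; rewrite !mxE eqxx /=; case: eqVneq => [->|_]; first by rewrite y0 add0r ler01 lexx.
    by rewrite addr0; exact: cy.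
  apply: avgs_lower => //; first exact: ltW.
    by move=> y /H[cy y1 ->]; rewrite subr0; exact: top.
  move=> y Hy Hi; have [cy y1 ->] := H y Hy; rewrite subr0; apply: Hm.
  apply: mx_norm_le; first exact: ltW.
  move=> i j; rewrite ord1.
  have -> : (y + delta_mx 0 0 - c) 0 j = (y + delta_mx 0 0) 0 j - c 0 j by rewrite !mxE.
  rewrite [c 0 j]mxE; case: (eqVneq j 0) => [->|j0].
    by rewrite y1 subrr normr0 ltW.
  rewrite !mxE (negbTE j0) andbF addr0.
  have := Hi j; rewrite mem_rem_uniq // !inE j0 ins => /(_ isT) /andP[h1 h2].
  by rewrite ger0_norm; [rewrite lerBlDl|rewrite subr_ge0].
move: upper; rewrite avgs_sum (bigD1 0) //= big1 ?addr0; last by move=> a; exact: flux0.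
move=> upper; have := le_trans lower upper.
have -> : n.+1%:R * eps = L / 2 by rewrite /eps invfM [L * _]mulrA mulrC divfK ?pnatr_eq0.
by rewrite leNgt; move/negP; apply; rewrite ltr_pdivrMr // ltr_pMr // ltr1n.
Qed.

(** * The wedge of a covector and three two-forms in dimension seven *)
Section Alternating.
Variable R : realType.
Notation I := 'I_7.
Notation o0 := (@Ordinal 7 0 isT).
Notation o1 := (@Ordinal 7 1 isT).
Notation o2 := (@Ordinal 7 2 isT).
Notation o3 := (@Ordinal 7 3 isT).
Notation o4 := (@Ordinal 7 4 isT).
Notation o5 := (@Ordinal 7 5 isT).
Notation o6 := (@Ordinal 7 6 isT).

(** Exterior algebra in top degree: Phi is a covariant tensor evaluated on the
    basis vectors of indices f 0, ..., f 6, and alt Phi is the value on the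
    standard basis of its antisymmetrization. *)
Definition alt (Phi : (I -> I) -> R) : R := \sum_(s : 'S_7) (-1) ^+ s * Phi s.

Implicit Types Phi Psi : (I -> I) -> R.

Lemma alt_ext Phi Psi : (forall s : 'S_7, Phi s = Psi s) -> alt Phi = alt Psi.
Proof. by move=> E; apply: eq_bigr => s _; rewrite E. Qed.

Lemma altD Phi Psi : alt (fun f => Phi f + Psi f) = alt Phi + alt Psi.
Proof. by rewrite /alt -big_split /=; apply: eq_bigr => s _; rewrite mulrDr. Qed.

Lemma altZ c Phi : alt (fun f => c * Phi f) = c * alt Phi.
Proof. by rewrite /alt mulr_sumr; apply: eq_bigr => s _; rewrite mulrCA. Qed.

Lemma alt_perm (c : 'S_7) Phi Psi :
  (forall s : 'S_7, Psi s = Phi (c * s)%g) -> alt Psi = (-1) ^+ c * alt Phi.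
Proof.
move=> E; rewrite /alt [in RHS](reindex_inj (mulgI c)) /= mulr_sumr.
by apply: eq_bigr => s _; rewrite E odd_permM signr_addb mulrA mulrA -expr2 sqrr_sign mul1r.
Qed.

Lemma thrice_eq0 (x : R) : x + x + x = 0 -> x = 0. Proof. by move=> E; lra. Qed.
Lemma eq_opp0 (x : R) : x = - x -> x = 0. Proof. by move=> E; lra. Qed.

(** The three cyclic permutations of a, b, c are even, so they give the same
    alternating sum, whereas the three summands cancel. *)
Lemma alt_cyclic (F : I -> I -> I -> R) (H : I -> I -> I -> I -> R) (a b c d e f g : I) :
  a != b -> b != c -> a != c ->
  d \notin [:: a; b; c] -> e \notin [:: a; b; c] ->
  f \notin [:: a; b; c] -> g \notin [:: a; b; c] ->
  (forall i j k, F i j k + F j k i + F k i j = 0) ->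
  alt (fun s => F (s a) (s b) (s c) * H (s d) (s e) (s f) (s g)) = 0.
Proof.
move=> ab bc ac da ea fa ga F0.
pose Phi (s : I -> I) := F (s a) (s b) (s c) * H (s d) (s e) (s f) (s g).
pose t := (tperm a b * tperm a c)%g.
have out x : x \notin [:: a; b; c] -> t x = x.
  rewrite !inE !negb_or => /and3P[xa xb xc].
  by rewrite /t permM !tpermD // eq_sym.
have ta : t a = b by rewrite /t permM tpermL tpermD // eq_sym.
have tb : t b = c by rewrite /t permM tpermR tpermL.
have tc : t c = a by rewrite /t permM (tpermD ac bc) tpermR.
have st : (-1) ^+ t = 1 :> R by rewrite /t odd_permM !odd_tperm ab ac.
have E1 : alt (fun s => F (s b) (s c) (s a) * H (s d) (s e) (s f) (s g)) = alt Phi.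
  rewrite (alt_perm (c := t) (Phi := Phi)) ?st ?mul1r // => s.
  by rewrite /Phi !(permM t) ta tb tc !out.
have E2 : alt (fun s => F (s c) (s a) (s b) * H (s d) (s e) (s f) (s g)) = alt Phi.
  rewrite -E1 (alt_perm (c := t) (Phi := fun s => F (s b) (s c) (s a) * H (s d) (s e) (s f) (s g))) ?st ?mul1r // => s.
  by rewrite !(permM t) ta tb tc !out.
have : alt Phi + alt Phi + alt Phi = 0.
  rewrite -{2}E1 -{2}E2 -!altD /alt big1 // => s _.
  by rewrite /Phi -!mulrDl F0 mul0r mulr0.
exact: thrice_eq0.
Qed.

Definition wedge (l : I -> R) (A B C : 'M[R]_7) : R :=
  alt (fun f => l (f o0) * (A (f o1) (f o2) * (B (f o3) (f o4) * C (f o5) (f o6)))).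

Variable l : I -> R.
Notation T := (wedge l).

Lemma wedge_lin1 a A A' B C : T (a *: A + A') B C = a * T A B C + T A' B C.
Proof. by rewrite -altZ -altD; apply: alt_ext => s; rewrite !mxE; ring. Qed.
Lemma wedge_lin2 a A B B' C : T A (a *: B + B') C = a * T A B C + T A B' C.
Proof. by rewrite -altZ -altD; apply: alt_ext => s; rewrite !mxE; ring. Qed.
Lemma wedge_lin3 a A B C C' : T A B (a *: C + C') = a * T A B C + T A B C'.
Proof. by rewrite -altZ -altD; apply: alt_ext => s; rewrite !mxE; ring. Qed.

Lemma wedge_swap12 A B C : T A B C = T B A C.
Proof.
rewrite [RHS](alt_perm (c := (tperm o1 o3 * tperm o2 o4)%g)
  (Phi := fun f => l (f o0) * (A (f o1) (f o2) * (B (f o3) (f o4) * C (f o5) (f o6))))).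
  by rewrite odd_permM !odd_tperm /= mul1r.
by move=> s; rewrite !permM !permE /=; ring.
Qed.

Lemma wedge_swap23 A B C : T A B C = T A C B.
Proof.
rewrite [RHS](alt_perm (c := (tperm o5 o3 * tperm o6 o4)%g)
  (Phi := fun f => l (f o0) * (A (f o1) (f o2) * (B (f o3) (f o4) * C (f o5) (f o6))))).
  by rewrite odd_permM !odd_tperm /= mul1r.
by move=> s; rewrite !permM !permE /=; ring.
Qed.

Lemma wedge_tr1 A B C : T A^T B C = - T A B C.
Proof.
rewrite [LHS](alt_perm (c := tperm o1 o2)
  (Phi := fun f => l (f o0) * (A (f o1) (f o2) * (B (f o3) (f o4) * C (f o5) (f o6))))).
  by rewrite odd_tperm /= expr1 mulN1r.
by move=> s; rewrite !permM !permE mxE /=.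
Qed.

Lemma wedge_rank1 (p q : 'rV[R]_7) C : T (p^T *m q) (p^T *m q) C = 0.
Proof.
have : T (p^T *m q) (p^T *m q) C = - T (p^T *m q) (p^T *m q) C.
  rewrite {1}/wedge (alt_perm (c := tperm o1 o3)
  (Phi := fun f => l (f o0) * ((p^T *m q) (f o1) (f o2) * ((p^T *m q) (f o3) (f o4) * C (f o5) (f o6))))).
    by rewrite odd_tperm /= expr1 mulN1r.
  by move=> s; rewrite !permM !permE /= !mxE !big_ord1 !mxE; ring.
exact: eq_opp0.
Qed.

Lemma wedge_det (p q : 'I_3 -> 'rV[R]_7) (M : 'M[R]_7) :
  (forall j, M o0 j = l j) ->
  (forall j, M o1 j = p 0 0 j) -> (forall j, M o2 j = q 0 0 j) ->
  (forall j, M o3 j = p 1 0 j) -> (forall j, M o4 j = q 1 0 j) ->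
  (forall j, M o5 j = p 2 0 j) -> (forall j, M o6 j = q 2 0 j) ->
  T ((p 0)^T *m q 0) ((p 1)^T *m q 1) ((p 2)^T *m q 2) = \det M.
Proof.
move=> M0 M1 M2 M3 M4 M5 M6; apply: eq_bigr => s _; congr (_ * _).
have -> : \prod_(i < 7) M i (s i) = M o0 (s o0) * (M o1 (s o1) * (M o2 (s o2) *
   (M o3 (s o3) * (M o4 (s o4) * (M o5 (s o5) * M o6 (s o6)))))).
  rewrite !big_ord_recl big_ord0 mulr1.
  by repeat (congr (_ * _)); (congr (M _ (s _)) || idtac); apply: val_inj.
by rewrite M0 M1 M2 M3 M4 M5 M6 !mxE !big_ord1 !mxE; ring.
Qed.

End Alternating.

Section Decomposition.
Variables (F : fieldType) (n : nat).

(** Symplectic Gaussian elimination: a nonzero entry A i j splits off the block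
    p /\ q spanned by rows i and j, and the remainder has rank smaller by 2,
    since its kernel contains that of A together with the i-th and j-th basis
    vectors. *)
Lemma antisym_decomp k (A : 'M[F]_n) : (forall i, A i i = 0) -> A^T = - A -> (\rank A <= k.*2)%N ->
  exists p q : 'I_k -> 'rV[F]_n, A = \sum_r ((p r)^T *m q r - (q r)^T *m p r).
Proof.
elim: k A => [|k IH] A dA aA rA.
  exists (fun=> 0), (fun=> 0); rewrite big_ord0; apply/eqP.
  by rewrite -mxrank_eq0 -leqn0.
have [->|A0] := eqVneq A 0.
  by exists (fun=> 0), (fun=> 0); rewrite big1 // => r _; rewrite mulmx0 subrr.
have [i [j Aij]] : exists i j, A i j != 0.
  apply: contrapT => H; move/eqP: A0; apply; apply/matrixP => i j; rewrite mxE.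
  by apply: contrapT => /eqP Aij; apply: H; exists i, j.
have Aji : A j i = - A i j by have := congr1 (fun M : 'M[F]_n => M i j) aA; rewrite !mxE.
pose p := row i A; pose q := (A i j)^-1 *: row j A.
pose A' := A - (p^T *m q - q^T *m p).
have dA' a : A' a a = 0 by rewrite !mxE !big_ord1 !mxE dA mulrC subrr subrr.
have aA' : A'^T = - A'.
  apply/matrixP => a b; have Eab : A b a = - A a b.
    by have := congr1 (fun M : 'M[F]_n => M a b) aA; rewrite !mxE.
  by rewrite !mxE !big_ord1 !mxE Eab; ring.
have eiA' : (delta_mx 0 i : 'rV[F]_n) *m A' = 0.
  apply/rowP => b; rewrite -rowE !mxE !big_ord1 !mxE dA Aji; field.
  exact: Aij.
have ejA' : (delta_mx 0 j : 'rV[F]_n) *m A' = 0.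
  apply/rowP => b; rewrite -rowE !mxE !big_ord1 !mxE dA; field.
  exact: Aij.
pose D : 'M[F]_(1 + 1, n) := col_mx (delta_mx 0 i) (delta_mx 0 j).
have DA (v : 'rV_(1 + 1)) : v *m D *m A = 0 -> v = 0.
  rewrite -[v]hsubmxK; move: (lsubmx v) (rsubmx v) => a b.
  rewrite mul_row_col !mulmxDl -!mulmxA -!rowE => /rowP H.
  have Ha := H j; have Hb := H i; move: Ha Hb; rewrite !mxE !big_ord1 !mxE !dA Aji !mulr0 addr0 add0r.
  move=> /eqP; rewrite mulf_eq0 (negbTE Aij) orbF => /eqP a0 /eqP.
  rewrite mulf_eq0 oppr_eq0 (negbTE Aij) orbF => /eqP b0.
  have -> : a = 0 by apply/rowP => z; rewrite ord1 a0 mxE.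
  have -> : b = 0 by apply/rowP => z; rewrite ord1 b0 mxE.
  exact: row_mx0.
have rD : \rank D = 2.
  by apply/eqP; apply/inj_row_free => v vD; apply: DA; rewrite vD mul0mx.
have sub : (kermx A + D <= kermx A')%MS.
  rewrite addsmx_sub; apply/andP; split; apply/sub_kermxP.
    have kp : kermx A *m p^T = 0.
      by rewrite /p tr_row aA linearN /= mulmxN colE mulmxA mulmx_ker mul0mx oppr0.
    have kq : kermx A *m q^T = 0.
      rewrite /q linearZ /= tr_row aA linearN /= -scalemxAr mulmxN colE mulmxA.
      by rewrite mulmx_ker mul0mx oppr0 scaler0.
    by rewrite /A' !mulmxBr mulmx_ker !mulmxA kp kq !mul0mx !subr0.
  by rewrite mul_col_mx eiA' ejA' col_mx0.
have disj : (kermx A :&: D)%MS = 0.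
  apply/eqP/rowV0P => v; rewrite sub_capmx => /andP[/sub_kermxP vA /submxP[x vx]].
  by rewrite vx in vA *; rewrite (DA _ vA) mul0mx.
have rA' : (\rank A' <= k.*2)%N.
  have := mxrankS sub; rewrite mxrank_disjoint_sum // rD !mxrank_ker.
  have := rank_leq_row A; have := rank_leq_row A'; move: rA; rewrite doubleS; lia.
have [p' [q' EA']] := IH A' dA' aA' rA'.
exists (fun r => if unlift ord0 r is Some r' then p' r' else p),
       (fun r => if unlift ord0 r is Some r' then q' r' else q).
rewrite big_ord_recl unlift_none.
under eq_bigr do rewrite liftK.
by rewrite -EA' /A' addrC subrK.
Qed.

End Decomposition.

Section NonDegenerate.
Variable R : realType.

(** The squares of the decomposable forms A, B, C vanish, so of the cube of their
    sum only the 6 terms with three distinct factors survive; each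
    antisymmetrization contributes a factor 2, and 48 = 6 * 2^3. *)
Lemma wedge_cube_rank1 (l : 'I_7 -> R) (A B C : 'M[R]_7) :
  (forall X, wedge l A A X = 0) -> (forall X, wedge l B B X = 0) ->
  (forall X, wedge l C C X = 0) ->
  let U := A + B + C in wedge l (U - U^T) (U - U^T) (U - U^T) = 48%:R * wedge l A B C.
Proof.
move=> hA hB hC U.
have l1 X Y Z W : wedge l (X + Y) Z W = wedge l X Z W + wedge l Y Z W.
  by rewrite -[X]scale1r wedge_lin1 mul1r scale1r.
have l2 X Y Z W : wedge l Z (X + Y) W = wedge l Z X W + wedge l Z Y W.
  by rewrite -[X]scale1r wedge_lin2 mul1r scale1r.
have l3 X Y Z W : wedge l Z W (X + Y) = wedge l Z W X + wedge l Z W Y.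
  by rewrite -[X]scale1r wedge_lin3 mul1r scale1r.
have s12 := wedge_swap12 l; have s23 := wedge_swap23 l.
have D X Y Z : wedge l (X - X^T) Y Z = 2 * wedge l X Y Z.
  by rewrite addrC -scaleN1r wedge_lin1 wedge_tr1; ring.
have E : wedge l (U - U^T) (U - U^T) (U - U^T) = 8 * wedge l U U U.
  by rewrite D s12 D s23 s12 D; ring.
have hA' X : wedge l A X A = 0 by rewrite s23 hA.
have hB' X : wedge l B X B = 0 by rewrite s23 hB.
have hC' X : wedge l C X C = 0 by rewrite s23 hC.
have hA'' X : wedge l X A A = 0 by rewrite s12 hA'.
have hB'' X : wedge l X B B = 0 by rewrite s12 hB'.
have hC'' X : wedge l X C C = 0 by rewrite s12 hC'.
rewrite E /U !l1 !l2 !l3 !hA !hB !hC !hA' !hB' !hC' !hA'' !hB'' !hC''.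
have -> : wedge l A C B = wedge l A B C by rewrite s23.
have -> : wedge l B A C = wedge l A B C by rewrite s12.
have -> : wedge l B C A = wedge l A B C by rewrite s23 s12.
have -> : wedge l C A B = wedge l A B C by rewrite s12 s23.
have -> : wedge l C B A = wedge l A B C by rewrite s12 s23 s12.
by ring.
Qed.

(** A form of rank at most 6 is p_0 /\ q_0 + p_1 /\ q_1 + p_2 /\ q_2.  Were the wedge
    zero, the covectors dy_0, p_r, q_r would be linearly dependent; a common
    zero u of all of them is in the kernel of A and in the hyperplane
    y_0 = 0. *)
Lemma wedge_nondegenerate (A : 'M[R]_7) : A^T = - A -> (forall j, A 0 j = 0) ->
  (forall u : 'rV_7, u *m A = 0 -> u 0 0 = 0 -> u = 0) ->
  wedge (fun j => (j == 0)%:R) A A A <> 0.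
Proof.
move=> aA A0 ndA; set l := fun j => _.
have dA i : A i i = 0.
  by have := congr1 (fun M : 'M[R]_7 => M i i) aA; rewrite !mxE => E; lra.
have rA : (\rank A <= 3.*2)%N.
  have : (delta_mx 0 0 : 'rV[R]_7) *m A = 0 by apply/rowP => j; rewrite -rowE !mxE A0.
  move=> /sub_kermxP/mxrankS; rewrite mxrank_delta mxrank_ker.
  have := rank_leq_row A; lia.
have [p [q EA]] := antisym_decomp dA aA rA.
pose Th r := (p r)^T *m q r.
have EA' : A = (Th 0 + Th 1 + Th 2) - (Th 0 + Th 1 + Th 2)^T.
  rewrite EA !big_ord_recl big_ord0 addr0 !linearD /= /Th !trmx_mul !trmxK.
  have -> : lift ord0 (ord0 : 'I_2) = 1 by apply/val_inj.
  have -> : lift ord0 (lift ord0 (ord0 : 'I_1)) = 2 by apply/val_inj.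
  by apply/matrixP => i j; rewrite !mxE; ring.
pose f (i : 'I_7) : 'rV[R]_7 := nth 0 [:: \row_j l j; p 0; q 0; p 1; q 1; p 2; q 2] i.
pose M := \matrix_i f i.
have ME i j : M i j = f i 0 j by rewrite mxE.
rewrite {1 2 3}EA' wedge_cube_rank1; try by move=> X; exact: wedge_rank1.
rewrite (@wedge_det _ l p q M); try by move=> j; rewrite ME /f /= ?mxE.
move=> /eqP; rewrite mulf_eq0 pnatr_eq0 /= => /eqP dM.
have : \det M^T = 0 by rewrite det_tr.
move=> /eqP/det0P[u u0 uM].
have uf i : u *m (f i)^T = 0.
  apply/matrixP => a b; rewrite !ord1 [RHS]mxE [LHS]mxE.
  have /rowP/(_ i) := uM; rewrite [X in X = _]mxE [X in _ = X]mxE => H; apply: etrans H; apply: eq_bigr => k _; congr (_ * _).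
  by rewrite !mxE.
have up r : u *m (p r)^T = 0.
  have := uf (@Ordinal 7 1 isT); have := uf (@Ordinal 7 3 isT); have := uf (@Ordinal 7 5 isT).
  rewrite /f /= => h3 h2 h1; case: r => [[|[|[|//]]] lt];
    [rewrite -[RHS]h1|rewrite -[RHS]h2|rewrite -[RHS]h3];
    congr (_ *m (p _)^T); exact/val_inj.
have uq r : u *m (q r)^T = 0.
  have := uf (@Ordinal 7 2 isT); have := uf (@Ordinal 7 4 isT); have := uf (@Ordinal 7 6 isT).
  rewrite /f /= => h3 h2 h1; case: r => [[|[|[|//]]] lt];
    [rewrite -[RHS]h1|rewrite -[RHS]h2|rewrite -[RHS]h3];
    congr (_ *m (q _)^T); exact/val_inj.
have uA : u *m A = 0.
  rewrite EA mulmx_sumr big1 // => r _.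
  by rewrite mulmxBr !mulmxA up uq !mul0mx subr0.
have ul : u 0 0 = 0.
  have := uf (@Ordinal 7 0 isT); rewrite /f /= => /matrixP/(_ 0 0).
  rewrite !mxE (bigD1 0) //= !mxE /l eqxx mulr1 big1 ?addr0 // => k k0.
  by rewrite !mxE (negbTE k0) mulr0.
by move: u0; rewrite (ndA u uA ul) eqxx.
Qed.

End NonDegenerate.

(** * The closed two-form of a family of projections *)
Section Leibniz.
Variables (R : realType) (V : normedModType R).

Lemma is_derive_mul (f g : V -> R^o) x v (df dg : R^o) :
  is_derive x v f df -> is_derive x v g dg ->
  is_derive x v (fun y => (f y * g y : R^o)) (df * g x + f x * dg).
Proof.
move=> Hf Hg; have := is_deriveM Hf Hg.
suff -> : f x *: dg + g x *: df = df * g x + f x * dg by [].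
by rewrite addrC; congr (_ + _); exact: mulrC.
Qed.

Lemma is_derive_bigsum (W : normedModType R) (I : Type) (r : seq I) (F : I -> V -> W)
  (dF : I -> W) x v : (forall i, is_derive x v (F i) (dF i)) ->
  is_derive x v (fun y => \sum_(i <- r) F i y) (\sum_(i <- r) dF i).
Proof.
move=> H; elim: r => [|i r IH].
  rewrite big_nil (_ : (fun y => _) = cst 0); first exact: is_derive_cst.
  by apply/funext => y; rewrite big_nil.
rewrite big_cons (_ : (fun y => _) = (F i \+ (fun y => \sum_(i <- r) F i y))); first exact: is_deriveD.
by apply/funext => y; rewrite big_cons.
Qed.

Lemma is_derive_mxP m n (A : V -> 'M[R]_(m, n)) x v dA :
  is_derive x v A dA <-> forall i j, is_derive x v (fun y => A y i j : R^o) (dA i j).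
Proof.
split=> [[dr <-] i j|H].
  split; first exact: (derivable_mxP A x v).1 dr i j.
  by rewrite derive_mx // mxE.
have dr : derivable A x v by apply/derivable_mxP => i j; have [] := H i j.
split=> //; apply/matrixP => i j; rewrite derive_mx // mxE.
by have [_ ->] := H i j.
Qed.

Lemma is_derive_mulmx m n p (A : V -> 'M[R]_(m, n)) (B : V -> 'M[R]_(n, p)) x v dA dB :
  is_derive x v A dA -> is_derive x v B dB ->
  is_derive x v (fun y => A y *m B y) (dA *m B x + A x *m dB).
Proof.
move=> /is_derive_mxP HA /is_derive_mxP HB; apply/is_derive_mxP => i j.
rewrite (_ : (fun y => _) = (fun y => \sum_k A y i k * B y k j)); last first.
  by apply/funext => y; rewrite mxE.
have -> : (dA *m B x + A x *m dB) i j = \sum_k (dA i k * B x k j + A x i k * dB k j).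
  by rewrite !mxE big_split.
by apply: is_derive_bigsum => k; apply: is_derive_mul.
Qed.

Lemma is_derive_mxtrace n (A : V -> 'M[R]_n) x v dA :
  is_derive x v A dA -> is_derive x v (fun y => \tr (A y) : R^o) (\tr dA).
Proof. by move=> /is_derive_mxP HA; apply: is_derive_bigsum => i; exact: HA. Qed.

End Leibniz.

Section ProjectionForm.
Variables (R : realType) (n N : nat).
Notation E := 'rV[R]_n.
Variables (K : 'M[R]_N) (P : E -> 'M[R]_N).

(** For a family P of projections this is the trace of K composed with the
    curvature P dP dP of the connection P d on the bundle of images of P.  When
    K is the complex structure of the fibres it represents, up to a constant,
    the first Chern class of this bundle. *)
Definition proj_form (y u v : E) : R :=
  \tr (K *m P y *m ('D_u P y *m 'D_v P y - 'D_v P y *m 'D_u P y)).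

Hypothesis PP : forall y, P y *m P y = P y.
Hypothesis KP : forall y, K *m P y = P y *m K.
Hypothesis CP : Ck 2 setT P.

Let dP y v : is_derive y v P ('D_v P y).
Proof. by apply: derivableP; exact: (Ck_derivable CP). Qed.

Let ddP y u v : is_derive y u ('D_v P) ('D_u ('D_v P) y).
Proof. by apply: derivableP; exact: (Ck_derivable (Ck_D v CP)). Qed.

Lemma derive_idempotent y v : 'D_v P y = 'D_v P y *m P y + P y *m 'D_v P y.
Proof.
have [_ <-] := is_derive_mulmx (dP y v) (dP y v).
by congr ('D_v _ y); apply/funext => z; rewrite PP.
Qed.

(** The hypotheses on X, Y, Z say that they exchange the image and the kernel of
    Q, as do all derivatives of a family of projections.  So does a product of
    three of them, and K preserves both spaces: the diagonal blocks are zero. *)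
Lemma mxtrace_odd (Q X Y Z : 'M[R]_N) : Q *m Q = Q -> K *m Q = Q *m K ->
  X = X *m Q + Q *m X -> Y = Y *m Q + Q *m Y -> Z = Z *m Q + Q *m Z ->
  \tr (K *m (X *m Y *m Z)) = 0.
Proof.
move=> QQ KQ hX hY hZ.
have shift A : A = A *m Q + Q *m A -> Q *m A = A - A *m Q.
  by move=> h; rewrite {2}h addrC addKr.
set W := X *m Y *m Z.
have QXY : Q *m X *m Y = X *m Y *m Q.
  by rewrite (shift _ hX) mulmxBl -[X *m Q *m Y]mulmxA (shift _ hY) mulmxBr opprB addrC subrK mulmxA.
have QW : Q *m W = W - W *m Q.
  by rewrite /W !mulmxA QXY -[_ *m Q *m Z]mulmxA (shift _ hZ) mulmxBr !mulmxA.
have QWQ : Q *m W *m Q = 0 by rewrite QW mulmxBl -[W *m Q *m Q]mulmxA QQ subrr.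
have t1 : \tr (K *m (Q *m W)) = 0.
  have -> : K *m (Q *m W) = Q *m (K *m (Q *m W)).
    by rewrite [RHS]mulmxA -KQ -mulmxA [Q *m (Q *m W)]mulmxA QQ.
  by rewrite mxtrace_mulC -mulmxA QWQ mulmx0 mxtrace0.
have t2 : \tr (K *m (W *m Q)) = 0.
  by rewrite mulmxA mxtrace_mulC mulmxA -KQ -mulmxA t1.
have -> : W = Q *m W + W *m Q by rewrite QW subrK.
by rewrite mulmxDr linearD /= t1 t2 addr0.
Qed.

(** Here X, Y, Z stand for first derivatives of P, and Dxy, ... for its second
    derivatives.  The terms with three first derivatives vanish by parity, those
    with second derivatives cancel by symmetry. *)
Lemma closed_algebra (Q X Y Z Dxy Dyx Dxz Dzx Dyz Dzy : 'M[R]_N) : Q *m Q = Q ->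
  K *m Q = Q *m K -> X = X *m Q + Q *m X -> Y = Y *m Q + Q *m Y -> Z = Z *m Q + Q *m Z ->
  Dxy = Dyx -> Dxz = Dzx -> Dyz = Dzy ->
  \tr (K *m X *m (Y *m Z - Z *m Y)) +
    \tr (K *m Q *m (Dxy *m Z + Y *m Dxz - (Dxz *m Y + Z *m Dxy))) +
  (\tr (K *m Y *m (Z *m X - X *m Z)) +
    \tr (K *m Q *m (Dyz *m X + Z *m Dyx - (Dyx *m Z + X *m Dyz)))) +
  (\tr (K *m Z *m (X *m Y - Y *m X)) +
    \tr (K *m Q *m (Dzx *m Y + X *m Dzy - (Dzy *m X + Y *m Dzx)))) = 0.
Proof.
move=> QQ KQ hX hY hZ -> -> ->.
have odd A B C : A = A *m Q + Q *m A -> B = B *m Q + Q *m B -> C = C *m Q + Q *m C ->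
    \tr (K *m A *m (B *m C - C *m B)) = 0.
  move=> hA hB hC; rewrite mulmxBr linearB /= -!(mulmxA K) !(mulmxA A).
  by rewrite (mxtrace_odd QQ KQ hA hB hC) (mxtrace_odd QQ KQ hA hC hB) subrr.
rewrite (odd X Y Z) // (odd Y Z X) // (odd Z X Y) // !add0r.
rewrite -!mxtraceD -!mulmxDr.
set S := (X in K *m Q *m X); have -> : S = 0.
  by apply/matrixP => i j; rewrite !mxE; ring.
by rewrite mulmx0 mxtrace0.
Qed.

Lemma derive_proj_form y u v w : is_derive y w (fun z => proj_form z u v : R^o)
  (\tr (K *m 'D_w P y *m ('D_u P y *m 'D_v P y - 'D_v P y *m 'D_u P y)) +
   \tr (K *m P y *m ('D_w ('D_u P) y *m 'D_v P y + 'D_u P y *m 'D_w ('D_v P) y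
       - ('D_w ('D_v P) y *m 'D_u P y + 'D_v P y *m 'D_w ('D_u P) y)))).
Proof.
have cK : is_derive y w (fun=> K) 0 by exact: is_derive_cst.
have H1 := is_derive_mulmx cK (dP y w).
have H2 := is_deriveB (is_derive_mulmx (ddP y w u) (ddP y w v))
                      (is_derive_mulmx (ddP y w v) (ddP y w u)).
have := is_derive_mxtrace (is_derive_mulmx H1 H2).
by rewrite mul0mx add0r linearD.
Qed.

Lemma derive2_comm y u v : 'D_u ('D_v P) y = 'D_v ('D_u P) y.
Proof. exact: (@derive_comm_mx R n N N setT y openT I P u v CP). Qed.

(** The exterior derivative of the form is the cyclic sum of its derivatives. *)
Lemma proj_form_closed y u v w :
  'D_u (fun z => proj_form z v w : R^o) y + 'D_v (fun z => proj_form z w u : R^o) y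
  + 'D_w (fun z => proj_form z u v : R^o) y = 0.
Proof.
have [_ E1] := derive_proj_form y v w u.
have [_ E2] := derive_proj_form y w u v.
have [_ E3] := derive_proj_form y u v w.
apply: etrans (f_equal2 +%R (f_equal2 +%R E1 E2) E3) _ => {E1 E2 E3}.
exact: (closed_algebra (PP y) (KP y) (derive_idempotent y u) (derive_idempotent y v)
  (derive_idempotent y w) (derive2_comm y u v) (derive2_comm y u w) (derive2_comm y v w)).
Qed.

Lemma Ck_proj_form k u v : Ck k.+1 setT P -> Ck k setT (fun y => proj_form y u v : R^o).
Proof.
move=> CPk; have oT := @openT E; have Cu w : Ck k setT ('D_w P) by exact: Ck_D.
have CB : Ck k setT (fun y => K *m P y *m ('D_u P y *m 'D_v P y - 'D_v P y *m 'D_u P y)).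
  apply: Ck_mulmx => //.
    by apply: Ck_mulmx => //; [exact: Ck_cst|exact: CkS].
  by apply: Ck_add => //; last apply: Ck_opp => //; apply: Ck_mulmx.
by apply: Ck_sum => // i _; exact: Ck_entry.
Qed.

End ProjectionForm.

(** * The divergence-free field of three closed two-forms *)
Section WedgeField.
Variable R : realType.
Notation E := 'rV[R]_7.
Notation e i := (delta_mx 0 i : E).
Notation o0 := (@Ordinal 7 0 isT).
Notation o1 := (@Ordinal 7 1 isT).
Notation o2 := (@Ordinal 7 2 isT).
Notation o3 := (@Ordinal 7 3 isT).
Notation o4 := (@Ordinal 7 4 isT).
Notation o5 := (@Ordinal 7 5 isT).
Notation o6 := (@Ordinal 7 6 isT).

Definition closed_form (A : E -> 'M[R]_7) := forall y i j k,
  'D_(e i) (fun z => A z j k : R^o) y + 'D_(e j) (fun z => A z k i : R^o) y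
  + 'D_(e k) (fun z => A z i j : R^o) y = 0.

(** The vector field dual to the 6-form A /\ B /\ C on R^7; its divergence is the
    exterior derivative of that form. *)
Definition wedge_field (A B C : E -> 'M[R]_7) (a : 'I_7) (y : E) : R^o :=
  wedge (fun j => (j == a)%:R) (A y) (B y) (C y).

Variables A B C : E -> 'M[R]_7.
Hypotheses (CA : Ck 1 setT A) (CB : Ck 1 setT B) (CC : Ck 1 setT C).

Lemma Ck_wedge_field a : Ck 1 setT (wedge_field A B C a).
Proof.
have oT := @openT E.
apply: Ck_sum => // s _; do 2 (apply: Ck_mul; [exact: oT|exact: Ck_cst|]).
by do 2 (apply: Ck_mul; [exact: oT|exact: Ck_entry|]); exact: Ck_entry.
Qed.

Hypotheses (dA : closed_form A) (dB : closed_form B) (dC : closed_form C).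

Let dentry (M : E -> 'M[R]_7) (CM : Ck 1 setT M) y v i j :
  is_derive y v (fun z => M z i j : R^o) ('D_v (fun z => M z i j : R^o) y).
Proof.
apply: derivableP; apply: (@Ck_derivable _ _ _ 0 setT) => //.
exact: (Ck_entry i j (@openT E) CM).
Qed.

Lemma divergence_term (F1 F2 F3 : E -> R^o) (c b : R) y v d1 d2 d3 :
  is_derive y v F1 d1 -> is_derive y v F2 d2 -> is_derive y v F3 d3 ->
  is_derive y v (fun z => (c * (b * (F1 z * (F2 z * F3 z))) : R^o))
    (c * (b * (d1 * (F2 y * F3 y) + (F1 y * (d2 * F3 y) + F1 y * (F2 y * d3))))).
Proof.
move=> h1 h2 h3; have cc (w : R) : is_derive y v (fun=> (w : R^o)) 0 by exact: is_derive_cst.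
have H := is_derive_mul (cc c) (is_derive_mul (cc b) (is_derive_mul h1 (is_derive_mul h2 h3))).
apply: (is_derive_eq H); rewrite !mul0r !add0r.
by congr (c * (b * (_ + _))); exact: mulrDr.
Qed.

(** By the Leibniz rule d (A /\ B /\ C) is a sum of three terms, each with the
    derivative of one factor, in which the antisymmetrization produces the cyclic
    sum that is zero for a closed form. *)
Lemma wedge_field_divergence y : \sum_a 'D_(e a) (wedge_field A B C a) y = 0.
Proof.
pose D (M : E -> 'M[R]_7) i j k : R := 'D_(e i) (fun z => M z j k : R^o) y.
pose term i (s : 'I_7 -> 'I_7) : R :=
  D A i (s o1) (s o2) * (B y (s o3) (s o4) * C y (s o5) (s o6)) +
  (A y (s o1) (s o2) * (D B i (s o3) (s o4) * C y (s o5) (s o6)) +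
   A y (s o1) (s o2) * (B y (s o3) (s o4) * D C i (s o5) (s o6))).
have Ea a : 'D_(e a) (wedge_field A B C a) y =
    \sum_(s : 'S_7) (-1) ^+ s * ((s o0 == a)%:R * term a s).
  have H : is_derive y (e a) (wedge_field A B C a)
      (\sum_(s : 'S_7) (-1) ^+ s * ((s o0 == a)%:R * term a s)).
    by apply: is_derive_bigsum => s; apply: divergence_term; exact: dentry.
  by have [_ ->] := H.
rewrite (eq_bigr _ (fun a _ => Ea a)) exchange_big /=.
have -> : \sum_(s : 'S_7) \sum_a (-1) ^+ s * ((s o0 == a)%:R * term a s) =
    alt (fun s => term (s o0) s).
  apply: eq_bigr => s _; rewrite (bigD1 (s o0)) //= eqxx mul1r big1 ?addr0 // => a.
  by rewrite eq_sym => /negbTE ->; rewrite mul0r mulr0.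
rewrite !altD; set t1 := alt _; set t2 := alt _; set t3 := alt _.
have -> : t1 = 0.
  exact: (@alt_cyclic R (D A) (fun i j k l => B y i j * C y k l) o0 o1 o2 o3 o4 o5 o6
    isT isT isT isT isT isT isT (dA y)).
have -> : t2 = 0.
  rewrite -[RHS](@alt_cyclic R (D B) (fun i j k l => A y i j * C y k l) o0 o3 o4 o1 o2 o5 o6
    isT isT isT isT isT isT isT (dB y)).
  by apply: alt_ext => s; exact: mulrCA.
have -> : t3 = 0.
  rewrite -[RHS](@alt_cyclic R (D C) (fun i j k l => A y i j * B y k l) o0 o5 o6 o1 o2 o3 o4
    isT isT isT isT isT isT isT (dC y)).
  by apply: alt_ext => s; rewrite mulrA; exact: mulrC.
by rewrite !addr0.
Qed.

End WedgeField.

Section ProjectionFormMatrix.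
Variables (R : realType) (N : nat) (K : 'M[R]_N) (P : 'rV[R]_7 -> 'M[R]_N).
Notation e i := (delta_mx 0 i : 'rV[R]_7).

Definition form_matrix (y : 'rV[R]_7) : 'M[R]_7 := \matrix_(i, j) proj_form K P y (e i) (e j).

Lemma mxtrace_subC (T X Y : 'M[R]_N) : \tr (T *m (X - Y)) = - \tr (T *m (Y - X)).
Proof. by rewrite -opprB mulmxN linearN. Qed.

Lemma form_matrix_antisym y : (form_matrix y)^T = - form_matrix y.
Proof.
by apply/matrixP => i j; rewrite !mxE; exact: mxtrace_subC.
Qed.

Hypothesis PP : forall y, P y *m P y = P y.
Hypothesis KP : forall y, K *m P y = P y *m K.
Hypothesis CP : Ck 2 setT P.

Lemma Ck_form_matrix : Ck 1 setT form_matrix.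
Proof.
apply: Ck_mx => [|i j]; first exact: openT.
rewrite (_ : (fun x => _) = (fun y => proj_form K P y (e i) (e j))); first exact: Ck_proj_form.
by apply/funext => y; rewrite mxE.
Qed.

Lemma form_matrix_closed : closed_form form_matrix.
Proof.
move=> y i j k.
have E a b : (fun z => form_matrix z a b : R^o) = (fun z => proj_form K P z (e a) (e b) : R^o).
  by apply/funext => z; rewrite mxE.
rewrite !E; exact: proj_form_closed.
Qed.

(** The form is bilinear, because directional derivatives are linear in the
    direction. *)
Lemma form_matrixE y u v : proj_form K P y u v = (u *m form_matrix y *m v^T) 0 0.
Proof.
have C1 : Ck 1 setT P by exact: CkS.
have E1 w := @derive_coords R 7 N N setT P openT C1 y w I.
pose S (X Y : 'M[R]_N) := \tr (K *m P y *m (X *m Y - Y *m X)).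
have Sl a b c d : S (a *: b + c) d = a * S b d + S c d.
  rewrite /S -mxtraceZ -mxtraceD scalemxAr -mulmxDr; congr (\tr (_ *m _)).
  by rewrite mulmxDl mulmxDr -scalemxAl -scalemxAr scalerBr opprD addrACA.
have S0l d : S 0 d = 0 by rewrite /S mul0mx mulmx0 subrr mulmx0 mxtrace0.
have Sa a b : S a b = - S b a by exact: mxtrace_subC.
have Ssum (r : seq 'I_7) F d : S (\sum_(i <- r) u 0 i *: F i) d = \sum_(i <- r) u 0 i * S (F i) d.
  by elim: r => [|i r IH]; rewrite ?big_nil // !big_cons Sl IH.
have Ssum' (r : seq 'I_7) F d : S d (\sum_(i <- r) v 0 i *: F i) = \sum_(i <- r) v 0 i * S d (F i).
  elim: r => [|i r IH]; first by rewrite !big_nil Sa S0l oppr0.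
  by rewrite !big_cons Sa Sl opprD -mulrN -!Sa IH.
rewrite /proj_form -/(S _ _) (E1 u) (E1 v) Ssum mxE.
transitivity (\sum_i \sum_j u 0 i * (v 0 j * form_matrix y i j)).
  by apply: eq_bigr => i _; rewrite Ssum' mulr_sumr; apply: eq_bigr => j _; rewrite mxE.
rewrite exchange_big; apply: eq_bigr => j _; rewrite !mxE mulr_suml.
by apply: eq_bigr => i _; rewrite mulrA mulrAC.
Qed.

End ProjectionFormMatrix.

(** * The Euclidean product of R^7 *)
Section Dot.
Variable R : realType.
Notation E := 'rV[R]_7.
Implicit Types u v w : E.

Lemma dotE u v : dot u v = \sum_i u 0 i * v 0 i.
Proof. by rewrite /dot mxE; apply: eq_bigr => i _; rewrite mxE. Qed.

Lemma dotC u v : dot u v = dot v u.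
Proof. by rewrite !dotE; apply: eq_bigr => i _; rewrite mulrC. Qed.

Lemma dotDl u v w : dot (u + v) w = dot u w + dot v w.
Proof. by rewrite /dot mulmxDl mxE. Qed.

Lemma dotZl a u v : dot (a *: u) v = a * dot u v.
Proof. by rewrite /dot -scalemxAl mxE. Qed.

Lemma dotDr u v w : dot w (u + v) = dot w u + dot w v.
Proof. by rewrite !(dotC w) dotDl. Qed.

Lemma dotZr a u v : dot v (a *: u) = a * dot v u.
Proof. by rewrite !(dotC v) dotZl. Qed.

Lemma dotNl u v : dot (- u) v = - dot u v.
Proof. by rewrite -scaleN1r dotZl mulN1r. Qed.

Lemma dot0l v : dot 0 v = 0. Proof. by rewrite /dot mul0mx mxE. Qed.
Lemma dot0r v : dot v 0 = 0. Proof. by rewrite dotC dot0l. Qed.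

Lemma dot_ge0 u : 0 <= dot u u.
Proof. by rewrite dotE sumr_ge0 // => i _; rewrite -expr2 sqr_ge0. Qed.

Lemma dot_eq0 u : (dot u u == 0) = (u == 0).
Proof.
rewrite dotE psumr_eq0; last by move=> i _; rewrite -expr2 sqr_ge0.
apply/allP/eqP => [H|-> i _]; last by rewrite !mxE mul0r eqxx.
apply/rowP => i; rewrite mxE; have := H i (mem_index_enum _).
by rewrite mulf_eq0 orbb => /eqP.
Qed.

Lemma dot_gt0 u : u != 0 -> 0 < dot u u.
Proof. by move=> u0; rewrite lt_neqAle dot_ge0 andbT eq_sym dot_eq0. Qed.

Lemma dot_delta u i : dot u (delta_mx 0 i) = u 0 i.
Proof.
rewrite dotE (bigD1 i) //= mxE !eqxx mulr1 big1 ?addr0 // => j ji.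
by rewrite mxE eqxx (negbTE ji) mulr0.
Qed.

Lemma is_derive_dot (V : normedModType R) (f g : V -> E) (x d : V) df dg :
  is_derive x d f df -> is_derive x d g dg ->
  is_derive x d (fun y => dot (f y) (g y) : R^o) (dot df (g x) + dot (f x) dg).
Proof.
move=> /is_derive_mxP Hf /is_derive_mxP Hg.
rewrite !dotE -big_split /=.
rewrite (_ : (fun y => _) = (fun y => \sum_i f y 0 i * g y 0 i)); last first.
  by apply/funext => y; rewrite dotE.
by apply: is_derive_bigsum => i; exact: (is_derive_mul (Hf 0 i) (Hg 0 i)).
Qed.

Lemma Ck_dot (V : normedModType R) k U (f g : V -> E) : open U -> Ck k U f -> Ck k U g ->
  Ck k U (fun y => dot (f y) (g y) : R^o).
Proof.
move=> oU Cf Cg.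
apply: (@Ck_entry _ _ _ _ _ _ (fun y => f y *m (g y)^T)) => //.
by apply: Ck_mulmx => //; exact: Ck_trmx.
Qed.

Lemma is_derive_addp (V W : normedModType R) (f g : V -> W) (x h : V) df dg :
  is_derive x h f df -> is_derive x h g dg -> is_derive x h (fun y => f y + g y) (df + dg).
Proof. by move=> hf hg; exact: is_deriveD. Qed.

Lemma is_derive_subp (V W : normedModType R) (f g : V -> W) (x h : V) df dg :
  is_derive x h f df -> is_derive x h g dg -> is_derive x h (fun y => f y - g y) (df - dg).
Proof. by move=> hf hg; exact: is_deriveB. Qed.

Lemma is_derive_unique (V W : normedModType R) (f : V -> W) (x h : V) d d' :
  is_derive x h f d -> is_derive x h f d' -> d = d'.
Proof. by move=> [_ <-] [_ <-]. Qed.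

End Dot.

(** * A map from the cube onto the sphere *)
Section Cap.
Variable R : realType.
Notation E := 'rV[R]_7.
Implicit Types y z v : E.

(** The inverse stereographic projection of centered y / bump y, written without
    that quotient.  It depends only on the coordinates 1, ..., 6.  On the
    boundary of the cube bump is zero, so the whole boundary goes to the pole
    e_0, and the formula is smooth everywhere. *)
Definition centered y : E := \row_i (if i == 0 then 0 else 2 * y 0 i - 1).
Definition bump y : R := \prod_i (1 - centered y 0 i ^+ 2).
Definition cap_den y : R := bump y ^+ 2 + dot (centered y) (centered y).
Definition cap y : E := (cap_den y)^-1 *:
  ((2 * bump y) *: centered y
   + (dot (centered y) (centered y) - bump y ^+ 2) *: delta_mx 0 0).

Definition velocity v : E := \row_i (if i == 0 then 0 else 2 * v 0 i).

Lemma cap_den_gt0 y : 0 < cap_den y.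
Proof.
have [x0|x0] := eqVneq (centered y) 0; last by rewrite ltr_wpDl ?sqr_ge0 // dot_gt0.
rewrite ltr_wpDr ?dot_ge0 // /bump x0 big1 ?expr1n // => i _.
by rewrite mxE expr0n subr0.
Qed.

Lemma centered0 y : centered y 0 0 = 0. Proof. by rewrite mxE eqxx. Qed.

Lemma cap_sphere y : dot (cap y) (cap y) = 1.
Proof.
have s0 := lt0r_neq0 (cap_den_gt0 y).
rewrite /cap dotZl dotZr !(dotDl, dotDr, dotZl, dotZr).
rewrite (dotC (delta_mx 0 0) (centered y)) !dot_delta centered0 mxE !eqxx.
by move: s0; rewrite /cap_den /= => s0; field.
Qed.

Lemma is_derive_centered y v : is_derive y v centered (velocity v).
Proof.
apply/is_derive_mxP => i j; rewrite ord1 !mxE.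
rewrite (_ : (fun z => _) = (fun z : E => (if j == 0 then 0 else 2 * z 0 j - 1) : R^o)); last first.
  by apply/funext => z; rewrite mxE.
case: eqP => _; first exact: is_derive_cst.
have hid : is_derive y v (fun z : E => z 0 j : R^o) (v 0 j).
  by have /is_derive_mxP := is_derive_id y v; exact.
have c2 : is_derive y v (fun=> (2 : R^o)) 0 by exact: is_derive_cst.
have c1 : is_derive y v (fun=> (1 : R^o)) 0 by exact: is_derive_cst.
have := is_derive_subp (is_derive_mul c2 hid) c1.
by rewrite mul0r add0r subr0.
Qed.

Lemma Ck_centered k : Ck k setT centered.
Proof.
have oT := @openT E.
suff H : forall i, Ck k setT (fun z : E => centered z 0 i : R^o).
  by apply: Ck_mx => // i j; rewrite ord1; exact: H.
move=> i; rewrite (_ : (fun z => _) = (fun z : E => (if i == 0 then 0 else 2 * z 0 i - 1) : R^o)); last first.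
  by apply/funext => z; rewrite mxE.
case: eqP => _; first exact: Ck_cst.
have Cid := @Ck_id R E k setT.
apply: Ck_add => //; last exact: Ck_cst.
by apply: Ck_mul => //; [exact: Ck_cst|exact: (Ck_entry 0 i oT Cid)].
Qed.

Lemma Ck_bump k : Ck k setT (bump : E -> R^o).
Proof.
have oT := @openT E; apply: Ck_prod => // i.
apply: Ck_add => //; first exact: Ck_cst.
by apply: Ck_opp => //; apply: Ck_mul => //; apply: Ck_entry => //; exact: Ck_centered.
Qed.

Lemma Ck_cap_den k : Ck k setT (cap_den : E -> R^o).
Proof.
have oT := @openT E; apply: Ck_add => //.
  by apply: Ck_mul => //; exact: Ck_bump.
by apply: Ck_dot => //; exact: Ck_centered.
Qed.

Lemma Ck_cap k : Ck k setT cap.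
Proof.
have oT := @openT E; apply: Ck_scalemx => //.
  apply: Ck_inv => //; last exact: Ck_cap_den.
  by move=> x _; exact: lt0r_neq0 (cap_den_gt0 x).
apply: Ck_add => //; apply: Ck_scalemx => //.
- by apply: Ck_mul => //; [exact: Ck_cst|exact: Ck_bump].
- exact: Ck_centered.
- apply: Ck_add => //; first by apply: Ck_dot => //; exact: Ck_centered.
  by apply: Ck_opp => //; apply: Ck_mul => //; exact: Ck_bump.
- exact: Ck_cst.
Qed.

(** Along a radial direction all factors of bump decrease together; the sign of
    m is what excludes a critical point of centered / bump. *)
Lemma bump_derive y v lam : (forall i, 0 < 1 - centered y 0 i ^+ 2) ->
  (forall i, velocity v 0 i = lam * centered y 0 i) ->
  exists2 m, 0 <= m & is_derive y v (bump : E -> R^o) (- (lam * m)).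
Proof.
move=> x1 vx; rewrite /bump; elim: (index_enum _) => [|i r [m m0 IH]].
  exists 0 => //; rewrite (_ : (fun z => _) = fun=> 1); first by rewrite mulr0 oppr0; exact: is_derive_cst.
  by apply/funext => z; rewrite big_nil.
exists (2 * centered y 0 i ^+ 2 * \prod_(j <- r) (1 - centered y 0 j ^+ 2)
        + (1 - centered y 0 i ^+ 2) * m).
  apply: addr_ge0; apply: mulr_ge0 => //; last exact: ltW.
    by rewrite mulr_ge0 ?sqr_ge0.
  by apply: prodr_ge0 => j _; exact: ltW.
rewrite (_ : (fun z => _) = (fun z => (1 - centered z 0 i ^+ 2) *
    \prod_(j <- r) (1 - centered z 0 j ^+ 2))); last first.
  by apply/funext => z; rewrite big_cons.
have hx : is_derive y v (fun z : E => centered z 0 i : R^o) (velocity v 0 i).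
  by have /is_derive_mxP := is_derive_centered y v; exact.
have c1 : is_derive y v (fun=> (1 : R^o)) 0 by exact: is_derive_cst.
have := is_derive_mul (is_derive_subp c1 (is_derive_mul hx hx)) IH.
move=> H; apply: (is_derive_eq H); rewrite vx; ring.
Qed.

(** If the derivative of cap vanishes, so does that of centered / bump, hence
    the velocity is a multiple of centered y; the radial monotonicity of bump
    then forces the multiple to be 0. *)
Lemma cap_immersion y v : (forall i, i != 0 -> 0 < y 0 i < 1) -> v 0 0 = 0 ->
  'D_v cap y = 0 -> v = 0.
Proof.
move=> y01 v0 dc0; pose x := centered y; pose w := velocity v.
have x1 i : 0 < 1 - centered y 0 i ^+ 2.
  rewrite mxE; case: eqVneq => [_|/y01 /andP[h0 h1]]; first by rewrite expr0n subr0.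
  have -> : 1 - (2 * y 0 i - 1) ^+ 2 = 4 * (y 0 i * (1 - y 0 i)) by ring.
  by rewrite mulr_gt0 // mulr_gt0 // subr_gt0.
pose b := bump y; have b0 : 0 < b by apply: prodr_gt0 => i _; exact: x1.
have hb : is_derive y v (bump : E -> R^o) ('D_v (bump : E -> R^o) y).
  by apply: derivableP; exact: (Ck_derivable (Ck_bump 1)).
set b' : R := 'D_v _ y in hb.
have hx := is_derive_centered y v; have hr := is_derive_dot hx hx.
have hxi i : is_derive y v (fun z : E => centered z 0 i : R^o) (w 0 i).
  by have /is_derive_mxP := hx; exact.
have hs := is_derive_addp (is_derive_mul hb hb) hr.
have hc i : is_derive y v (fun z : E => cap z 0 i : R^o) 0.
  have : is_derive y v cap 0.
    by rewrite -dc0; apply: derivableP; exact: (Ck_derivable (Ck_cap 1)).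
  by move=> /is_derive_mxP /(_ 0 i); rewrite mxE.
pose r := dot x x; pose r' := dot w x + dot x w; pose s := cap_den y.
have s0 : s != 0 by exact: lt0r_neq0 (cap_den_gt0 y).
pose s' : R := b' * b + b * b' + r'.
have capE z i : cap_den z * cap z 0 i = 2 * bump z * centered z 0 i +
    (dot (centered z) (centered z) - bump z * bump z) * (delta_mx 0 0 : E) 0 i.
  by rewrite /cap mxE mulrA divff ?mul1r ?(lt0r_neq0 (cap_den_gt0 z)) // !mxE.
have cst c : is_derive y v (fun=> (c : R^o)) 0 by exact: is_derive_cst.
have key i : s' * cap y 0 i = 2 * b' * x 0 i + 2 * b * w 0 i +
    (r' - (b' * b + b * b')) * (delta_mx 0 0 : E) 0 i.
  have h1 := is_derive_mul hs (hc i).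
  have h2 := is_derive_addp (is_derive_mul (is_derive_mul (cst 2) hb) (hxi i))
    (is_derive_mul (is_derive_subp hr (is_derive_mul hb hb)) (cst ((delta_mx 0 0 : E) 0 i))).
  have e : (fun z => ((bump z * bump z + dot (centered z) (centered z)) * cap z 0 i : R^o)) =
    (fun z => (2 * bump z * centered z 0 i +
      (dot (centered z) (centered z) - bump z * bump z) * (delta_mx 0 0 : E) 0 i : R^o)).
    by apply/funext => z; rewrite -expr2 -/(cap_den z); exact: capE.
  rewrite e in h1; have := is_derive_unique h1 h2.
  rewrite !mulr0 !addr0 mul0r add0r; exact.
have c00 := capE y 0; have k0 := key 0.
have w0 : w 0 0 = 0 by rewrite mxE eqxx.
have d00 : (delta_mx 0 0 : E) 0 0 = 1 by rewrite mxE !eqxx.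
have x00 : x 0 0 = 0 by exact: centered0.
move: c00 k0; rewrite -/x -/s -/b -/r d00 x00 w0 !mulr0 !add0r !mulr1 => c00 k0.
have sE : s = b * b + r by rewrite /s /cap_den expr2.
have c0E : cap y 0 0 = (r - b * b) / s by rewrite -c00 mulrC mulKf.
(* The coordinate 0 of cap is a function of the norm of centered / bump alone;
   its derivative fixes that of cap_den. *)
have s'b : s' * b = 2 * b' * s.
  have bn : 2 * b != 0 by rewrite mulf_neq0 // lt0r_neq0.
  apply: (mulfI bn); apply: (mulIf (invr_neq0 s0)).
  have e1 : s' * (1 - cap y 0 0) = 4 * b * b' by rewrite mulrBr k0 /s'; ring.
  have e2 : 1 - cap y 0 0 = 2 * b * b / s.
    by rewrite c0E; apply: (mulIf s0); rewrite divfK // mulrBl divfK // sE; ring.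
  have -> : 2 * b * (s' * b) / s = s' * (2 * b * b / s) by ring.
  by rewrite -e2 e1 -!mulrA mulfV //; ring.
have xw i : i != 0 -> b * w 0 i = b' * x 0 i.
  move=> i0; have := key i; have := capE y i.
  rewrite [(delta_mx 0 0 : E) 0 i]mxE (negbTE i0) !mulr0 !addr0 -/s -/b -/x => ci ki.
  have ciE : cap y 0 i = 2 * b * x 0 i / s by rewrite -ci mulrC mulKf.
  move: ki; rewrite ciE.
  have -> : s' * (2 * b * x 0 i / s) = (s' * b) * 2 * x 0 i / s by ring.
  rewrite s'b.
  have -> : 2 * b' * s * 2 * x 0 i / s = 4 * b' * x 0 i * (s / s) by ring.
  by rewrite divff // mulr1; lra.
have wl i : w 0 i = b' / b * x 0 i.
  have [->|i0] := eqVneq i 0; first by rewrite w0 /x centered0 mulr0.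
  by rewrite mulrAC -(xw i i0) mulrC mulKf // lt0r_neq0.
have [m m0 hbm] := bump_derive x1 wl.
have b'm := is_derive_unique hb hbm.
have b'0 : b' = 0.
  have : b' * (b + m) = 0.
    by rewrite mulrDr {1}b'm; have := lt0r_neq0 b0 => bn; field.
  by move/eqP; rewrite mulf_eq0 (gt_eqF (ltr_wpDr m0 b0)) orbF => /eqP.
apply/rowP => i; rewrite mxE; have [->|i0] := eqVneq i 0; first exact: v0.
have := wl i; rewrite b'0 !mul0r mxE (negbTE i0) => /eqP.
by rewrite mulf_eq0 pnatr_eq0 /= => /eqP.
Qed.

Lemma cap_face y i : i != 0 -> y 0 i = 0 \/ y 0 i = 1 -> cap y = delta_mx 0 0.
Proof.
move=> i0 yi; have b0 : bump y = 0.
  rewrite /bump (bigD1 i) //= mxE (negbTE i0).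
  by case: yi => ->; rewrite ?mulr0 ?sub0r ?mulr1 ?sqrrN ?expr1n ?subrr ?mul0r //;
     rewrite (_ : 2 - 1 = 1 :> R) ?expr1n ?subrr ?mul0r //; ring.
have := cap_den_gt0 y; rewrite /cap /cap_den b0 expr0n add0r mulr0 scale0r add0r subr0 => r0.
by rewrite scalerA mulVf ?scale1r // lt0r_neq0.
Qed.

Lemma cap_coord0 y z : (forall i, i != 0 -> y 0 i = z 0 i) -> cap y = cap z.
Proof.
move=> yz; rewrite /cap /cap_den /bump (_ : centered y = centered z) //.
by apply/rowP => i; rewrite !mxE; case: eqVneq => // /yz ->.
Qed.

End Cap.

(** * A projection form on the sphere is degenerate somewhere *)
Section Agreement.
Variables (R : realType) (V W : normedModType R).

Lemma derive_agree (f g : V -> W) x v : (forall h : R, f (h *: v + x) = g (h *: v + x)) ->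
  'D_v f x = 'D_v g x.
Proof.
move=> fg; rewrite derive_along (derive_along g).
by rewrite (_ : (fun h => f _) = (fun h => g (h *: v + x))) //; apply/funext => h; exact: fg.
Qed.

Lemma derive_constant_along (f : V -> W) x v : (forall h : R, f (h *: v + x) = f x) ->
  'D_v f x = 0.
Proof.
by move=> fx; rewrite (@derive_agree f (fun=> f x)) //; exact: derive_cst.
Qed.

End Agreement.

Section RealFacts.
Variable R : realType.

Lemma segment_interior (t b : R) : 0 <= t -> t <= 1 -> 0 < b < 1 ->
  0 < 1 / 2 + t * (b - 1 / 2) < 1.
Proof. by move=> t0 t1 /andP[b0 b1]; apply/andP; split; nra. Qed.

Lemma opposite_signs (a b : R) : a * b < 0 -> Num.min a b <= 0 <= Num.max a b.
Proof.
move=> ab; rewrite ge_min le_max.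
by have [a0|a0] := leP a 0; have [b0|b0] := leP b 0 => //=;
   rewrite ?(ltW a0) ?(ltW b0) ?orbT //; nra.
Qed.

End RealFacts.

Section Nondegenerate.
Variables (R : realType) (N : nat) (K : 'M[R]_N) (P : 'rV[R]_7 -> 'M[R]_N).
Notation E := 'rV[R]_7.
Notation e i := (delta_mx 0 i : E).
Notation U := [set y : E | y != 0].
Hypothesis CP : Ck 2 U P.
Hypothesis PP : forall y, y != 0 -> P y *m P y = P y.
Hypothesis KP : forall y, y != 0 -> K *m P y = P y *m K.
Hypothesis nd : forall x X, sphere6 x -> tangent x X -> X != 0 ->
  exists2 Y, tangent x Y & proj_form K P x X Y != 0.

Lemma open_nonzero : open U.
Proof.
have -> : U = ~` [set 0] by apply/seteqP; split=> y /= /eqP.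
apply/closed_openC/accessible_closed_set1/hausdorff_accessible; exact: norm_hausdorff.
Qed.

Lemma cap_neq0 (y : E) : cap y != 0.
Proof.
apply/eqP => c0; have := cap_sphere y; rewrite c0 dot0l => /esym/eqP.
by rewrite oner_eq0.
Qed.

Implicit Types (y : E) (i j : 'I_7).

(** Coordinate 0 is the time of a homotopy, from a constant map at time 0 to the
    map cap at time 1. *)
Definition scaled (y : E) : E := y 0 0 *: y.
Definition final_map (y : E) : 'M[R]_N := P (cap y).
Definition homotopy (y : E) : 'M[R]_N := P (cap (scaled y)).
Notation Q0 := final_map.
Notation Q1 := homotopy.

Lemma Ck_final : Ck 2 setT Q0.
Proof.
have nz (y : E) : setT y -> U (cap y) by move=> _; exact: cap_neq0.
have H := @Ck_comp R E 2 7 N N U P setT (@cap R) open_nonzero openT nz CP (Ck_cap R 2).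
exact: H.
Qed.

Lemma Ck_scaled k : Ck k setT scaled.
Proof.
have oT := @openT E; apply: Ck_scalemx; [exact: oT| |exact: Ck_id].
by apply: Ck_entry; [exact: oT|exact: Ck_id].
Qed.

Lemma Ck_homotopy : Ck 2 setT Q1.
Proof.
have tt (y : E) : setT y -> setT (scaled y) by [].
have Cs := @Ck_comp R E 2 7 1 7 setT (@cap R) setT scaled openT openT tt (Ck_cap R 2) (Ck_scaled 2).
have nz (y : E) : setT y -> U ((@cap R \o scaled) y) by move=> _; exact: cap_neq0.
have H := @Ck_comp R E 2 7 N N U P setT (@cap R \o scaled) open_nonzero openT nz CP Cs.
exact: H.
Qed.

Notation A := (form_matrix K Q1).
Notation B := (form_matrix K Q0).

Lemma proj_form_0l (F : E -> 'M[R]_N) y u v : 'D_u F y = 0 -> proj_form K F y u v = 0.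
Proof. by move=> D0; rewrite /proj_form D0 mul0mx mulmx0 subrr mulmx0 mxtrace0. Qed.

Lemma proj_form_0r (F : E -> 'M[R]_N) y u v : 'D_v F y = 0 -> proj_form K F y u v = 0.
Proof. by move=> D0; rewrite /proj_form D0 mul0mx mulmx0 subrr mulmx0 mxtrace0. Qed.

Lemma derive_final0 y : 'D_(e 0) Q0 y = 0.
Proof.
apply: derive_constant_along => h; congr (P _); apply: cap_coord0 => i i0.
by rewrite !mxE (negbTE i0) andbF mulr0 add0r.
Qed.

Lemma derive_final_face y i j : i != 0 -> j != i -> y 0 i = 0 \/ y 0 i = 1 ->
  'D_(e j) Q0 y = 0.
Proof.
move=> i0 ji yi; apply: derive_constant_along => h; congr (P _).
rewrite !(@cap_face _ _ i) //.
by rewrite !mxE eq_sym (negbTE ji) andbF mulr0 add0r.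
Qed.

Lemma derive_homotopy_bottom y j : j != 0 -> y 0 0 = 0 -> 'D_(e j) Q1 y = 0.
Proof.
move=> j0 y0; apply: derive_constant_along => h; congr (P (cap _)).
by rewrite /scaled y0 !mxE eq_sym (negbTE j0) andbF mulr0 add0r y0 !scale0r.
Qed.

Lemma derive_homotopy_top y j : j != 0 -> y 0 0 = 1 -> 'D_(e j) Q1 y = 'D_(e j) Q0 y.
Proof.
move=> j0 y0; apply: derive_agree => h; congr (P (cap _)).
by rewrite /scaled !mxE eq_sym (negbTE j0) andbF mulr0 add0r y0 scale1r.
Qed.

Lemma wedge_eq0 l (M1 M2 M3 : 'M[R]_7) :
  (forall s : 'S_7, l (s 0) != 0 -> M1 (s (@Ordinal 7 1 isT)) (s (@Ordinal 7 2 isT)) = 0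
    \/ M2 (s (@Ordinal 7 3 isT)) (s (@Ordinal 7 4 isT)) = 0) ->
  wedge l M1 M2 M3 = 0.
Proof.
move=> H; rewrite /wedge /alt big1 // => s _.
rewrite (_ : Ordinal _ = 0); last exact/val_inj.
have [->|l0] := eqVneq (l (s 0)) 0; first by rewrite mul0r mulr0.
by have [->|->] := H s l0; rewrite ?mul0r ?mulr0.
Qed.

(** With A the pullback of the form by the homotopy and B its pullback by the
    final map, the 6-form A /\ B /\ B is closed; it is zero at time 0, where A is,
    and it is B /\ B /\ B at time 1.  Keeping two factors B independent of the time
    makes it zero on the sides of the cube, where cap is constant. *)
Definition flux := wedge_field A B B.

Lemma flux_side y a i : i != 0 -> y 0 i = 0 \/ y 0 i = 1 -> flux a y = 0.
Proof.
move=> i0 yi; apply: wedge_eq0 => s _; right; rewrite mxE.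
set j := s _; set k := s _; have jk : j != k by rewrite inj_eq //; exact: perm_inj.
have [ji|ji] := eqVneq j i.
  by rewrite proj_form_0r // (derive_final_face i0 _ yi) // -ji eq_sym.
by rewrite proj_form_0l // (derive_final_face i0 ji yi).
Qed.

Lemma flux_bottom y : y 0 0 = 0 -> flux 0 y = 0.
Proof.
move=> y0; apply: wedge_eq0 => s s0; left; rewrite mxE proj_form_0l //.
have s00 : s 0 = 0 by apply/eqP; move: s0; case: (s 0 == 0) => //; rewrite eqxx.
apply: derive_homotopy_bottom => //.
by rewrite -[X in _ != X]s00 inj_eq //; exact: perm_inj.
Qed.

Lemma wedge_agree (M M' M2 M3 : 'M[R]_7) :
  (forall j k, j != 0 -> k != 0 -> M j k = M' j k) ->
  wedge (fun j => (j == 0)%:R) M M2 M3 = wedge (fun j => (j == 0)%:R) M' M2 M3.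
Proof.
move=> MM'; apply: alt_ext => s; cbv beta.
rewrite (_ : @Ordinal 7 0 isT = 0); last exact/val_inj.
case: (eqVneq (s 0) 0) => s0; last by rewrite [LHS]mul0r [RHS]mul0r.
have sn k : k != 0 -> s k != 0 by rewrite -[X in _ -> _ != X]s0 inj_eq //; exact: perm_inj.
by rewrite (MM' _ _ (sn (@Ordinal 7 1 isT) isT) (sn (@Ordinal 7 2 isT) isT)).
Qed.

Lemma flux_top y : y 0 0 = 1 -> flux 0 y = wedge (fun j => (j == 0)%:R) (B y) (B y) (B y).
Proof.
move=> y0; apply: wedge_agree => j k j0 k0; rewrite [LHS]mxE [RHS]mxE /proj_form.
have EQ : Q1 y = Q0 y by rewrite /Q1 /scaled y0 scale1r.
by rewrite EQ (derive_homotopy_top j0 y0) (derive_homotopy_top k0 y0).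
Qed.

Lemma cap_tangent y v : tangent (cap y) ('D_v (@cap R) y).
Proof.
have dc : is_derive y v (@cap R) ('D_v (@cap R) y).
  by apply: derivableP; exact: (Ck_derivable (Ck_cap R 1)).
have h1 := is_derive_dot dc dc.
have e : (fun z : E => dot (cap z) (cap z) : R^o) = fun=> 1.
  by apply/funext => z; exact: cap_sphere.
rewrite e in h1; have := is_derive_unique h1 (is_derive_cst _ _ _).
by rewrite (dotC (cap y)) /tangent; move: (dot _ _) => d ?; lra.
Qed.

(** The differential of cap has rank at least 6, because its kernel is the line of
    e_0; the tangent space of the sphere has dimension 6. *)
Lemma cap_surjective y Y : (forall i, i != 0 -> 0 < y 0 i < 1) -> tangent (cap y) Y ->
  exists w, 'D_w (@cap R) y = Y.
Proof.
move=> y01 tY; have oT := @openT E.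
have E1 w := @derive_coords R 7 1 7 setT (@cap R) oT (Ck_cap R 1) y w I.
pose L : 'M[R]_7 := \matrix_i 'D_(e i) (@cap R) y.
have LE w : w *m L = 'D_w (@cap R) y.
  rewrite E1 mulmx_sum_row; apply: eq_bigr => i _; congr (_ *: _).
  by apply/rowP => j; rewrite !mxE.
have tgt v := cap_tangent y v.
have LT : (L <= kermx (cap y)^T)%MS.
  apply/sub_kermxP/row_matrixP => i; rewrite row_mul row0 rowE LE.
  by apply/rowP => j; rewrite ord1 [RHS]mxE; exact: tgt.
have rT : \rank (kermx (cap y)^T) = 6.
  by rewrite mxrank_ker mxrank_tr rank_rV cap_neq0.
have kL : (kermx L <= e 0)%MS.
  apply/row_subP => i; set u := row i _.
  have uL : u *m L = 0 by rewrite /u -row_mul mulmx_ker row0.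
  pose u' := u - u 0 0 *: e 0.
  have e0L : e 0 *m L = 0.
    rewrite LE; apply: derive_constant_along => h; apply: cap_coord0 => k k0.
    by rewrite !mxE (negbTE k0) andbF mulr0 add0r.
  have u'0 : u' = 0.
    apply: (cap_immersion y01); first by rewrite !mxE !eqxx mulr1 subrr.
    by rewrite -LE mulmxBl uL -scalemxAl e0L scaler0 subrr.
  have -> : u = u 0 0 *: e 0 by apply/eqP; rewrite -subr_eq0 -/u' u'0.
  exact: scalemx_sub.
have rL : (6 <= \rank L)%N.
  have := mxrankS kL; rewrite mxrank_ker mxrank_delta; have := rank_leq_row L; lia.
have YT : (Y <= kermx (cap y)^T)%MS.
  by apply/sub_kermxP/rowP => j; rewrite ord1 [RHS]mxE; exact: tY.
have [rle] := mxrank_leqif_sup LT; rewrite eqn_leq rle rT rL => /esym TL.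
have /submxP[w ->] := submx_trans YT TL.
by exists w; rewrite LE.
Qed.

(** In the interior of the cube cap is a local diffeomorphism onto the sphere, so
    B is the pullback of a nondegenerate form, and its cube is not zero. *)
Lemma flux_top_neq0 y : y 0 0 = 1 -> (forall i, i != 0 -> 0 < y 0 i < 1) -> flux 0 y <> 0.
Proof.
move=> y0 y01; rewrite flux_top //; apply: wedge_nondegenerate.
- exact: form_matrix_antisym.
- by move=> j; rewrite mxE proj_form_0l // derive_final0.
move=> u uB u0; have C0 := Ck_final.
have chain v : 'D_v Q0 y = 'D_('D_v (@cap R) y) P (cap y).
  have dc : derivable (@cap R) y v by exact: (Ck_derivable (Ck_cap R 1)).
  by have [_ ->] := derive_chain open_nonzero (CkS CP) (cap_neq0 y) dc.
apply: contrapT => /eqP un0; have X0 : 'D_u (@cap R) y != 0.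
  by apply: contra_neq un0; exact: cap_immersion.
have tgt := cap_tangent y u.
have [Y tY] := nd (cap_sphere y) tgt X0.
have [w <-] := cap_surjective y01 tY.
have -> : proj_form K P (cap y) ('D_u (@cap R) y) ('D_w (@cap R) y) = proj_form K Q0 y u w.
  by rewrite /proj_form !chain.
by rewrite (form_matrixE K C0) uB mul0mx mxE eqxx.
Qed.

Lemma flux_Ck a : Ck 1 setT (flux a).
Proof.
by apply: Ck_wedge_field; apply: Ck_form_matrix; [exact: Ck_homotopy|exact: Ck_final|exact: Ck_final].
Qed.

Lemma flux_divergence y : \sum_a 'D_(e a) (flux a) y = 0.
Proof.
have P1 z : Q1 z *m Q1 z = Q1 z by exact: PP (cap_neq0 _).
have P0 z : Q0 z *m Q0 z = Q0 z by exact: PP (cap_neq0 _).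
have K1 z : K *m Q1 z = Q1 z *m K by exact: KP (cap_neq0 _).
have K0 z : K *m Q0 z = Q0 z *m K by exact: KP (cap_neq0 _).
have C0 := Ck_final; have C1 := Ck_homotopy.
apply: wedge_field_divergence.
- exact: Ck_form_matrix.
- exact: Ck_form_matrix.
- exact: Ck_form_matrix.
- exact: form_matrix_closed.
- exact: form_matrix_closed.
- exact: form_matrix_closed.
Qed.

Let centre : E := \row_i (if i == 0 then 1 else 1 / 2).

(** The flux does not vanish on the segment from the centre to y, which stays in
    the interior of the face. *)
Lemma flux_same_sign y : cube y -> y 0 0 = 1 -> 0 <= (flux 0 centre : R) * flux 0 y.
Proof.
move=> cy y0; have [y01|] := pselect (forall i, i != 0 -> 0 < y 0 i < 1); last first.
  move=> /existsNP[i /not_implyP[i0 yi]].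
  rewrite (@flux_side y 0 i i0) ?mulr0 //.
  have /andP[h0 h1] := cy i; move/negP: yi; rewrite negb_and -!leNgt => /orP[yi|yi].
    by left; apply/le_anti; rewrite h0 yi.
  by right; apply/le_anti; rewrite h1 yi.
rewrite leNgt; apply/negP => neg.
pose f (t : R) : R := flux 0 (centre + t *: (y - centre)).
have pt (t : R) i : (centre + t *: (y - centre)) 0 i = centre 0 i + t * (y 0 i - centre 0 i).
  by rewrite !mxE.
have nz (t : R) : 0 <= t <= 1 -> f t <> 0.
  move=> /andP[t0 t1]; apply: flux_top_neq0; first by rewrite pt y0 mxE eqxx subrr mulr0 addr0.
  by move=> i i0; rewrite pt mxE (negbTE i0); apply: segment_interior => //; exact: y01.
have cf : {within `[0, 1], continuous f}.
  apply: derivable_within_continuous => t _.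
  have [] := @is_derive_line R E R^o (flux 0) centre (y - centre) t; last by [].
  exact: (Ck_derivable (flux_Ck 0)).
have f0 : f 0 = flux 0 centre by rewrite /f scale0r addr0.
have e1 : centre + (1 : R) *: (y - centre) = y by rewrite scale1r addrC subrK.
have f1 : f 1 = flux 0 y := congr1 (flux 0) e1.
have [t] : exists2 t, t \in `[0, 1]%R & f t = 0.
  by apply: IVT; [exact: ler01|exact: cf|rewrite f0 f1; exact: opposite_signs].
by rewrite in_itv /= => /nz.
Qed.

(** A closed form on the sphere is exact, hence so is its cube, which cannot be a
    volume form.  The contradiction is with the divergence theorem for the flux,
    multiplied by its value at the centre of the top face to make it
    nonnegative there. *)
Theorem no_nondegenerate_proj_form : False.
Proof.
have cc i : i != 0 -> 0 < centre 0 i < 1.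
  by move=> i0; rewrite mxE (negbTE i0); apply/andP; split; lra.
have c0 : centre 0 0 = 1 by rewrite mxE eqxx.
pose sg : R := flux 0 centre; have sg0 : sg != 0 by apply/eqP; exact: flux_top_neq0.
pose G a : E -> R^o := fun y => sg * flux a y.
have CG a : Ck 1 setT (G a).
  by apply: Ck_mul; [exact: openT|exact: Ck_cst|exact: flux_Ck].
apply: (@no_positive_outflow R 6 G CG).
- move=> y; rewrite (eq_bigr (fun a => sg * 'D_(e a) (flux a) y)).
    by rewrite -mulr_sumr flux_divergence mulr0.
  move=> a _; have df : derivable (flux a) y (e a) by exact: (Ck_derivable (flux_Ck a)).
  exact: (deriveZ sg df).
- by move=> a y a0 cy ya; rewrite /G (flux_side _ a0 ya) mulr0.
- by move=> y cy y0; rewrite /G flux_bottom ?mulr0.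
- by move=> y cy y0; exact: flux_same_sign.
- by rewrite /G -/centre -/sg -expr2 exprn_even_gt0.
Qed.

End Nondegenerate.

(** * Complex matrices as pairs and blocks of real matrices *)
Section ComplexMatrices.
Variable R : realType.
Notation C := R[i].

Lemma conjC_complex (z : C) : (z^*)%R = (complex.Re z -i* complex.Im z)%C.
Proof. by case: z. Qed.

Definition reM m n (A : 'M[C]_(m, n)) : 'M[R]_(m, n) := map_mx (@complex.Re R) A.
Definition imM m n (A : 'M[C]_(m, n)) : 'M[R]_(m, n) := map_mx (@complex.Im R) A.

Lemma ReM (a b : C) : complex.Re (a * b) = complex.Re a * complex.Re b - complex.Im a * complex.Im b.
Proof. by case: a; case: b. Qed.
Lemma ImM (a b : C) : complex.Im (a * b) = complex.Re a * complex.Im b + complex.Im a * complex.Re b.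
Proof. by case: a; case: b. Qed.
Lemma ReD (a b : C) : complex.Re (a + b) = complex.Re a + complex.Re b.
Proof. by case: a; case: b. Qed.
Lemma ImD (a b : C) : complex.Im (a + b) = complex.Im a + complex.Im b.
Proof. by case: a; case: b. Qed.
Lemma ReN (a : C) : complex.Re (- a) = - complex.Re a. Proof. by case: a. Qed.
Lemma ImN (a : C) : complex.Im (- a) = - complex.Im a. Proof. by case: a. Qed.
Lemma Re_sum I (r : seq I) (F : I -> C) :
  complex.Re (\sum_(i <- r) F i) = \sum_(i <- r) complex.Re (F i).
Proof. by elim: r => [|i r IH]; rewrite ?big_nil // !big_cons ReD IH. Qed.
Lemma Im_sum I (r : seq I) (F : I -> C) :
  complex.Im (\sum_(i <- r) F i) = \sum_(i <- r) complex.Im (F i).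
Proof. by elim: r => [|i r IH]; rewrite ?big_nil // !big_cons ImD IH. Qed.

Lemma eqC (a b : C) : complex.Re a = complex.Re b -> complex.Im a = complex.Im b -> a = b.
Proof. by case: a => a1 a2; case: b => b1 b2 /= -> ->. Qed.

Lemma reM_mul m n p (A : 'M[C]_(m, n)) (B : 'M[C]_(n, p)) :
  reM (A *m B) = reM A *m reM B - imM A *m imM B.
Proof.
apply/matrixP => i j; rewrite !mxE Re_sum -sumrB; apply: eq_bigr => k _.
by rewrite ReM !mxE.
Qed.

Lemma imM_mul m n p (A : 'M[C]_(m, n)) (B : 'M[C]_(n, p)) :
  imM (A *m B) = reM A *m imM B + imM A *m reM B.
Proof.
apply/matrixP => i j; rewrite !mxE Im_sum -big_split; apply: eq_bigr => k _.
by rewrite ImM !mxE.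
Qed.

Lemma reMD m n (A B : 'M[C]_(m, n)) : reM (A + B) = reM A + reM B.
Proof. by apply/matrixP => i j; rewrite !mxE ReD. Qed.
Lemma imMD m n (A B : 'M[C]_(m, n)) : imM (A + B) = imM A + imM B.
Proof. by apply/matrixP => i j; rewrite !mxE ImD. Qed.
Lemma reMN m n (A : 'M[C]_(m, n)) : reM (- A) = - reM A.
Proof. by apply/matrixP => i j; rewrite !mxE ReN. Qed.
Lemma imMN m n (A : 'M[C]_(m, n)) : imM (- A) = - imM A.
Proof. by apply/matrixP => i j; rewrite !mxE ImN. Qed.

Lemma reM_trC m n (A : 'M[C]_(m, n)) : reM (A ^t*) = (reM A)^T.
Proof. by apply/matrixP => i j; rewrite !mxE conjC_complex. Qed.
Lemma imM_trC m n (A : 'M[C]_(m, n)) : imM (A ^t*) = - (imM A)^T.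
Proof. by apply/matrixP => i j; rewrite !mxE conjC_complex. Qed.

Lemma reM_cx m n (A : 'M[R]_(m, n)) : reM (complexify A) = A.
Proof. by apply/matrixP => i j; rewrite !mxE. Qed.
Lemma imM_cx m n (A : 'M[R]_(m, n)) : imM (complexify A) = 0.
Proof. by apply/matrixP => i j; rewrite !mxE. Qed.
Lemma reM_iZ m n (A : 'M[C]_(m, n)) : reM ('i%C *: A) = - imM A.
Proof. by apply/matrixP => i j; rewrite !mxE ReM /= mul0r mul1r sub0r. Qed.
Lemma imM_iZ m n (A : 'M[C]_(m, n)) : imM ('i%C *: A) = reM A.
Proof. by apply/matrixP => i j; rewrite !mxE ImM /= mul0r mul1r add0r. Qed.
Lemma reM_halfZ m n (A : 'M[C]_(m, n)) : reM (2^-1%:C%C *: A) = 2^-1 *: reM A.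
Proof. by apply/matrixP => i j; rewrite !mxE ReM /= mul0r subr0. Qed.
Lemma imM_halfZ m n (A : 'M[C]_(m, n)) : imM (2^-1%:C%C *: A) = 2^-1 *: imM A.
Proof. by apply/matrixP => i j; rewrite !mxE ImM /= mul0r addr0. Qed.

Lemma cmatrixP m n (A B : 'M[C]_(m, n)) : reM A = reM B -> imM A = imM B -> A = B.
Proof.
move=> /matrixP re /matrixP im; apply/matrixP => i j; apply: eqC.
  by have := re i j; rewrite !mxE.
by have := im i j; rewrite !mxE.
Qed.

Lemma trC_mul m n p (A : 'M[C]_(m, n)) (B : 'M[C]_(n, p)) : (A *m B) ^t* = B ^t* *m A ^t*.
Proof. by rewrite trmx_mul map_mxM. Qed.

Lemma trC_cx m n (A : 'M[R]_(m, n)) : (complexify A) ^t* = complexify A^T.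
Proof.
by apply: cmatrixP; rewrite ?reM_trC ?imM_trC ?reM_cx ?imM_cx // trmx0 oppr0.
Qed.

(** The action of A on C^n regarded as R^n + R^n; it lets the calculus of real
    matrices be applied to complex ones.  The signs are those of row vectors. *)
Definition realify n (A : 'M[C]_n) : 'M[R]_(n + n) :=
  block_mx (reM A) (imM A) (- imM A) (reM A).

Lemma realify_mul n (A B : 'M[C]_n) : realify (A *m B) = realify A *m realify B.
Proof.
rewrite /realify mulmx_block reM_mul imM_mul !mulNmx !mulmxN.
by congr block_mx; rewrite ?opprD // addrC.
Qed.

Lemma realify_trC n (A : 'M[C]_n) : realify (A ^t*) = (realify A)^T.
Proof.
have trN (M : 'M[R]_n) : (- M)^T = - M^T by apply/matrixP => i j; rewrite !mxE.
by rewrite /realify tr_block_mx reM_trC imM_trC opprK trN.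
Qed.

Lemma realifyD n (A B : 'M[C]_n) : realify (A + B) = realify A + realify B.
Proof. by rewrite /realify add_block_mx reMD imMD opprD. Qed.
Lemma realifyN n (A : 'M[C]_n) : realify (- A) = - realify A.
Proof. by rewrite /realify opp_block_mx reMN imMN. Qed.
Lemma realify_trace n (A : 'M[C]_n) : \tr (realify A) = 2 * complex.Re (\tr A).
Proof.
rewrite /realify mxtrace_block mulr2n mulrDl !mul1r Re_sum.
by congr (_ + _); apply: eq_bigr => i _; rewrite mxE.
Qed.

End ComplexMatrices.

(** * The Hermitian product, and the geometry of one tangent space *)
Section Hermitian.
Variable R : realType.
Notation C := R[i].
Notation iC := ('i%C : C).

Definition herm n (a b : 'rV[C]_n) : C := (a *m b ^t*) 0 0.

Variable n : nat.
Implicit Types a b c : 'rV[C]_n.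

Lemma hermDl a b c : herm (a + b) c = herm a c + herm b c.
Proof. by rewrite /herm mulmxDl mxE. Qed.
Lemma hermZl z a b : herm (z *: a) b = z * herm a b.
Proof. by rewrite /herm -scalemxAl mxE. Qed.
Lemma hermNl a b : herm (- a) b = - herm a b.
Proof. by rewrite -scaleN1r hermZl mulN1r. Qed.
Lemma herm_conj a b : herm b a = (herm a b)^*.
Proof.
have -> : (herm a b)^* = ((a *m b ^t*) ^t*) 0 0 by rewrite /herm [RHS]mxE [X in _ = X^*]mxE.
by rewrite trC_mul trmxCK.
Qed.
Lemma hermDr a b c : herm c (a + b) = herm c a + herm c b.
Proof. by rewrite !(herm_conj _ c) hermDl rmorphD. Qed.
Lemma hermZr z a b : herm b (z *: a) = z^* * herm b a.
Proof. by rewrite !(herm_conj _ b) hermZl rmorphM. Qed.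
Lemma hermNr a b : herm b (- a) = - herm b a.
Proof. by rewrite !(herm_conj _ b) hermNl rmorphN. Qed.

Lemma herm_iZl a b : herm (iC *: a) b = iC * herm a b. Proof. exact: hermZl. Qed.
Lemma conj_i : (iC)^* = - iC.
Proof. by rewrite conjC_complex; apply: eqC => /=; rewrite ?oppr0. Qed.
Lemma herm_iZr a b : herm a (iC *: b) = - iC * herm a b.
Proof. by rewrite hermZr conj_i. Qed.

Lemma herm_ii a b : herm (iC *: a) (iC *: b) = herm a b.
Proof.
rewrite herm_iZl herm_iZr; move: (herm a b) => h.
by rewrite mulrA mulrN -expr2 sqr_i opprK mul1r.
Qed.

Lemma Re_herm_sym a b : complex.Re (herm a b) = complex.Re (herm b a).
Proof. by rewrite (herm_conj b a); move: (herm b a) => h; rewrite conjC_complex. Qed.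

Lemma herm_norm a : herm a a = (\sum_i (complex.Re (a 0 i) ^+ 2 + complex.Im (a 0 i) ^+ 2))%:C%C.
Proof.
rewrite /herm mxE rmorph_sum; apply: eq_bigr => i _; rewrite !mxE conjC_complex.
by apply: eqC; rewrite ?ReM ?ImM /=; ring.
Qed.

Lemma herm_ge0 a : 0 <= complex.Re (herm a a).
Proof. by rewrite herm_norm sumr_ge0 // => i _; rewrite addr_ge0 // sqr_ge0. Qed.

Lemma Im_herm a : complex.Im (herm a a) = 0.
Proof. by rewrite herm_norm. Qed.

Lemma herm_eq0 a : complex.Re (herm a a) = 0 -> a = 0.
Proof.
rewrite herm_norm /= => /eqP; rewrite psumr_eq0; last first.
  by move=> i _; rewrite addr_ge0 // sqr_ge0.
move=> /allP H; apply/rowP => i; rewrite mxE.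
have := H i (mem_index_enum _); rewrite /= paddr_eq0 ?sqr_ge0 // !sqrf_eq0 => /andP[/eqP r /eqP m].
exact: eqC.
Qed.

(** The vector y is orthogonal to p and q, so the two parts do not interact. *)
Lemma herm_orthonormal_shift (p q y : 'rV[C]_n) (z w : C) :
  herm p y = 0 -> herm q y = 0 -> herm y y = 1 ->
  herm (iC *: p - z *: y) (iC *: (q + iC *: p) - w *: y) =
  herm p q - iC * herm p p + z * w^*.
Proof.
move=> py qy yy; have yp : herm y p = 0 by rewrite herm_conj py rmorph0.
have yq : herm y q = 0 by rewrite herm_conj qy rmorph0.
have ii : iC *: (q + iC *: p) = iC *: q - p.
  by rewrite scalerDr scalerA -expr2 sqr_i scaleN1r.
have E1 : herm (iC *: p) (iC *: q - p) = herm p q - iC * herm p p.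
  by rewrite hermDr hermNr herm_ii herm_iZl.
have E2 : herm (z *: y) (iC *: q - p) = 0.
  by rewrite hermDr hermNr hermZl herm_iZr yq hermZl yp !mulr0 subr0.
have E3 : herm (iC *: p) (w *: y) = 0 by rewrite hermZr herm_iZl py !mulr0.
have E4 : herm (z *: y) (w *: y) = z * w^* by rewrite hermZr hermZl yy mulr1 mulrC.
rewrite ii hermDl hermNl !(hermDr _ (- (w *: y))) !hermNr E1 E2 E3 E4.
by rewrite subr0 sub0r opprK.
Qed.

Lemma Im_shift (h k v : C) : complex.Im k = 0 ->
  complex.Im (h - iC * k + v) = complex.Im h - complex.Re k + complex.Im v.
Proof. by case: h => h1 h2; case: k => k1 k2; case: v => v1 v2 /= ->; ring. Qed.

Lemma Re_iC_r (h : C) : complex.Re (- iC * h) = complex.Im h.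
Proof. by case: h => h1 h2 /=; ring. Qed.

End Hermitian.

Section Pointwise.
Variable R : realType.
Notation C := R[i].
Notation iC := ('i%C : C).
Notation half := ((2^-1)%:C%C : C).
Notation E := 'rV[R]_7.
Variables (x : E) (J : 'M[R]_7) (Q : 'M[C]_7).

(** The projection of the complexified space onto T^{0,1} along T^{1,0} and the
    normal line.  It has the same image as the orthogonal projection Q, and it is
    an explicit expression in J. *)
Definition cx_proj : 'M[C]_7 := half *: (complexify (1%:M - x^T *m x) + iC *: complexify J).
Notation N := cx_proj.

Hypotheses (xx : x *m x^T = 1%:M) (xJ : x *m J = 0) (Jx : J *m x^T = 0).
Hypothesis JJ : J *m J = x^T *m x - 1%:M.
Hypotheses (QQ : Q *m Q = Q) (Qh : Q ^t* = Q) (NQ : N *m Q = N) (QN : Q *m N = Q).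

Lemma cxM m n p (A : 'M[R]_(m, n)) (B : 'M[R]_(n, p)) :
  complexify (A *m B) = complexify A *m complexify B.
Proof. exact: map_mxM. Qed.
Lemma cxD m n (A B : 'M[R]_(m, n)) : complexify (A + B) = complexify A + complexify B.
Proof. by apply/matrixP => i j; rewrite !mxE rmorphD. Qed.

Lemma reN : reM N = 2^-1 *: (1%:M - x^T *m x).
Proof. by rewrite reM_halfZ reMD reM_cx reM_iZ imM_cx oppr0 addr0. Qed.
Lemma imN : imM N = 2^-1 *: J.
Proof. by rewrite imM_halfZ imMD imM_cx imM_iZ reM_cx add0r. Qed.

Lemma x_proj : complexify x *m Q = 0.
Proof.
have Nx : N *m complexify x^T = 0.
  rewrite /N -scalemxAl mulmxDl -scalemxAl -!cxM Jx mulmxBl mul1mx -mulmxA xx mulmx1 subrr.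
  by rewrite /complexify !map_mx0 scaler0 addr0 scaler0.
have Qx : Q *m complexify x^T = 0 by rewrite -QN -mulmxA Nx mulmx0.
by rewrite -[LHS]trmxCK trC_mul Qh trC_cx Qx trmx0 map_mx0.
Qed.

(** The component of a real vector orthogonal to T^{0,1}. *)
Definition Dop (W : E) : 'rV[C]_7 := complexify W *m (1%:M - Q).

Lemma DopE W : Dop W = complexify W - complexify W *m Q.
Proof. by rewrite /Dop mulmxBr mulmx1. Qed.

(** The vector W + i WJ is in T^{0,1}, so it has no component orthogonal to it. *)
Lemma Dop_J W : W *m x^T = 0 -> Dop (W *m J) = iC *: Dop W.
Proof.
move=> Wx; have WN : complexify W *m N = half *: (complexify W + iC *: complexify (W *m J)).
  rewrite /N -scalemxAr mulmxDr -scalemxAr -!cxM mulmxBr mulmx1 mulmxA Wx mul0mx subr0.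
  by [].
have : complexify W *m N *m (1%:M - Q) = 0.
  by rewrite -mulmxA mulmxBr mulmx1 NQ subrr mulmx0.
rewrite WN -scalemxAl mulmxDl -scalemxAl -/(Dop _) -/(Dop _) => /eqP.
rewrite scaler_eq0 => /orP[/eqP/(congr1 (@complex.Re R)) /= /eqP|].
  by rewrite invr_eq0 pnatr_eq0.
rewrite addr_eq0 => /eqP ->; rewrite scalerN scalerA.
by rewrite -expr2 sqr_i scaleN1r opprK.
Qed.

Lemma Dop_x W : W *m x^T = 0 -> herm (Dop W) (complexify x) = 0.
Proof.
move=> Wx; rewrite /herm /Dop trC_cx -mulmxA mulmxBl mul1mx.
have Qx : Q *m complexify x^T = 0.
  by rewrite -trC_cx -[Q]trmxCK -trC_mul Qh x_proj trmx0 map_mx0.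
by rewrite Qx subr0 -cxM Wx mxE mxE.
Qed.

Lemma herm_x : herm (complexify x) (complexify x) = 1.
Proof. by rewrite /herm trC_cx -cxM xx !mxE eqxx. Qed.

Definition ipQ (U W : E) : R := dot (U *m imM Q) (W *m J).

Lemma herm_Dop (U W : E) : herm (Dop U) (Dop W) = (complexify U *m (1%:M - Q) *m complexify W^T) 0 0.
Proof.
rewrite /herm /Dop trC_mul trC_cx.
have -> : (1%:M - Q) ^t* = 1%:M - Q.
  by rewrite linearB /= map_mxB trmx1 map_mx1 Qh.
congr (fun_of_matrix _ 0 0); rewrite -!mulmxA; congr (_ *m _); rewrite mulmxA; congr (_ *m _).
by rewrite mulmxBr mulmx1 mulmxBl mul1mx QQ subrr subr0.
Qed.

Lemma Im_herm_Dop U W : complex.Im (herm (Dop U) (Dop W)) = - dot (U *m imM Q) W.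
Proof.
rewrite herm_Dop /dot.
have -> : complex.Im ((complexify U *m (1%:M - Q) *m complexify W^T) 0 0) =
   (imM (complexify U *m (1%:M - Q) *m complexify W^T)) 0 0 by rewrite [RHS]mxE.
rewrite mulmxBr mulmx1 mulmxBl imMD imMN -cxM imM_cx add0r !imM_mul.
by rewrite !imM_cx !reM_cx mulmx0 mul0mx addr0 add0r mxE.
Qed.

(** So the product induced by J is the pullback of the Hermitian product by Dop,
    which explains that it is positive and that J is orthogonal for it. *)
Lemma ipQE U W : W *m x^T = 0 -> ipQ U W = complex.Re (herm (Dop U) (Dop W)).
Proof.
move=> Wx; have := Im_herm_Dop U (W *m J); rewrite (Dop_J Wx) herm_iZr mulNr ImN ImM /= mul0r mul1r add0r.
by move=> /oppr_inj ->.
Qed.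

Lemma ipQ_ge0 U : U *m x^T = 0 -> 0 <= ipQ U U.
Proof. by move=> Ux; rewrite ipQE // herm_ge0. Qed.

(** A real vector in T^{0,1} is its own conjugate, so it is zero. *)
Lemma ipQ_eq0 U : U *m x^T = 0 -> ipQ U U = 0 -> U = 0.
Proof.
move=> Ux; rewrite ipQE // => /herm_eq0; rewrite DopE => /eqP; rewrite subr_eq0 => /eqP UQ.
have UN : complexify U *m N = complexify U by rewrite UQ -mulmxA QN.
have : imM (complexify U *m N) = 0 by rewrite UN imM_cx.
rewrite imM_mul imM_cx mul0mx addr0 reM_cx imN -scalemxAr => /eqP.
rewrite scaler_eq0 invr_eq0 pnatr_eq0 /= => /eqP UJ.
have : U *m J *m J = 0 by rewrite UJ mul0mx.
by rewrite -mulmxA JJ mulmxBr mulmx1 mulmxA Ux mul0mx sub0r => /eqP; rewrite oppr_eq0 => /eqP.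
Qed.

Lemma ipQ_J U W : U *m x^T = 0 -> W *m x^T = 0 -> ipQ (U *m J) (W *m J) = ipQ U W.
Proof.
move=> Ux Wx; have WJx : W *m J *m x^T = 0 by rewrite -mulmxA Jx mulmx0.
by rewrite (ipQE _ WJx) (ipQE _ Wx) (Dop_J Ux) (Dop_J Wx) herm_ii.
Qed.

Lemma ipQ_cauchy U W : U *m x^T = 0 -> W *m x^T = 0 ->
  ipQ U W <= Num.sqrt (ipQ U U) * Num.sqrt (ipQ W W).
Proof.
move=> Ux Wx; set p := Num.sqrt (ipQ U U); set q := Num.sqrt (ipQ W W).
have p2 : p ^+ 2 = ipQ U U by rewrite sqr_sqrtr // ipQ_ge0.
have q2 : q ^+ 2 = ipQ W W by rewrite sqr_sqrtr // ipQ_ge0.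
have sym : ipQ W U = ipQ U W.
  by rewrite (ipQE W Ux) (ipQE U Wx); exact: Re_herm_sym.
have quad a b : 0 <= a ^+ 2 * ipQ U U + 2 * a * b * ipQ U W + b ^+ 2 * ipQ W W.
  have Vx : (a *: U + b *: W) *m x^T = 0.
    by rewrite mulmxDl -!scalemxAl Ux Wx !scaler0 addr0.
  have := ipQ_ge0 Vx; rewrite {1}/ipQ !mulmxDl -!scalemxAl !(dotDl, dotDr, dotZl, dotZr).
  rewrite -!/(ipQ _ _) sym => h; apply: le_trans h _; rewrite le_eqVlt; apply/orP; left.
  by apply/eqP; ring.
have p0 : 0 <= p by exact: sqrtr_ge0. have q0 : 0 <= q by exact: sqrtr_ge0.
have [pz|pn] := eqVneq p 0.
  have U0 : U = 0 by apply: ipQ_eq0 => //; rewrite -p2 pz expr0n.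
  by rewrite pz mul0r U0 /ipQ mul0mx dot0l.
have [qz|qn] := eqVneq q 0.
  have W0 : W = 0 by apply: ipQ_eq0 => //; rewrite -q2 qz expr0n.
  by rewrite qz mulr0 W0 /ipQ mul0mx dot0r.
have pq : 0 < p * q by rewrite mulr_gt0 // lt0r ?pn ?qn.
have := quad q (- p); rewrite -p2 -q2 => H.
have : 0 <= 2 * (p * q) * (p * q - ipQ U W) by apply: le_trans H _; rewrite le_eqVlt; apply/orP; left; apply/eqP; ring.
by rewrite pmulr_rge0 ?subr_ge0 // mulr_gt0.
Qed.

(** The derivative of Q on the vector e = Z + i ZJ of T^{0,1}, when x moves with
    velocity X and J changes by J'.  As e N = e, the relation N' Q + N Q' = N' gives
    e Q' = e N' (1 - Q), and e N' is computed from the formula for N.  The vector S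
    is the covariant derivative of J applied to Z; the multiple of x is due to the
    motion of the tangent space itself. *)
Lemma frame_derivative (Z X S : E) (J' : 'M[R]_7) (Q' N' : 'M[C]_7) :
  Z *m x^T = 0 -> J' *m J + J *m J' = X^T *m x + x^T *m X ->
  N' = half *: (complexify (- (X^T *m x + x^T *m X)) + iC *: complexify J') ->
  N' *m Q + N *m Q' = N' ->
  S = Z *m J' + dot (Z *m J) X *: x -> S *m x^T = 0 ->
  (complexify Z + iC *: complexify (Z *m J)) *m Q' =
  iC *: Dop S - ((dot Z X) +i* (dot (Z *m J) X))%C *: complexify x.
Proof.
move=> Zx J'J N'E NQ' SE Sx; set e := _ + _; set c := (dot Z X +i* dot (Z *m J) X)%C.
have re : reM e = Z by rewrite reMD reM_cx reM_iZ imM_cx oppr0 addr0.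
have ie : imM e = Z *m J by rewrite imMD imM_cx imM_iZ reM_cx add0r.
have ZJx : Z *m J *m x^T = 0 by rewrite -mulmxA Jx mulmx0.
have ZP : Z *m (1%:M - x^T *m x) = Z by rewrite mulmxBr mulmx1 mulmxA Zx mul0mx subr0.
have ZJP : Z *m J *m (1%:M - x^T *m x) = Z *m J.
  by rewrite mulmxBr mulmx1 mulmxA ZJx mul0mx subr0.
have ZJJ : Z *m J *m J = - Z.
  by rewrite -mulmxA JJ mulmxBr mulmx1 mulmxA Zx mul0mx sub0r.
have eN : e *m N = e.
  apply: cmatrixP; rewrite ?reM_mul ?imM_mul re ie reN imN -!scalemxAr ?ZP ?ZJP ?ZJJ.
    by rewrite scalerN opprK -scalerDl -div1r -splitr scale1r.
  by rewrite -scalerDl -div1r -splitr scale1r.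
have eQ' : e *m Q' = e *m N' *m (1%:M - Q).
  rewrite -{1}eN -!mulmxA; congr (_ *m _).
  by rewrite mulmxBr mulmx1 -{1}NQ' addrC addKr.
have outer (V : E) : V *m x^T = 0 -> V *m (X^T *m x + x^T *m X) = dot V X *: x.
  move=> Vx; rewrite mulmxDr !mulmxA Vx mul0mx addr0 [V *m X^T]mx11_scalar.
  by rewrite mul_scalar_mx.
have ZJ' : Z *m J' = S - dot (Z *m J) X *: x by rewrite SE addrK.
have ZJJ' : Z *m J *m J' = dot Z X *: x - S *m J.
  have := congr1 (mulmx Z) J'J; rewrite (outer Z Zx) mulmxDr !mulmxA ZJ' mulmxBl -scalemxAl xJ scaler0 subr0.
  by move=> <-; rewrite addrC addKr.
have eN' : e *m N' = half *: (iC *: complexify S + complexify (S *m J)) - c *: complexify x.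
  rewrite N'E; apply: cmatrixP.
    rewrite reM_mul re ie reM_halfZ imM_halfZ reMD imMD !reM_cx !imM_cx reM_iZ imM_iZ imM_cx reM_cx.
    rewrite oppr0 addr0 add0r -!scalemxAr mulmxN (outer Z Zx) ZJJ'.
    rewrite reMD reMN reM_halfZ reMD reM_iZ !reM_cx imM_cx oppr0 add0r.
    apply/matrixP => i j; rewrite !mxE ReM /c /= mulr0 subr0; lra.
  rewrite imM_mul re ie reM_halfZ imM_halfZ reMD imMD !reM_cx !imM_cx reM_iZ imM_iZ imM_cx reM_cx.
  rewrite oppr0 addr0 add0r -!scalemxAr mulmxN (outer _ ZJx) ZJ'.
  rewrite imMD imMN imM_halfZ imMD imM_iZ !reM_cx imM_cx addr0.
  apply/matrixP => i j; rewrite !mxE ImM /c /= mulr0 add0r; lra.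
rewrite eQ' eN' mulmxBl -scalemxAl mulmxDl -!scalemxAl -/(Dop S) -/(Dop (S *m J)) (Dop_J Sx).
rewrite [complexify x *m _]mulmxBr mulmx1 x_proj subr0; congr (_ - _).
rewrite -scalerDl scalerA; congr (_ *: _).
by apply: eqC; rewrite ?ReM ?ImM /= ?addr0 ?mul0r ?mulr0 ?subr0 ?addr0 -?splitr //; field.
Qed.

(** Here S and m + SJ stand for the covariant derivatives of J along X and along XJ
    applied to a vector of a frame, so that m is a value of the tangent algebra. *)
Lemma Im_herm_frame (S m : E) (c d : C) : S *m x^T = 0 -> m *m x^T = 0 ->
  complex.Im (herm (iC *: Dop S - c *: complexify x)
                   (iC *: Dop (m + S *m J) - d *: complexify x)) =
  ipQ S (m *m J) - ipQ S S + complex.Im (c * d^*).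
Proof.
move=> Sx mx; have mJx : m *m J *m x^T = 0 by rewrite -mulmxA Jx mulmx0.
have DmS : Dop (m + S *m J) = Dop m + iC *: Dop S.
  by rewrite -(Dop_J Sx) /Dop cxD mulmxDl.
rewrite DmS (herm_orthonormal_shift _ _ (Dop_x Sx) (Dop_x mx) herm_x).
rewrite (Im_shift _ _ (Im_herm _)) (ipQE _ mJx) (ipQE _ Sx) (Dop_J mx) herm_iZr.
by congr (_ - _ + _); rewrite Re_iC_r.
Qed.

End Pointwise.

(** * The space T^{0,1} and its orthonormal frames *)
Section AlmostComplexPoint.
Variables (R : realType) (J : 'rV[R]_7 -> 'M[R]_7) (x : 'rV[R]_7).
Hypotheses (hJ : almost_complex J) (sx : sphere6 x).
Notation E := 'rV[R]_7.

Lemma tangentP (v : E) : tangent x v <-> v *m x^T = 0.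
Proof.
split=> [tv|vx]; last by rewrite /tangent /dot vx mxE.
by apply/matrixP => i j; rewrite !ord1 [RHS]mxE; exact: tv.
Qed.

Lemma sphere_mul : x *m x^T = 1%:M.
Proof.
apply/matrixP => i j; rewrite !ord1 [RHS]mxE eqxx; exact: sx.
Qed.

Lemma acs_left : x *m J x = 0. Proof. exact: (ac_normal hJ sx). Qed.

Lemma tangent_part (v : E) : tangent x (v *m (1%:M - x^T *m x)).
Proof. by apply/tangentP; rewrite -mulmxA mulmxBl mul1mx -mulmxA sphere_mul mulmx1 subrr mulmx0. Qed.

Lemma acs_projl : (1%:M - x^T *m x) *m J x = J x.
Proof. by rewrite mulmxBl mul1mx -mulmxA acs_left mulmx0 subr0. Qed.

Lemma acs_right : J x *m x^T = 0.
Proof.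
apply/row_matrixP => i; rewrite row0 row_mul -acs_projl row_mul.
by apply/tangentP; apply: (ac_tangent hJ sx); rewrite rowE; exact: tangent_part.
Qed.

Lemma acs_sqr : J x *m J x = x^T *m x - 1%:M.
Proof.
rewrite -{1}acs_projl; apply/row_matrixP => i; rewrite !row_mul.
rewrite (ac_square hJ sx); last by rewrite rowE; exact: tangent_part.
by apply/rowP => j; rewrite !mxE; ring.
Qed.

End AlmostComplexPoint.

Section OrthogonalProjection.
Variables (R : realType) (n : nat).
Notation C := R[i].
Implicit Types Q N : 'M[C]_n.

Lemma conjmxK m p (A : 'M[C]_(m, p)) : map_mx Num.Def.conjC (map_mx Num.Def.conjC A) = A.
Proof. by apply/matrixP => i j; rewrite !mxE conjCK. Qed.

Lemma hermitian_of_orthogonal Q : (1%:M - Q) *m Q ^t* = 0 -> Q ^t* = Q.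
Proof.
move=> H; have E : Q ^t* = Q *m Q ^t*.
  by apply/eqP; rewrite -subr_eq0 -[X in X - _]mul1mx -mulmxBl H.
have E2 : Q = Q *m Q ^t*.
  have : (Q ^t*) ^t* = (Q *m Q ^t*) ^t* by rewrite -E.
  by rewrite trC_mul !trmxCK.
by rewrite E -E2.
Qed.

(** The orthogonal projection with the same image as a projection N, as a rational
    function of N.  The matrix W to be inverted is symmetric with
    W^2 = 1 + S S^T for S = N - N^T. *)
Lemma realify_projection Q N (NN := realify N) : N *m N = N -> Q ^t* = Q ->
  N *m Q = N -> Q *m N = Q ->
  NN + NN^T - 1%:M \in unitmx /\ realify Q = NN^T *m invmx (NN + NN^T - 1%:M).
Proof.
move=> NNh Qh NQ QN; have NNN : NN *m NN = NN by rewrite /NN -realify_mul NNh.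
set W := _ - _.
have WW : W *m W = 1%:M + (NN - NN^T) *m (NN - NN^T)^T.
  have NTT : NN^T *m NN^T = NN^T by rewrite -trmx_mul NNN.
  rewrite /W [(NN - NN^T)^T]linearB /= trmxK.
  rewrite !(mulmxBl, mulmxBr, mulmxDl, mulmxDr, mulmx1, mul1mx) NNN NTT.
  by apply/matrixP => i j; rewrite !mxE; ring.
have uW : W \in unitmx.
  rewrite -row_free_unit; apply/inj_row_free => v vW.
  have : ((v *m W *m W) *m v^T) 0 0 = 0 by rewrite vW !mul0mx mxE.
  have -> : v *m W *m W *m v^T = v *m v^T + (v *m (NN - NN^T)) *m (v *m (NN - NN^T))^T.
    by rewrite -[v *m W *m W]mulmxA WW mulmxDr mulmx1 mulmxDl trmx_mul !mulmxA.
  have sq (w : 'rV[R]_(n + n)) : (w *m w^T) 0 0 = \sum_i w 0 i ^+ 2.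
    by rewrite mxE; apply: eq_bigr => i _; rewrite mxE expr2.
  have ge (w : 'rV[R]_(n + n)) : 0 <= \sum_i w 0 i ^+ 2.
    by apply: sumr_ge0 => i _; exact: sqr_ge0.
  rewrite mxE !sq => /eqP; rewrite paddr_eq0 ?ge // => /andP[+ _].
  rewrite psumr_eq0; last by move=> i _; exact: sqr_ge0.
  move=> /allP H; apply/rowP => i; rewrite mxE; apply/eqP.
  by have := H i (mem_index_enum _); rewrite /= sqrf_eq0.
split=> //; apply: (canRL (mulmxK uW)).
have QNT : Q *m N ^t* = N ^t* by rewrite -{1}Qh -trC_mul NQ.
rewrite /W mulmxBr mulmx1 mulmxDr -realify_trC -!realify_mul QN QNT.
by rewrite addrC addKr.
Qed.

Lemma projection_of_basis k Q (B : 'M[C]_(k, n)) : B *m B ^t* = 1%:M -> Q ^t* = Q ->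
  B *m Q = B -> (Q <= B)%MS -> Q = B ^t* *m B.
Proof.
move=> BB Qh BQ /submxP[W QW].
have QBB : Q *m B ^t* *m B = Q by rewrite {1}QW -!mulmxA (mulmxA B) BB mul1mx -QW.
by rewrite -{1}QBB -{1}Qh -trC_mul BQ.
Qed.

End OrthogonalProjection.

Section AntiholomorphicSpace.
Variables (R : realType) (J : 'rV[R]_7 -> 'M[R]_7) (x : 'rV[R]_7).
Notation C := R[i].
Notation iC := ('i%C : C).
Notation E := 'rV[R]_7.
Notation T := (T01 J x).
Notation Q := (proj_ortho T).
Notation N := (cx_proj x (J x)).
Hypotheses (xx : x *m x^T = 1%:M) (xJ : x *m J x = 0) (Jx : J x *m x^T = 0).
Hypothesis JJ : J x *m J x = x^T *m x - 1%:M.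

Lemma sub_T01P m (V : 'M[C]_(m, 7)) :
  (V <= T)%MS <-> V *m complexify x^T = 0 /\ V *m complexify (J x) = - iC *: V.
Proof.
have tc : (complexify x)^T = complexify x^T by rewrite /complexify map_trmx.
rewrite /T01 sub_capmx; split => [/andP[/sub_kermxP + /eigenspaceP +]|[h1 h2]].
  by rewrite tc.
by apply/andP; split; [apply/sub_kermxP; rewrite tc|apply/eigenspaceP].
Qed.

Lemma T01_fixed m (V : 'M[C]_(m, 7)) : (V <= T)%MS -> V *m N = V.
Proof.
move=> /sub_T01P[Vx VJ]; rewrite /cx_proj -scalemxAr mulmxDr -scalemxAr VJ.
have -> : complexify (1%:M - x^T *m x) = 1%:M - complexify x^T *m complexify x.
  by rewrite -cxM; apply: cmatrixP; rewrite ?reMD ?imMD ?reMN ?imMN ?reM_cx ?imM_cx ?oppr0 ?addr0;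
     apply/matrixP => i j; rewrite !mxE //=; case: eqP => /=; rewrite ?subr0 ?oppr0.
rewrite mulmxBr mulmx1 mulmxA Vx mul0mx subr0 scalerA mulrN -expr2 sqr_i opprK scale1r.
apply: cmatrixP; rewrite ?reM_halfZ ?imM_halfZ ?reMD ?imMD;
  by apply/matrixP => i j; rewrite !mxE; lra.
Qed.

Lemma cx_proj_sub : (N <= T)%MS.
Proof.
apply/sub_T01P; split.
  rewrite /cx_proj -scalemxAl mulmxDl -scalemxAl -!cxM Jx mulmxBl mul1mx -mulmxA xx mulmx1 subrr.
  by rewrite /complexify !map_mx0 scaler0 addr0 scaler0.
rewrite /cx_proj -scalemxAl mulmxDl -scalemxAl -!cxM mulmxBl mul1mx -mulmxA xJ mulmx0 subr0 JJ.
rewrite scalerA mulrC -scalerA; congr (_ *: _).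
apply: cmatrixP; apply/matrixP => i j; rewrite !mxE /=; ring.
Qed.

Lemma projQ_idem : Q *m Q = Q. Proof. exact: proj_ortho_proj. Qed.

(** The image of 1 - Q is orthogonal to that of Q, so Q^* = Q Q^*, and the right
    side is selfadjoint. *)
Lemma projQ_herm : Q ^t* = Q.
Proof.
have H : (1%:M - Q) *m Q ^t* = 0.
  apply/orthomx1P; have := proj_ortho_compl_sub T (1%:M : 'M[C]_7); rewrite mul1mx => H.
  apply: submx_trans H _; rewrite submx_ortho.
  by have := proj_ortho_sub T (1%:M : 'M[C]_7); rewrite mul1mx.
exact: hermitian_of_orthogonal H.
Qed.

Lemma projQ_N : N *m Q = N. Proof. exact: (proj_ortho_id cx_proj_sub). Qed.

Lemma N_projQ : Q *m N = Q.
Proof.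
by apply: T01_fixed; have := proj_ortho_sub T (1%:M : 'M[C]_7); rewrite mul1mx.
Qed.

Lemma realify_projQ (NN := realify N) :
  NN + NN^T - 1%:M \in unitmx /\ realify Q = NN^T *m invmx (NN + NN^T - 1%:M).
Proof.
exact: (realify_projection (T01_fixed cx_proj_sub) projQ_herm projQ_N N_projQ).
Qed.

Section Frame.
Variable Z : 'I_3 -> E.
Hypothesis fZ : T01_frame J x Z.

Definition frame_vec k : 'rV[C]_7 := complexify (Z k) + iC *: complexify (Z k *m J x).

Let B : 'M[C]_(3, 7) := \matrix_(k < 3) frame_vec k.

Lemma frame_proj : Q = B ^t* *m B.
Proof.
case: fZ => _ /unitarymxP BB /eqmxP BT.
have BQ : B *m Q = B by apply: proj_ortho_id; rewrite BT.
apply: projection_of_basis BB projQ_herm BQ _.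
by rewrite BT; have := proj_ortho_sub T (1%:M : 'M[C]_7); rewrite mul1mx.
Qed.

(** On T^{0,1} the trace is computed in the orthonormal basis of the frame; the
    commutator of two Hermitian matrices leaves twice an imaginary part, and
    realification doubles the real part of the trace. *)
Lemma frame_trace (QX QY : 'M[C]_7) : QX ^t* = QX -> QY ^t* = QY ->
  \tr (realify (iC *: 1%:M : 'M[C]_7) *m realify Q *m
       (realify QX *m realify QY - realify QY *m realify QX)) =
  - 4 * \sum_k complex.Im (herm (frame_vec k *m QX) (frame_vec k *m QY)).
Proof.
rewrite frame_proj => hX hY; rewrite -!realify_mul -realifyN -realifyD -realify_mul realify_trace.
rewrite -scalemxAl mul1mx -scalemxAl linearZ /= ReM /= mul0r mul1r sub0r.
have tr2 (A D : 'M[C]_7) : A ^t* = A -> D ^t* = D ->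
    \tr (B ^t* *m B *m (A *m D)) = \sum_k herm (frame_vec k *m A) (frame_vec k *m D).
  move=> hA hD; rewrite -mulmxA mxtrace_mulC; apply: eq_bigr => k _.
  rewrite /herm trC_mul hD.
  have -> : (B *m (A *m D) *m B ^t*) k k = row k (B *m (A *m D) *m B ^t*) 0 k by rewrite [RHS]mxE.
  rewrite !row_mul rowK !mulmxA.
  rewrite mxE [RHS]mxE; apply: eq_bigr => j _; congr (_ * _).
  by rewrite !mxE.
rewrite mulmxDr mulmxN linearD linearN /= ImD ImN (tr2 _ _ hX hY) (tr2 _ _ hY hX) !Im_sum.
have -> : \sum_(k < 3) complex.Im (herm (frame_vec k *m QY) (frame_vec k *m QX)) =
    - \sum_(k < 3) complex.Im (herm (frame_vec k *m QX) (frame_vec k *m QY)).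
  rewrite -sumrN; apply: eq_bigr => k _; rewrite herm_conj; move: (herm _ _) => h.
  by rewrite conjC_complex.
by move: (\sum_(k < 3) _) => s; ring.
Qed.

(** With Q = B^* B, both sides are the imaginary part of the Hermitian form of Q
    on the real vectors X and Y. *)
Lemma frame_sum_pairing (X Y : E) :
  \sum_k complex.Im ((dot (Z k) X +i* dot (Z k *m J x) X)%C * ((dot (Z k) Y +i* dot (Z k *m J x) Y)%C)^*)
  = - dot (X *m imM Q) Y.
Proof.
have := frame_proj; have := projQ_herm; move: Q => P Ph PB.
have dE k (V : E) : (dot (Z k) V +i* dot (Z k *m J x) V)%C = (frame_vec k *m complexify V^T) 0 0.
  apply: eqC.
    transitivity (reM (frame_vec k *m complexify V^T) 0 0); last by rewrite [LHS]mxE.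
    by rewrite reM_mul reM_cx imM_cx mulmx0 subr0 /frame_vec reMD reM_cx reM_iZ imM_cx oppr0 addr0.
  transitivity (imM (frame_vec k *m complexify V^T) 0 0); last by rewrite [LHS]mxE.
  by rewrite imM_mul reM_cx imM_cx mulmx0 add0r /frame_vec imMD imM_cx imM_iZ reM_cx add0r.
have QE : complexify Y *m P *m complexify X^T =
    \matrix_(a < 1, b < 1) \sum_k (frame_vec k *m complexify X^T) 0 0 * ((frame_vec k *m complexify Y^T) 0 0)^*.
  rewrite PB mulmxA -mulmxA; apply/matrixP => a b; rewrite !ord1 !mxE.
  apply: eq_bigr => k _; rewrite mulrC; congr (_ * _).
    have -> : (B *m complexify X^T) k 0 = row k (B *m complexify X^T) 0 0 by rewrite [RHS]mxE.
    by rewrite row_mul rowK.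
  have -> : complexify Y *m B ^t* = (B *m complexify Y^T) ^t* by rewrite trC_mul trC_cx trmxK.
  rewrite mxE mxE; congr (_^*).
  have -> : (B *m complexify Y^T) k 0 = row k (B *m complexify Y^T) 0 0 by rewrite [RHS]mxE.
  by rewrite row_mul rowK.
transitivity (imM (complexify Y *m P *m complexify X^T) 0 0).
  by rewrite QE !mxE Im_sum; apply: eq_bigr => k _; rewrite -!dE.
rewrite !imM_mul !imM_cx !reM_cx mul0mx mulmx0 add0r addr0.
have imT : (imM P)^T = - imM P by rewrite -{2}Ph imM_trC opprK.
transitivity ((Y *m imM P *m X^T)^T 0 0); first by rewrite [RHS]mxE.
by rewrite !trmx_mul trmxK imT mulNmx mulmxN mulmxA mxE.
Qed.

End Frame.

(** N and its conjugate are projections with zero product whose sum is the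
    projection onto the complexified tangent space, of rank 6. *)
Lemma rank_T01 : \rank T = 3.
Proof.
have NT : (T == N)%MS.
  apply/andP; split; last exact: cx_proj_sub.
  by rewrite -(T01_fixed (submx_refl T)) submxMl.
have rTN : \rank T = \rank N by apply/eqmx_rank.
pose P : 'M[C]_7 := complexify (1%:M - x^T *m x).
pose Nc : 'M[C]_7 := map_mx Num.Def.conjC N.
have NN : N *m N = N by exact: T01_fixed cx_proj_sub.
have reNc : reM Nc = reM N by apply/matrixP => i j; rewrite !mxE conjC_complex.
have imNc : imM Nc = - imM N by apply/matrixP => i j; rewrite !mxE conjC_complex.
have PE : N + Nc = P.
  apply: cmatrixP; rewrite ?reMD ?imMD ?reNc ?imNc ?reM_cx ?imM_cx ?subrr //.
  by rewrite reN -scalerDl -div1r -splitr scale1r.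
have PJ : (1%:M - x^T *m x) *m J x = J x by rewrite mulmxBl mul1mx -mulmxA xJ mulmx0 subr0.
have JP : J x *m (1%:M - x^T *m x) = J x by rewrite mulmxBr mulmx1 mulmxA Jx mul0mx subr0.
have PP : (1%:M - x^T *m x) *m (1%:M - x^T *m x) = 1%:M - x^T *m x.
  by rewrite mulmxBr mulmx1 mulmxBl mul1mx mulmxA -[_ *m x^T]mulmxA xx mulmx1 subrr subr0.
have NNc : N *m Nc = 0.
  apply: cmatrixP; rewrite ?reM_mul ?imM_mul reNc imNc reN imN -!scalemxAl -!scalemxAr ?mulmxN -?scalemxAr ?PP ?PJ ?JP ?JJ.
    by apply/matrixP => i j; rewrite !mxE; ring.
  by apply/matrixP => i j; rewrite !mxE; ring.
have rP : \rank P = 6.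
  have rk : (\rank (kermx P) = 1)%N.
    suff -> : \rank (kermx P) = \rank (complexify x).
      by rewrite mxrank_map rank_rV; case: eqP => // x0; have := xx; rewrite x0 mul0mx => /matrixP/(_ 0 0)/eqP; rewrite !mxE eqxx eq_sym oner_eq0.
    apply/eqmx_rank/andP; split.
      have -> : kermx P = kermx P *m complexify x^T *m complexify x.
        have := mulmx_ker P; rewrite {2}/P.
        have -> : complexify (1%:M - x^T *m x) = 1%:M - complexify x^T *m complexify x.
          by rewrite -cxM; apply: cmatrixP; rewrite ?reMD ?imMD ?reMN ?imMN ?reM_cx ?imM_cx ?oppr0 ?addr0;
             apply/matrixP => i j; rewrite !mxE //=; case: eqP => /=; rewrite ?subr0 ?oppr0.
        by rewrite mulmxBr mulmx1 mulmxA => /eqP; rewrite subr_eq0 => /eqP.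
      exact: submxMl.
    apply/sub_kermxP; rewrite -cxM mulmxBr mulmx1 mulmxA xx mul1mx subrr.
    by rewrite /complexify map_mx0.
  by have := mxrank_ker P; rewrite rk; have := rank_leq_row P; lia.
have cap0 : (N :&: Nc)%MS = 0.
  apply/eqP/rowV0P => v; rewrite sub_capmx => /andP[/submxP[a va] /submxP[b vb]].
  have v1 : v *m N = v by rewrite va -mulmxA NN.
  have NcN : Nc *m N = 0.
    by rewrite -[X in _ *m X](conjmxK N) -map_mxM NNc map_mx0.
  by rewrite -v1 vb -mulmxA NcN mulmx0.
have rs : \rank (N + Nc)%MS = 6.
  rewrite -rP; apply/eqmx_rank/andP; split.
    have PN : N *m P = N.
      by rewrite -PE mulmxDr NN NNc addr0.
    rewrite addsmx_sub -{1}PN submxMl /=.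
    have -> : Nc = (map_mx Num.Def.conjC (N *m P)) by rewrite PN.
    rewrite map_mxM (_ : (map_mx Num.Def.conjC P) = P) ?submxMl //.
    by apply/matrixP => i j; rewrite !mxE conjC_complex /= oppr0.
  by rewrite -PE addmx_sub_adds.
rewrite rTN; have := mxrank_disjoint_sum cap0; rewrite rs /Nc (mxrank_map _ N).
move: (\rank N) => r; lia.
Qed.

(** The equation of T^{0,1} says that the imaginary part of a vector is the image
    by J of its real part. *)
Lemma frame_exists : exists Z, T01_frame J x Z.
Proof.
have basis r : \rank T = r -> exists2 B : 'M[C]_(r, 7), B \is unitarymx & (B == T)%MS.
  move=> <-; exists (schmidt (row_base T)); first by apply: schmidt_unitarymx; exact: rank_leq_col.
  by apply/eqmxP; apply: eqmx_trans (eqmx_schmidt_free _) (eq_row_base _); exact: row_base_free.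
have [B uB BT] := basis 3 rank_T01.
have /eqmxP BT' := BT.
have /sub_T01P[Bx BJ] : (B <= T)%MS by rewrite BT'.
pose Z k := row k (reM B).
have ZJ k : Z k *m J x = row k (imM B).
  rewrite /Z -row_mul; congr (row k _); have := congr1 (@reM R 3 7) BJ.
  rewrite reM_mul reM_cx imM_cx mulmx0 subr0 => ->.
  by rewrite scaleNr reMN reM_iZ opprK.
have BE : \matrix_(k < 3) (complexify (Z k) + iC *: complexify (Z k *m J x)) = B.
  apply/row_matrixP => k; rewrite rowK; apply: cmatrixP.
    by rewrite reMD reM_iZ reM_cx imM_cx oppr0 addr0; apply/rowP => j; rewrite !mxE.
  by rewrite imMD imM_iZ imM_cx reM_cx add0r ZJ; apply/rowP => j; rewrite !mxE.
exists Z; rewrite /T01_frame BE; split=> // k; apply/tangentP.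
rewrite /Z -row_mul; have := congr1 (@reM R 3 1) Bx.
rewrite reM_mul reM_cx imM_cx mulmx0 subr0 => ->.
by apply/rowP => j; rewrite !mxE.
Qed.

End AntiholomorphicSpace.

(** * The radial retraction and the Levi-Civita connection of the sphere *)
Section Radial.
Variable R : realType.
Notation E := 'rV[R]_7.
Notation U := [set y : E | y != 0].
Implicit Types x y v w : E.

Definition inv_norm (y : E) : R := (Num.sqrt (dot y y))^-1.

Lemma norm_gt0 y : y != 0 -> 0 < Num.sqrt (dot y y).
Proof. by move=> y0; rewrite sqrtr_gt0 dot_gt0. Qed.

Lemma Ck_dot_self k : Ck k U (fun y : E => dot y y : R^o).
Proof. by apply: Ck_dot; [exact: open_nonzero|exact: Ck_id|exact: Ck_id]. Qed.

Lemma is_derive_inv_sqrt (u : R) : 0 < u ->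
  is_derive u 1 (fun t : R => (Num.sqrt t)^-1 : R^o) (- (2 * Num.sqrt u ^+ 3)^-1).
Proof.
move=> u0; have s0 : Num.sqrt u != 0 by rewrite gt_eqF // sqrtr_gt0.
have [ds es] := is_derive1_sqrt u0.
have := deriveV s0 ds; have dv := derivableV s0 ds => ev.
split; first exact: dv.
apply: etrans ev _; rewrite es; change (- Num.sqrt u ^- 2 * (2 * Num.sqrt u)^-1 = - (2 * Num.sqrt u ^+ 3)^-1).
by field.
Qed.

Lemma inv_norm_chain y v : y != 0 -> differentiable (inv_norm : E -> R^o) y /\
  'D_v (inv_norm : E -> R^o) y = - dot y v * inv_norm y ^+ 3.
Proof.
move=> y0; have q0 := dot_gt0 y0.
have [dphi ephi] := is_derive_inv_sqrt q0.
have dq : differentiable (fun y : E => dot y y : R^o) y.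
  by apply: (C1_differentiable (@open_nonzero R)) y0; exact: Ck_dot_self.
have df : differentiable (fun t : R => (Num.sqrt t)^-1 : R^o) (dot y y).
  exact/derivable1_diffP.
have dc := differentiable_comp dq df.
split; first exact: dc.
have hq := is_derive_dot (is_derive_id y v) (is_derive_id y v).
have hc := @is_derive_chain R E R^o R^o (fun y : E => dot y y) (fun t : R => (Num.sqrt t)^-1)
  y v df (diff_derivable dq).
have eq' := @derive_val _ _ _ _ _ _ _ hq.
have := @derive_val _ _ _ _ _ _ _ hc; rewrite eq' => Ec; apply: etrans Ec _.
have -> : dot v y + dot y v = (dot v y + dot y v) *: (1 : R) by rewrite [RHS]mulr1.
rewrite linearZ -deriveE // ephi.
change ((dot v y + dot y v) * - (2 * Num.sqrt (dot y y) ^+ 3)^-1 = - dot y v * inv_norm y ^+ 3).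
rewrite /inv_norm (dotC v y); have := norm_gt0 y0 => /lt0r_neq0 s0; by field.
Qed.

Lemma Ck_inv_norm k : Ck k U (inv_norm : E -> R^o).
Proof.
have oU := @open_nonzero R.
elim: k => [|k IH].
  split=> // y y0; apply: differentiable_continuous; exact: (inv_norm_chain 0 y0).1.
split=> [y y0|v]; first by apply: differentiable_continuous; exact: (inv_norm_chain 0 y0).1.
split=> [y y0|]; first by exact: (diff_derivable (inv_norm_chain 0 y0).1).
have C : Ck k U (fun y => (- dot y v) * (inv_norm y * (inv_norm y * inv_norm y)) : R^o).
  apply: (Ck_mul oU); last by apply: (Ck_mul oU IH); exact: (Ck_mul oU IH IH).
  by apply: (Ck_opp oU); apply: (Ck_dot oU); [exact: Ck_id|exact: Ck_cst].
apply: (Ck_ext oU _ C) => y y0; rewrite (inv_norm_chain v y0).2.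
by rewrite !exprS expr0 mulr1.
Qed.

Lemma radialE y : radial y = inv_norm y *: y. Proof. by []. Qed.

Lemma Ck_radial k : Ck k U (@radial R).
Proof.
exact: (Ck_scalemx (@open_nonzero R) (Ck_inv_norm k) (Ck_id k U)).
Qed.

Lemma radial_sphere y : y != 0 -> sphere6 (radial y).
Proof.
move=> y0; rewrite /sphere6 /= radialE dotZl dotZr /inv_norm.
have s0 := lt0r_neq0 (norm_gt0 y0); have := sqr_sqrtr (dot_ge0 y).
by move=> e; rewrite -{3}e expr2 mulKf // mulVf.
Qed.

Lemma sphere_neq0 x : sphere6 x -> x != 0.
Proof.
by move=> sx; apply/eqP => x0; move: sx; rewrite /sphere6 /= x0 dot0l => /eqP; rewrite eq_sym oner_eq0.
Qed.

Lemma radial_id x : sphere6 x -> radial x = x.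
Proof. by rewrite /sphere6 /radial /= => ->; rewrite sqrtr1 invr1 scale1r. Qed.

Lemma derive_radial y v : y != 0 ->
  is_derive y v (@radial R) (inv_norm y *: (v - dot v (radial y) *: radial y)).
Proof.
move=> y0; have [dr er] := inv_norm_chain v y0.
apply/is_derive_mxP => i j; rewrite ord1 !mxE.
have hr : is_derive y v (inv_norm : E -> R^o) (- dot y v * inv_norm y ^+ 3).
  by split; [exact: (diff_derivable dr)|exact: er].
have hi : is_derive y v (fun z : E => z 0 j : R^o) (v 0 j).
  by have /is_derive_mxP := is_derive_id y v; exact.
have H := is_derive_mul hr hi.
rewrite (_ : (fun z => _) = (fun z : E => inv_norm z * z 0 j : R^o)); last first.
  by apply/funext => z; rewrite mxE.
apply: (is_derive_eq H); rewrite -/(inv_norm y) radialE dotZr (dotC v y); ring.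
Qed.

Lemma derive_radial_tangent x v : sphere6 x -> tangent x v -> is_derive x v (@radial R) v.
Proof.
move=> sx tv; have := derive_radial v (sphere_neq0 sx).
by rewrite radial_id // (tv : dot v x = 0) scale0r subr0 /inv_norm sx sqrtr1 invr1 scale1r.
Qed.

Lemma smooth_sphereE (W : normedModType R) (f : E -> W) :
  smooth_sphere setT f <-> forall k, Ck k U (f \o @radial R).
Proof.
rewrite /smooth_sphere /smooth (_ : [set y | y != 0 /\ _] = U) //.
by apply/seteqP; split=> y /= => [[]|].
Qed.

Lemma eq_near_nonzero (W : normedModType R) (f g : E -> W) x v : x != 0 ->
  (forall y, y != 0 -> f y = g y) -> 'D_v f x = 'D_v g x.
Proof.
by move=> x0 fg; exact: (derive_eq_open v (@open_nonzero R) x0 fg).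
Qed.

End Radial.

Section LeviCivita.
Variables (R : realType).
Notation E := 'rV[R]_7.
Notation U := [set y : E | y != 0].
Implicit Types (x y v w : E) (X Y Z : E -> E).
Notation rad := (@radial R).

Definition Dfield X Y x : E := 'D_(X x) (Y \o rad) x.

Lemma field_derive Y x v : vector_field Y -> sphere6 x -> is_derive x v (Y \o rad) ('D_v (Y \o rad) x).
Proof.
move=> [_ /smooth_sphereE sY] sx; apply: derivableP.
exact: (Ck_derivable (sY 1%N) (sphere_neq0 sx)).
Qed.

Lemma smooth_dot z : smooth_fun (fun y : E => dot y z : R^o).
Proof.
apply/smooth_sphereE => k; apply: Ck_dot; [exact: open_nonzero|exact: Ck_radial|exact: Ck_cst].
Qed.

Lemma Dsphere_dot z x v : sphere6 x -> tangent x v ->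
  Dsphere (fun y : E => dot y z : R^o) x v = dot v z.
Proof.
move=> sx tv; have cz : is_derive x v (fun=> z) 0 by exact: is_derive_cst.
have [_ e] := is_derive_dot (derive_radial_tangent sx tv) cz.
by apply: etrans e _; rewrite dot0r addr0.
Qed.

Lemma tproj_field v : vector_field (tproj v).
Proof.
split.
  move=> x sx; rewrite /tangent /tproj dotDl dotNl dotZl (sx : dot x x = 1) mulr1 subrr //.
apply/smooth_sphereE => k; have oU := @open_nonzero R.
apply: (Ck_add oU); first exact: Ck_cst.
apply: (Ck_opp oU); apply: (Ck_scalemx oU); last exact: Ck_radial.
by apply: (Ck_dot oU); [exact: Ck_cst|exact: Ck_radial].
Qed.

Lemma tproj_id x v : tangent x v -> tproj v x = v.
Proof. by move=> tv; rewrite /tproj (tv : dot v x = 0) scale0r subr0. Qed.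

Variable nabla : (E -> E) -> (E -> E) -> (E -> E).
Hypothesis LC : Levi_Civita nabla.

(** The torsion identity is tested on the linear functions, which separate the
    vectors of R^7. *)
Lemma torsion_Dfield X Y x : vector_field X -> vector_field Y -> sphere6 x ->
  nabla X Y x - nabla Y X x = Dfield X Y x - Dfield Y X x.
Proof.
move=> fX fY sx.
have H z : dot (nabla X Y x) z - dot (nabla Y X x) z = dot (Dfield X Y x) z - dot (Dfield Y X x) z.
  have tXY := (LC_field LC fX fY).1 x sx; have tYX := (LC_field LC fY fX).1 x sx.
  have := LC_torsion_free LC fX fY (smooth_dot z) sx.
  rewrite !Dsphere_dot //; move=> ->.
  have D X' Y' : vector_field X' -> vector_field Y' ->
      Dsphere (fun y => Dsphere (fun y : E => dot y z : R^o) y (Y' y)) x (X' x) = dot (Dfield X' Y' x) z.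
    move=> fX' fY'; rewrite /Dsphere.
    rewrite (@eq_near_nonzero _ _ _ (fun y => dot (Y' (rad y)) z : R^o) _ _ (sphere_neq0 sx)); last first.
      move=> y y0; have sy := radial_sphere y0.
      exact: (Dsphere_dot z sy (fY'.1 _ sy)).
    have cz : is_derive x (X' x) (fun=> z) 0 by exact: is_derive_cst.
    have [_ e] := is_derive_dot (field_derive (X' x) fY' sx) cz.
    by apply: etrans e _; rewrite dot0r addr0.
  have := (D X Y fX fY); have := (D Y X fY fX); by move=> -> ->.
apply/rowP => i; have := H (delta_mx 0 i); rewrite !dot_delta !mxE; exact.
Qed.

Lemma metric_Dfield X Y Z x : vector_field X -> vector_field Y -> vector_field Z -> sphere6 x ->
  dot (nabla X Y x) (Z x) + dot (Y x) (nabla X Z x) =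
  dot (Dfield X Y x) (Z x) + dot (Y x) (Dfield X Z x).
Proof.
move=> fX fY fZ sx; rewrite -(LC_metric LC fX fY fZ sx).
have [_ e] := is_derive_dot (field_derive (X x) fY sx) (field_derive (X x) fZ sx).
by apply: etrans e _; rewrite /= radial_id.
Qed.

(** The tangential derivative of vector fields of R^7 is the Levi-Civita connection
    of the sphere.  The difference S of the two, paired with a third field, is
    symmetric in the first two arguments and skew in the last two, so it is
    zero; the normal component comes from differentiating the product of Y with
    the position vector, which is zero. *)
Lemma nablaE X Y x : vector_field X -> vector_field Y -> sphere6 x ->
  nabla X Y x = Dfield X Y x + dot (Y x) (X x) *: x.
Proof.
move=> fX fY sx.
pose S X Y Z := dot (nabla X Y x - Dfield X Y x) (Z x).
have sym A B C : vector_field A -> vector_field B -> vector_field C -> S A B C = S B A C.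
  move=> fA fB fC; have := torsion_Dfield fA fB sx; rewrite /S.
  move: (nabla A B x) (nabla B A x) (Dfield A B x) (Dfield B A x) => a b a' b' /eqP.
  by rewrite subr_eq addrAC => /eqP ->; rewrite -addrA addrAC addrA; congr (dot _ _); apply/rowP => i; rewrite !mxE; ring.
have skew A B C : vector_field A -> vector_field B -> vector_field C -> S A B C = - S A C B.
  move=> fA fB fC; have := metric_Dfield fA fB fC sx.
  rewrite /S; move: (nabla A B x) (nabla A C x) (Dfield A B x) (Dfield A C x) (B x) (C x) => a b a' b' u v.
  rewrite !(dotDl, dotNl) (dotC u) (dotC u) => e.
  by move: e; lra.
have S0 A B C : vector_field A -> vector_field B -> vector_field C -> S A B C = 0.
  move=> fA fB fC.
  have := (skew A B C fA fB fC, sym A C B fA fC fB, skew C A B fC fA fB,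
           sym C B A fC fB fA, skew B C A fB fC fA, sym B A C fB fA fC).
  move: (S A B C) (S A C B) (S C A B) (S C B A) (S B C A) (S B A C).
  by move=> r1 r2 r3 r4 r5 r6 [[[[[e1 e2] e3] e4] e5] e6]; lra.
set D := nabla X Y x - Dfield X Y x.
have tN := (LC_field LC fX fY).1 x sx.
have normal : dot (Dfield X Y x) x = - dot (Y x) (X x).
  have hY := field_derive (X x) fY sx.
  have hr := derive_radial_tangent sx (fX.1 x sx).
  have [_ e] := is_derive_dot hY hr.
  move: e; rewrite (@eq_near_nonzero _ _ _ (fun=> (0 : R^o)) _ _ (sphere_neq0 sx)); last first.
    by move=> y y0; exact: (fY.1 _ (radial_sphere y0)).
  rewrite derive_cst /= radial_id // => e; apply/eqP; rewrite -addr_eq0; apply/eqP.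
  by rewrite -e.
have Dx : dot D x = dot (Y x) (X x).
  by rewrite /D dotDl dotNl (tN : dot _ x = 0) normal sub0r opprK.
have DE : D - dot D x *: x = 0.
  have SD T : tangent x T -> dot D T = 0.
    by move=> tT; have := S0 X Y (tproj T) fX fY (tproj_field T); rewrite /S (tproj_id tT).
  clearbody D; move: SD Dx => SD _; apply/eqP; rewrite -dot_eq0; apply/eqP.
  have tT : tangent x (D - dot D x *: x).
    by rewrite /tangent dotDl dotNl dotZl (sx : dot x x = 1) mulr1 subrr.
  move: (SD _ tT) (tT : dot _ x = 0); set a := dot D x; set T := D - a *: x => e1 e2.
  by rewrite {1}/T dotDl dotNl dotZl (dotC x T) e1 e2 mulr0 subr0.
apply/eqP; rewrite -subr_eq0 opprD addrA -Dx; apply/eqP; exact: DE.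
Qed.

Variable J : E -> 'M[R]_7.
Hypothesis hJ : almost_complex J.

Lemma Ck_acs k : Ck k U (J \o rad).
Proof. exact: ((smooth_sphereE J).1 (ac_smooth hJ)). Qed.

Lemma J_field w : vector_field (fun y => tproj w y *m J y).
Proof.
split=> [x sx|]; first by apply: (ac_tangent hJ sx); exact: (tproj_field w).1.
apply/smooth_sphereE => k; apply: Ck_mulmx; [exact: open_nonzero| |exact: Ck_acs].
exact: ((smooth_sphereE (tproj w)).1 (tproj_field w).2).
Qed.

Lemma nablaJE x v w : sphere6 x -> tangent x v -> tangent x w ->
  nablaJ nabla J x v w = w *m 'D_v (J \o rad) x + dot (w *m J x) v *: x.
Proof.
move=> sx tv tw; rewrite /nablaJ !nablaE //; try exact: tproj_field; last exact: J_field.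
rewrite /Dfield !tproj_id //.
have hT := field_derive v (tproj_field w) sx.
have hJ' : is_derive x v (J \o rad) ('D_v (J \o rad) x).
  by apply: derivableP; exact: (Ck_derivable (Ck_acs 1) (sphere_neq0 sx)).
have [_ e] := is_derive_mulmx hT hJ'.
have e2 : 'D_v ((fun y => tproj w y *m J y) \o rad) x = _ := e.
rewrite e2; clear e e2.
rewrite /= radial_id // tproj_id // mulmxDl -scalemxAl (ac_normal hJ sx) scaler0 addr0.
move: (_ *m J x) (w *m _) (_ *: x) => a b c.
by apply/rowP => i; rewrite !mxE; ring.
Qed.

Lemma is_derive_acs x v : sphere6 x -> is_derive x v (J \o rad) ('D_v (J \o rad) x).
Proof.
by move=> sx; apply: derivableP; exact: (Ck_derivable (Ck_acs 1) (sphere_neq0 sx)).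
Qed.

Lemma is_derive_trmx m n (A : E -> 'M[R]_(m, n)) x v dA :
  is_derive x v A dA -> is_derive x v (fun y => (A y)^T) dA^T.
Proof.
move=> /is_derive_mxP HA; apply/is_derive_mxP => i j; rewrite mxE.
rewrite (_ : (fun y => _) = (fun y => A y j i : R^o)); first exact: HA.
by apply/funext => y; rewrite mxE.
Qed.

(** The values of J are orthogonal to the position vector; this is the derivative
    of that relation. *)
Lemma derive_acs_normal x v w : sphere6 x -> tangent x v ->
  dot (w *m 'D_v (J \o rad) x) x = - dot (w *m J x) v.
Proof.
move=> sx tv; have cw : is_derive x v (fun=> w) 0 by exact: is_derive_cst.
have H := is_derive_dot (is_derive_mulmx cw (is_derive_acs v sx)) (derive_radial_tangent sx tv).
have [_] := H; rewrite (@eq_near_nonzero _ _ _ (fun=> (0 : R^o)) _ _ (sphere_neq0 sx)); last first.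
  move=> y y0; rewrite /dot -mulmxA (acs_right hJ (radial_sphere y0)) mulmx0 mxE //.
rewrite derive_cst /= !radial_id // mul0mx add0r => /esym e.
by apply/eqP; rewrite -addr_eq0; apply/eqP.
Qed.

Lemma nablaJ_tangent x v w : sphere6 x -> tangent x v -> tangent x w ->
  tangent x (nablaJ nabla J x v w).
Proof.
move=> sx tv tw; rewrite nablaJE // /tangent dotDl derive_acs_normal //.
by rewrite dotZl (sx : dot x x = 1) mulr1 addNr.
Qed.

Lemma tangent_algebra_tangent x v w : sphere6 x -> tangent x v -> tangent x w ->
  tangent x (tangent_algebra nabla J x v w).
Proof.
move=> sx tv tw; have t1 := nablaJ_tangent sx (ac_tangent hJ sx tv) tw.
have := ac_tangent hJ sx (nablaJ_tangent sx tv tw).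
rewrite /tangent_algebra /tangent dotDl dotNl => ->.
by rewrite (t1 : dot _ _ = 0) subrr.
Qed.

Lemma tangent_algebraE x v w : sphere6 x -> tangent x v -> tangent x w ->
  tangent_algebra nabla J x v w = w *m 'D_(v *m J x) (J \o rad) x
    + dot (w *m J x) (v *m J x) *: x - w *m 'D_v (J \o rad) x *m J x.
Proof.
move=> sx tv tw; rewrite /tangent_algebra !nablaJE //; last exact: ac_tangent.
by rewrite [in X in _ - X]mulmxDl -scalemxAl (ac_normal hJ sx) scaler0 addr0.
Qed.

(** The derivative of J^2 = x^T x - 1. *)
Lemma derive_acs_sqr x v : sphere6 x -> tangent x v ->
  'D_v (J \o rad) x *m J x + J x *m 'D_v (J \o rad) x = v^T *m x + x^T *m v.
Proof.
move=> sx tv; have hr := derive_radial_tangent sx tv.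
have H1 := is_derive_mulmx (is_derive_acs v sx) (is_derive_acs v sx).
have H2 := is_derive_subp (is_derive_mulmx (is_derive_trmx hr) hr)
  (is_derive_cst (1%:M : 'M[R]_7) x v).
have e1 := @derive_val _ _ _ _ _ _ _ H1; have e2 := @derive_val _ _ _ _ _ _ _ H2.
move: e1; rewrite (@eq_near_nonzero _ _ _ (fun y => (rad y)^T *m rad y - 1%:M) _ _ (sphere_neq0 sx)); last first.
  by move=> y y0; exact: (acs_sqr hJ (radial_sphere y0)).
by rewrite e2 /= !radial_id // subr0 => <-.
Qed.

End LeviCivita.

(** * Cauchy-Riemann equations with variable complex structure *)
Section Moving.
Variables (R : realType) (n m p : nat).
Notation E := 'rV[R]_n.
Notation M := 'M[R]_(m, p).
Variables (V : set E) (x : E).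
Hypotheses (oV : open V) (Vx : V x).

(** When the direction W depends on the point, the derivative of the directional
    derivative has one more term, the derivative of F along that of W. *)
Lemma derive_moving (F : E -> M) (W : E -> E) u dW : Ck 2 V F -> is_derive x u W dW ->
  'D_u (fun y => 'D_(W y) F y) x = 'D_u (fun y => 'D_(W x) F y) x + 'D_dW F x.
Proof.
move=> CF HW; have C1 := CkS CF.
apply: etrans (derive_eq_open u oV Vx (fun y Vy => derive_coords oV C1 (W y) Vy)) _.
pose e (a : 'I_n) : E := delta_mx 0 a.
have HS : is_derive x u (fun y => \sum_a W y 0 a *: 'D_(e a) F y)
    (\sum_a (dW 0 a *: 'D_(e a) F x + W x 0 a *: 'D_u (fun y => 'D_(e a) F y) x)).
  apply: is_derive_bigsum => a; apply/is_derive_mxP => i j.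
  have h1 := (is_derive_mxP _ _ _ _).1 HW 0 a.
  have dF : is_derive x u (fun y => 'D_(e a) F y) ('D_u (fun y => 'D_(e a) F y) x).
    by apply: derivableP; exact: (Ck_derivable (Ck_D (e a) CF) Vx).
  have H := is_derive_mul h1 ((is_derive_mxP _ _ _ _).1 dF i j).
  rewrite (_ : (fun y => _) = (fun y => W y 0 a * 'D_(e a) F y i j : R^o)).
    by apply: (is_derive_eq H); rewrite !mxE.
  by apply/funext => y; rewrite mxE.
apply: etrans (@derive_val _ _ _ _ _ _ _ HS) _.
have e1 := derive_coords oV C1 dW Vx.
have e2 := etrans (derive_comm_mx oV Vx u (W x) CF)
  (@derive_coords _ _ _ _ _ _ oV (Ck_D u CF : Ck 1 V (fun y => 'D_u F y)) x (W x) Vx).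
apply: etrans _ (esym (f_equal2 +%R e2 e1)).
apply: etrans (big_split _ _ _ _ _) _; apply: etrans (addrC _ _) _.
apply: (f_equal2 +%R); last exact: erefl.
apply: eq_bigr => a _; exact: (f_equal (fun z => W x 0 a *: z) (derive_comm_mx oV Vx u (e a) CF)).
Qed.

End Moving.

(** The linear algebra of the argument below: f, g are the differentials of F and G
    at a point, ff, gg their second derivatives, J' the derivative of J. *)
Lemma nijenhuis_cancel (R : realType) (n m p : nat) (J : 'M[R]_n)
    (J' : 'rV[R]_n -> 'M[R]_n) 
    (f g : 'rV[R]_n -> 'M[R]_(m, p)) (ff gg : 'rV[R]_n -> 'rV[R]_n -> 'M[R]_(m, p)) u v :
  (forall v, f (v *m J) = - g v) -> (forall v, g (v *m J) = f v) ->
  (forall u v, ff u v = ff v u) -> (forall u v, gg u v = gg v u) ->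
  (forall u v, ff u (v *m J) + f (v *m J' u) = - gg u v) ->
  (forall u v, gg u (v *m J) + g (v *m J' u) = ff u v) ->
  f (u *m J' v *m J) + f (v *m J' (u *m J)) - f (v *m J' u *m J) - f (u *m J' (v *m J)) = 0 /\
  g (u *m J' v *m J) + g (v *m J' (u *m J)) - g (v *m J' u *m J) - g (u *m J' (v *m J)) = 0.
Proof.
move=> cf cg sf sg hf hg.
have ef u' v' : f (v' *m J' u') = - gg u' v' - ff u' (v' *m J).
  by rewrite -hf addrC addKr.
have eg u' v' : g (v' *m J' u') = ff u' v' - gg u' (v' *m J).
  by rewrite -hg addrC addKr.
rewrite !cf !cg !ef !eg (sf v u) (sf v (u *m J)) (sf (v *m J) (u *m J)) (sf (v *m J) u).
rewrite (sg v u) (sg v (u *m J)) (sg (v *m J) (u *m J)) (sg (v *m J) u) !opprD !opprK.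
move: (ff u v) (gg u v) (ff u (v *m J)) (gg u (v *m J)) (ff (u *m J) v) (gg (u *m J) v)
  (ff (u *m J) (v *m J)) (gg (u *m J) (v *m J)) => a b c d e q r t.
by split; apply/matrixP => i j; rewrite !mxE; ring.
Qed.

Section CauchyRiemann.
Variables (R : realType) (n m p : nat).
Notation E := 'rV[R]_n.
Variables (V : set E) (x : E) (F G : E -> 'M[R]_(m, p)) (J : E -> 'M[R]_n).
Hypotheses (oV : open V) (Vx : V x) (CF : Ck 2 V F) (CG : Ck 2 V G) (CJ : Ck 1 V J).
Hypothesis cr1 : forall y v, V y -> 'D_(v *m J y) F y = - 'D_v G y.
Hypothesis cr2 : forall y v, V y -> 'D_(v *m J y) G y = 'D_v F y.

(** The Nijenhuis tensor of J on the constant fields u and v, up to sign. *)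
Definition nijenhuis u v : E :=
  u *m 'D_v J x *m J x + v *m 'D_(u *m J x) J x
  - v *m 'D_u J x *m J x - u *m 'D_(v *m J x) J x.

Lemma cr_second u v :
  'D_u (fun y => 'D_(v *m J x) F y) x + 'D_(v *m 'D_u J x) F x
    = - 'D_u (fun y => 'D_v G y) x /\
  'D_u (fun y => 'D_(v *m J x) G y) x + 'D_(v *m 'D_u J x) G x
    = 'D_u (fun y => 'D_v F y) x.
Proof.
have dJ : is_derive x u J ('D_u J x).
  by apply: derivableP; exact: (Ck_derivable CJ Vx).
have cv : is_derive x u (fun=> v) 0 by exact: is_derive_cst.
have := is_derive_mulmx cv dJ; rewrite mul0mx add0r => HW.
split.
  apply: etrans (esym (derive_moving oV Vx CF HW)) _.
  apply: etrans (derive_eq_open u oV Vx (fun y Vy => cr1 v Vy)) _.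
  apply: (deriveN (f := fun y => 'D_v G y)).
  exact: (Ck_derivable (Ck_D v CG) Vx).
apply: etrans (esym (derive_moving oV Vx CG HW)) _.
exact: (derive_eq_open u oV Vx (fun y Vy => cr2 v Vy)).
Qed.

(** The functions F + iG are holomorphic for J.  Differentiating the
    Cauchy-Riemann equations once expresses the derivatives of F and G along the
    Nijenhuis tensor by second derivatives, which cancel by symmetry. *)
Lemma nijenhuis_killed u v : 'D_(nijenhuis u v) F x = 0 /\ 'D_(nijenhuis u v) G x = 0.
Proof.
have lin (H : E -> 'M[R]_(m, p)) : Ck 2 V H -> linear (fun w => 'D_w H x).
  move=> CH; have hl := derive_linear oV (CkS CH) Vx; exact: hl.
pose comb (H : E -> 'M[R]_(m, p)) := 'D_(u *m 'D_v J x *m J x) H x + 'D_(v *m 'D_(u *m J x) J x) H x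
  - 'D_(v *m 'D_u J x *m J x) H x - 'D_(u *m 'D_(v *m J x) J x) H x.
have linE (H : E -> 'M[R]_(m, p)) : Ck 2 V H -> 'D_(nijenhuis u v) H x = comb H.
  move=> CH; pose LM := GRing.isLinear.Build _ _ _ _ _ (lin H CH).
  pose L : {linear E -> 'M[R]_(m, p)} := HB.pack (fun v => 'D_v H x) LM.
  rewrite -[LHS]/(L (nijenhuis u v)) /nijenhuis.
  by rewrite (linearB L) (linearB L) (linearD L).
have [tF tG] := @nijenhuis_cancel R n m p (J x) (fun u => 'D_u J x)
  (fun w => 'D_w F x) (fun w => 'D_w G x) (fun u v => 'D_u (fun y => 'D_v F y) x)
  (fun u v => 'D_u (fun y => 'D_v G y) x) u v (fun v => cr1 v Vx) (fun v => cr2 v Vx)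
  (fun u v => derive_comm_mx oV Vx u v CF) (fun u v => derive_comm_mx oV Vx u v CG)
  (fun u v => (cr_second u v).1) (fun u v => (cr_second u v).2).
split; [exact: etrans (linE F CF) tF|exact: etrans (linE G CG) tG].
Qed.

End CauchyRiemann.

(** * Complex charts make the tangent algebra symmetric *)
Section Precomp.
Variables (R : realType) (V V' W : normedModType R) (L : {linear V -> V'}).
Hypothesis cL : continuous L.

Lemma derive_precomp (f : V' -> W) x v : 'D_v (f \o L) x = 'D_(L v) f (L x).
Proof.
rewrite /derive (_ : (fun h : R => _) = (fun h : R => h^-1 *: ((f \o shift (L x)) (h *: L v) - f (L x)))) //.
by apply/funext => h /=; rewrite (linearP L).
Qed.

Lemma derivable_precomp (f : V' -> W) x v : derivable f (L x) (L v) -> derivable (f \o L) x v.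
Proof.
rewrite /derivable (_ : (fun h : R => h^-1 *: (((f \o L) \o shift x) (h *: v) - (f \o L) x)) =
  (fun h : R => h^-1 *: ((f \o shift (L x)) (h *: L v) - f (L x)))) //.
by apply/funext => h /=; rewrite (linearP L).
Qed.

Lemma Ck_precomp k U (f : V' -> W) : Ck k U f -> Ck k (L @^-1` U) (f \o L).
Proof.
have cont (g : V' -> W) x : {for L x, continuous g} -> {for x, continuous (g \o L)}.
  by move=> cg; apply: continuous_comp; [exact: cL|exact: cg].
elim: k f => [|k IH] f [cf df]; first by split=> // x Ux; apply: cont; exact: cf.
split=> [x Ux|v]; first by apply: cont; exact: cf.
split=> [x Ux|]; first by apply: derivable_precomp; exact: (df (L v)).1.
rewrite (_ : (fun x => _) = (fun y => 'D_(L v) f y) \o L); first exact: IH (df (L v)).2.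
by apply/funext => x; exact: derive_precomp.
Qed.

End Precomp.

Section Chart.
Variable R : realType.
Notation E := 'rV[R]_7.
Notation C3 := ('rV[R]_3 * 'rV[R]_3)%type.
Notation rad := (@radial R).

(** The target C^3 of charts is a product, whereas the chain rule is about row
    vectors. *)
Definition split33 (y : 'rV[R]_(3 + 3)) : C3 := (lsubmx y, rsubmx y).

Lemma split33_is_linear : linear split33.
Proof. by move=> a u v; rewrite /split33 !linearP. Qed.
HB.instance Definition _ := GRing.isLinear.Build _ _ _ _ _ split33_is_linear.

Lemma split33_continuous : continuous split33.
Proof.
move=> y; have C0 := @Ck_id R 'rV[R]_(3 + 3) 0 setT.
have cl : Ck 0 setT (fun y : 'rV[R]_(3 + 3) => lsubmx y).
  apply: (Ck_mx openT) => i j; rewrite (_ : (fun x => _) = (fun x : 'rV[R]_(3+3) => x i (lshift 3 j) : R^o)).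
    exact: (Ck_entry _ _ openT C0).
  by apply/funext => u; rewrite mxE.
have cr : Ck 0 setT (fun y : 'rV[R]_(3 + 3) => rsubmx y).
  apply: (Ck_mx openT) => i j; rewrite (_ : (fun x => _) = (fun x : 'rV[R]_(3+3) => x i (rshift 3 j) : R^o)).
    exact: (Ck_entry _ _ openT C0).
  by apply/funext => u; rewrite mxE.
exact: (cvg_pair (Ck_cont cl (I : setT y)) (Ck_cont cr (I : setT y))).
Qed.

Variables (J : E -> 'M[R]_7) (U : set E) (z : E -> C3).
Hypotheses (hJ : almost_complex J) (hz : complex_chart J U z).
(** The cone over the domain of the chart, on which z composed with the radial
    retraction is smooth. *)
Let V := [set y : E | y != 0 /\ U (rad y)].
Let F y := (z (rad y)).1.
Let G y := (z (rad y)).2.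

Lemma open_cone : open V.
Proof.
have [oU _ _ _] := hz; rewrite openE => y [y0 Uy]; rewrite /interior.
have H1 : \forall t \near y, t != 0.
  by apply: open_nbhs_nbhs; split; [exact: open_nonzero|].
have H2 : \forall t \near y, U (rad t).
  have c : rad t @[t --> y] --> rad y := Ck_cont (@Ck_radial R 0) y0.
  by apply: c; apply: open_nbhs_nbhs; split.
by near=> t; split; near: t.
Unshelve. all: by end_near.
Qed.

Lemma chart_smooth k : Ck k V (z \o rad).
Proof. by have [_ sz _ _] := hz; exact: sz. Qed.

Lemma fst_continuous : continuous (fst : C3 -> 'rV[R]_3).
Proof. by move=> w; exact: cvg_fst. Qed.

Lemma snd_continuous : continuous (snd : C3 -> 'rV[R]_3).
Proof. by move=> w; exact: cvg_snd. Qed.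

Lemma Ck_chart_fst k : Ck k V F.
Proof. exact: (Ck_lin fst_continuous open_cone (chart_smooth k)). Qed.

Lemma Ck_chart_snd k : Ck k V G.
Proof. exact: (Ck_lin snd_continuous open_cone (chart_smooth k)). Qed.

Lemma derive_chart y v : V y ->
  'D_v F y = ('D_v (z \o rad) y).1 /\ 'D_v G y = ('D_v (z \o rad) y).2.
Proof.
move=> Vy; have d : derivable (z \o rad) y v := Ck_derivable (chart_smooth 1) Vy.
by split; [have [_ e] := is_derive_lin fst_continuous d|have [_ e] := is_derive_lin snd_continuous d]; exact: e.
Qed.

Lemma cone_radial y : V y -> V (rad y) /\ sphere6 (rad y).
Proof.
move=> [y0 Uy]; have sy := radial_sphere y0; split; last exact: sy.
by split; [exact: sphere_neq0|rewrite radial_id].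
Qed.

(** Functions constant along rays have the same derivatives on the cone as on the
    sphere, up to the differential of the retraction. *)
Lemma derive_via_radial m p (H : E -> 'M[R]_(m, p)) y v : Ck 1 V H ->
  (forall t, H (rad t) = H t) -> V y ->
  'D_v H y = 'D_(inv_norm y *: tproj v (rad y)) H (rad y).
Proof.
move=> CH Hr Vy; have [Vr _] := cone_radial Vy.
have dr := derive_radial v Vy.1.
have [dr1 dr2] := dr.
have H1 := derive_chain open_cone CH Vr dr1.
have e1 := @derive_val _ _ _ _ _ _ _ H1.
rewrite dr2 in e1; apply: etrans _ e1.
by apply: (derive_eq_open v open_cone Vy) => t _; rewrite /= Hr.
Qed.

Lemma radial_radial (y : E) : rad (rad y) = rad y.
Proof.
have [->|y0] := eqVneq y 0; first by rewrite /radial !scaler0.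
exact: radial_id (radial_sphere y0).
Qed.

(** The chart intertwines J with i on the sphere only; homogeneity carries the
    relation to the cone, where derivatives in all directions make sense. *)
Lemma chart_CR y v : V y ->
  'D_(v *m J (rad y)) F y = - 'D_v G y /\ 'D_(v *m J (rad y)) G y = 'D_v F y.
Proof.
move=> Vy; have [Vr sr] := cone_radial Vy; have [_ _ _ CR] := hz.
have FF t : F (rad t) = F t by rewrite /F radial_radial.
have GG t : G (rad t) = G t by rewrite /G radial_radial.
set u := inv_norm y *: tproj v (rad y).
have tu : tangent (rad y) u.
  by rewrite /tangent /u dotZl ((tproj_field v).1 _ sr : dot _ _ = 0) mulr0.
have eJ : inv_norm y *: tproj (v *m J (rad y)) (rad y) = u *m J (rad y).
  rewrite /u -scalemxAl /tproj mulmxBl -scalemxAl (ac_normal hJ sr) scaler0 subr0.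
  rewrite (_ : dot (v *m J (rad y)) (rad y) = 0) ?scale0r ?subr0 //.
  by rewrite /dot -mulmxA (acs_right hJ sr) mulmx0 mxE.
have h := CR (rad y) u Vy.2 sr tu.
have [a1 b1] := derive_chart u Vr; have [a2 b2] := derive_chart (u *m J (rad y)) Vr.
have f1 := derive_via_radial v (Ck_chart_fst 1) FF Vy.
have g1 := derive_via_radial v (Ck_chart_snd 1) GG Vy.
have f2 := derive_via_radial (v *m J (rad y)) (Ck_chart_fst 1) FF Vy.
have g2 := derive_via_radial (v *m J (rad y)) (Ck_chart_snd 1) GG Vy.
rewrite eJ in f2 g2.
split.
  apply: etrans f2 _; apply: etrans a2 _; apply: etrans (f_equal fst h) _.
  by apply: (f_equal -%R); apply: etrans (esym b1) (esym g1).
apply: etrans g2 _; apply: etrans b2 _; apply: etrans (f_equal snd h) _.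
exact: etrans (esym a1) (esym f1).
Qed.

(** The inverse w of the chart satisfies w o z o radial = radial near x, and the
    retraction is the identity on tangent vectors. *)
Lemma chart_immersion x d : U x -> sphere6 x -> tangent x d ->
  'D_d F x = 0 -> 'D_d G x = 0 -> d = 0.
Proof.
move=> Ux sx td F0 G0; have [_ _ [w [oO sw wz]] _] := hz.
have Vx : V x by split; [exact: sphere_neq0|rewrite radial_id].
pose O := split33 @^-1` (z @` (U `&` @sphere6 R)).
pose zz y : 'rV[R]_(3 + 3) := row_mx (F y) (G y).
have oO' : open O by apply: open_comp oO => y _; exact: split33_continuous.
have Cw : Ck 1 O (w \o split33) := Ck_precomp split33_continuous (sw 1%N).
have szz y : split33 (zz y) = z (rad y).
  by rewrite /split33 /zz row_mxKl row_mxKr -surjective_pairing.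
have Ozz : O (zz x).
  by rewrite /O /preimage /= szz; exists (rad x) => //; rewrite radial_id.
have dF : is_derive x d F 0.
  by rewrite -F0; apply: derivableP; exact: (Ck_derivable (Ck_chart_fst 1) Vx).
have dG : is_derive x d G 0.
  by rewrite -G0; apply: derivableP; exact: (Ck_derivable (Ck_chart_snd 1) Vx).
have dzz : is_derive x d zz 0.
  apply/is_derive_mxP => i j; rewrite [X in is_derive _ _ _ X]mxE; case: (split_ordP j) => k ->.
    rewrite (_ : (fun y => _) = (fun y => F y i k : R^o)).
      by have := (is_derive_mxP _ _ _ _).1 dF i k; rewrite mxE.
    by apply/funext => y; rewrite row_mxEl.
  rewrite (_ : (fun y => _) = (fun y => G y i k : R^o)).
    by have := (is_derive_mxP _ _ _ _).1 dG i k; rewrite mxE.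
  by apply/funext => y; rewrite row_mxEr.
have [dz1 dz2] := dzz.
have H := derive_chain oO' Cw Ozz dz1; rewrite dz2 in H.
have e := @derive_val _ _ _ _ _ _ _ H.
have e2 : 'D_d ((w \o split33) \o zz) x = d.
  apply: etrans (@derive_val _ _ _ _ _ _ _ (derive_radial_tangent sx td)).
  apply: (derive_eq_open d open_cone Vx) => y Vy; have [Vr sr] := cone_radial Vy.
  by rewrite /= szz; apply: wz => //; exact: Vy.2.
rewrite -e2 e; exact: derive0.
Qed.

End Chart.

Lemma difference_of_expansions (R : realType) n (a b c d e : 'rV[R]_n) :
  a + b - c - d = (b + e - c) - (d + e - a).
Proof. by apply/rowP => i; rewrite !mxE; ring. Qed.

(** The antisymmetric part of the tangent algebra is, up to sign, the Nijenhuis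
    tensor: this is the only use of integrability. *)
Lemma tangent_algebra_sym (R : realType) (J : 'rV[R]_7 -> 'M[R]_7) nabla x v w :
  almost_complex J -> Levi_Civita nabla -> integrable_acs J ->
  sphere6 x -> tangent x v -> tangent x w ->
  tangent_algebra nabla J x v w = tangent_algebra nabla J x w v.
Proof.
move=> hJ LC int sx tv tw; have [U [z [Ux hz]]] := int x sx.
have Vx : [set y | y != 0 /\ U (radial y)] x by split; [exact: sphere_neq0|rewrite radial_id].
have CJ : Ck 1 [set y | y != 0 /\ U (radial y)] (J \o @radial R).
  by apply: Ck_sub (Ck_acs hJ 1) => y [].
have [kF kG] := @nijenhuis_killed R 7 1 3 _ x _ _ (J \o @radial R) (open_cone hz) Vx
  (Ck_chart_fst hz 2) (Ck_chart_snd hz 2) CJ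
  (fun y u Vy => (chart_CR hJ hz u Vy).1) (fun y u Vy => (chart_CR hJ hz u Vy).2) v w.
have tE : nijenhuis x (J \o @radial R) v w =
    tangent_algebra nabla J x v w - tangent_algebra nabla J x w v.
  rewrite (tangent_algebraE LC hJ sx tv tw) (tangent_algebraE LC hJ sx tw tv).
  rewrite /nijenhuis /= !radial_id // (dotC (w *m J x)).
  exact: difference_of_expansions.
have t1 := tangent_algebra_tangent LC hJ sx tv tw.
have t2 := tangent_algebra_tangent LC hJ sx tw tv.
have td : tangent x (nijenhuis x (J \o @radial R) v w).
  by rewrite tE /tangent dotDl dotNl (t1 : dot _ _ = 0) (t2 : dot _ _ = 0) subr0.
have := chart_immersion hz Ux sx td kF kG.
by rewrite tE => /eqP; rewrite subr_eq0 => /eqP.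
Qed.

(** * The family of projections onto T^{0,1} *)
Section BlockCalculus.
Variables (R : realType) (V : normedModType R) (m1 m2 n1 n2 : nat).
Variables (A : V -> 'M[R]_(m1, n1)) (B : V -> 'M[R]_(m1, n2)).
Variables (C : V -> 'M[R]_(m2, n1)) (D : V -> 'M[R]_(m2, n2)).

Lemma Ck_block k U : open U -> Ck k U A -> Ck k U B -> Ck k U C -> Ck k U D ->
  Ck k U (fun y => block_mx (A y) (B y) (C y) (D y)).
Proof.
move=> oU CA CB CC CD; apply: Ck_mx => // i j.
case: (split_ordP i) => i' ->; case: (split_ordP j) => j' ->.
- rewrite (_ : (fun x => _) = (fun y => A y i' j' : R^o)); first exact: Ck_entry.
  by apply/funext => y; rewrite block_mxEul.
- rewrite (_ : (fun x => _) = (fun y => B y i' j' : R^o)); first exact: Ck_entry.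
  by apply/funext => y; rewrite block_mxEur.
- rewrite (_ : (fun x => _) = (fun y => C y i' j' : R^o)); first exact: Ck_entry.
  by apply/funext => y; rewrite block_mxEdl.
rewrite (_ : (fun x => _) = (fun y => D y i' j' : R^o)); first exact: Ck_entry.
by apply/funext => y; rewrite block_mxEdr.
Qed.

Lemma is_derive_block x v dA dB dC dD : is_derive x v A dA -> is_derive x v B dB ->
  is_derive x v C dC -> is_derive x v D dD ->
  is_derive x v (fun y => block_mx (A y) (B y) (C y) (D y)) (block_mx dA dB dC dD).
Proof.
move=> /is_derive_mxP hA /is_derive_mxP hB /is_derive_mxP hC /is_derive_mxP hD.
apply/is_derive_mxP => i j.
case: (split_ordP i) => i' ->; case: (split_ordP j) => j' ->.
- rewrite block_mxEul (_ : (fun y => _) = (fun y => A y i' j' : R^o)); first exact: hA.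
  by apply/funext => y; rewrite block_mxEul.
- rewrite block_mxEur (_ : (fun y => _) = (fun y => B y i' j' : R^o)); first exact: hB.
  by apply/funext => y; rewrite block_mxEur.
- rewrite block_mxEdl (_ : (fun y => _) = (fun y => C y i' j' : R^o)); first exact: hC.
  by apply/funext => y; rewrite block_mxEdl.
rewrite block_mxEdr (_ : (fun y => _) = (fun y => D y i' j' : R^o)); first exact: hD.
by apply/funext => y; rewrite block_mxEdr.
Qed.

End BlockCalculus.

Section Linear.
Variables (R : realType) (V : normedModType R) (m n : nat).
Implicit Types A : V -> 'M[R]_(m, n).

Lemma is_derive_scalel A (c : R) x v dA : is_derive x v A dA ->
  is_derive x v (fun y => c *: A y) (c *: dA).
Proof.
move=> /is_derive_mxP hA; apply/is_derive_mxP => i j; rewrite mxE.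
have hc : is_derive x v (fun=> c : R^o) 0 by exact: is_derive_cst.
have H := is_derive_mul hc (hA i j).
rewrite (_ : (fun y => _) = (fun y => c * A y i j : R^o)); last by apply/funext => y; rewrite mxE.
by apply: (is_derive_eq H); rewrite mul0r add0r.
Qed.

Lemma is_derive_oppmx A x v dA : is_derive x v A dA -> is_derive x v (fun y => - A y) (- dA).
Proof.
move=> /(is_derive_scalel (-1)) H; rewrite (_ : (fun y => _) = (fun y => -1 *: A y)).
  by apply: (is_derive_eq H); rewrite scaleN1r.
by apply/funext => y; rewrite scaleN1r.
Qed.

End Linear.

Section Constant.
Variables (R : realType) (V : normedModType R) (m n p : nat).

Lemma is_derive_mulmxl (K : 'M[R]_(m, n)) (A : V -> 'M[R]_(n, p)) x v dA :
  is_derive x v A dA -> is_derive x v (fun y => K *m A y) (K *m dA).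
Proof.
move=> hA; apply: (is_derive_eq (is_derive_mulmx (is_derive_cst K x v) hA)).
by rewrite mul0mx add0r.
Qed.

Lemma is_derive_mulmxr (K : 'M[R]_(n, p)) (A : V -> 'M[R]_(m, n)) x v dA :
  is_derive x v A dA -> is_derive x v (fun y => A y *m K) (dA *m K).
Proof.
move=> hA; apply: (is_derive_eq (is_derive_mulmx hA (is_derive_cst K x v))).
by rewrite mulmx0 addr0.
Qed.

End Constant.

Section Realification.
Variables (R : realType) (n : nat).
Notation C := R[i].

Definition imaginary_unit : 'M[R]_(n + n) := realify (('i%C : C) *: 1%:M).

Lemma realify_inj : injective (@realify R n).
Proof. by move=> A B /eq_block_mx[eR eI _ _]; exact: cmatrixP. Qed.

Lemma realify_commutes (A : 'M[C]_n) : imaginary_unit *m realify A = realify A *m imaginary_unit.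
Proof. by rewrite -!realify_mul -scalemxAl -scalemxAr mul1mx mulmx1. Qed.

(** A real matrix commuting with the multiplication by i is complex linear. *)
Lemma commutes_realify (D : 'M[R]_(n + n)) : imaginary_unit *m D = D *m imaginary_unit ->
  exists A : 'M[C]_n, D = realify A.
Proof.
have -> : imaginary_unit = block_mx 0 1%:M (- 1%:M) 0.
  have e1 : (1%:M : 'M[C]_n) = complexify 1%:M by rewrite /complexify map_mx1.
  by rewrite /imaginary_unit /realify reM_iZ imM_iZ e1 reM_cx imM_cx oppr0.
rewrite -[D]submxK !mulmx_block !(mul0mx, mulmx0, mul1mx, mulmx1, mulNmx, mulmxN, add0r, addr0).
move=> /eq_block_mx[e1 e2 _ _].
exists (\matrix_(i, j) (ulsubmx D i j +i* ursubmx D i j)%C); rewrite /realify; congr block_mx.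
- by apply/matrixP => i j; rewrite !mxE.
- by apply/matrixP => i j; rewrite !mxE.
- by rewrite e1; apply/matrixP => i j; rewrite !mxE.
by rewrite e2; apply/matrixP => i j; rewrite !mxE.
Qed.

End Realification.

Section Projections.
Variables (R : realType) (J : 'rV[R]_7 -> 'M[R]_7).
Hypothesis hJ : almost_complex J.
Notation C := R[i].
Notation E := 'rV[R]_7.
Notation U := [set y : E | y != 0].
Notation rad := (@radial R).
Notation projT y := (proj_ortho (T01 J y)).
Notation oblique y := (cx_proj y (J y)).

Definition T01_proj (y : E) : 'M[R]_(7 + 7) := realify (projT (rad y)).
Definition T01_oblique (y : E) : 'M[R]_(7 + 7) := realify (oblique (rad y)).

Lemma T01_obliqueE : T01_oblique = (fun y => block_mx
  (2^-1 *: (1%:M - (rad y)^T *m rad y)) (2^-1 *: (J \o rad) y)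
  (- (2^-1 *: (J \o rad) y)) (2^-1 *: (1%:M - (rad y)^T *m rad y))).
Proof. by apply/funext => y; rewrite /T01_oblique /realify !reN !imN. Qed.

Lemma Ck_T01_oblique k : Ck k U T01_oblique.
Proof.
have oU := @open_nonzero R; rewrite T01_obliqueE.
have c2 : Ck k U (fun=> 2^-1 : R^o) by exact: Ck_cst.
have C1 : Ck k U (fun y => 2^-1 *: (1%:M - (rad y)^T *m rad y)).
  apply: (Ck_scalemx oU c2); apply: (Ck_add oU); first exact: Ck_cst.
  apply: (Ck_opp oU); apply: (Ck_mulmx oU); last exact: Ck_radial.
  by apply: (Ck_trmx oU); exact: Ck_radial.
have C2 : Ck k U (fun y => 2^-1 *: (J \o rad) y) by apply: (Ck_scalemx oU c2); exact: Ck_acs.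
by apply: (Ck_block oU) => //; exact: (Ck_opp oU).
Qed.

Lemma sphere_facts x : sphere6 x -> [/\ x *m x^T = 1%:M, x *m J x = 0,
  J x *m x^T = 0 & J x *m J x = x^T *m x - 1%:M].
Proof.
move=> sx; split; [exact: sphere_mul|exact: acs_left|exact: (acs_right hJ)|exact: (acs_sqr hJ)].
Qed.

(** Smoothness is read off from the rational expression of the orthogonal
    projection in terms of the oblique one, whose entries are those of J. *)
Lemma Ck_T01_proj k : Ck k U T01_proj.
Proof.
have oU := @open_nonzero R.
have H y : y != 0 -> T01_oblique y + (T01_oblique y)^T - 1%:M \in unitmx /\
    T01_proj y = (T01_oblique y)^T *m invmx (T01_oblique y + (T01_oblique y)^T - 1%:M).
  by move=> y0; have [a b c d] := sphere_facts (radial_sphere y0); exact: (realify_projQ a b c d).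
have CN := Ck_T01_oblique k.
apply: (Ck_ext oU (f := fun y => (T01_oblique y)^T *m invmx (T01_oblique y + (T01_oblique y)^T - 1%:M))).
  by move=> y y0; rewrite (H y y0).2.
apply: (Ck_mulmx oU); first exact: (Ck_trmx oU).
apply: (Ck_invmx oU) => [y y0|]; first exact: (H y y0).1.
apply: (Ck_add oU); first by apply: (Ck_add oU) => //; exact: (Ck_trmx oU).
exact: Ck_cst.
Qed.

Lemma T01_proj_idem y : T01_proj y *m T01_proj y = T01_proj y.
Proof. by rewrite /T01_proj -realify_mul projQ_idem. Qed.

Lemma T01_proj_commutes y : imaginary_unit R 7 *m T01_proj y = T01_proj y *m imaginary_unit R 7.
Proof. exact: realify_commutes. Qed.

Lemma T01_proj_sym y : (T01_proj y)^T = T01_proj y.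
Proof. by rewrite /T01_proj -realify_trC projQ_herm. Qed.

Lemma is_derive_T01_proj x v : sphere6 x -> is_derive x v T01_proj ('D_v T01_proj x).
Proof.
by move=> sx; apply: derivableP; exact: (Ck_derivable (Ck_T01_proj 1) (sphere_neq0 sx)).
Qed.

Lemma derive_T01_oblique x v : sphere6 x -> tangent x v ->
  is_derive x v T01_oblique (realify ((2^-1)%:C%C *: (complexify (- (v^T *m x + x^T *m v))
     + ('i%C : C) *: complexify ('D_v (J \o rad) x)))).
Proof.
move=> sx tv; rewrite T01_obliqueE /realify reM_halfZ imM_halfZ reMD imMD reM_cx imM_cx reM_iZ imM_iZ.
rewrite reM_cx imM_cx oppr0 addr0 add0r.
have hr := derive_radial_tangent sx tv.
have H1 := is_derive_subp (is_derive_cst (1%:M : 'M[R]_7) x v) (is_derive_mulmx (is_derive_trmx hr) hr).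
rewrite radial_id // sub0r in H1.
have h1 := is_derive_scalel 2^-1 H1; have h2 := is_derive_scalel 2^-1 (is_derive_acs hJ v sx).
exact: (is_derive_block h1 h2 (is_derive_oppmx h2) h1).
Qed.

(** The relations P^T = P, iP = Pi and N P = N are linear in the derivative of P
    once differentiated. *)
Lemma derive_T01_proj x v : sphere6 x -> tangent x v ->
  exists2 Q' : 'M[C]_7, 'D_v T01_proj x = realify Q' & Q' ^t* = Q' /\
    let N' := (2^-1)%:C%C *: (complexify (- (v^T *m x + x^T *m v))
     + ('i%C : C) *: complexify ('D_v (J \o rad) x)) in
    N' *m projT x + oblique x *m Q' = N'.
Proof.
move=> sx tv; have x0 := sphere_neq0 sx; have dP := is_derive_T01_proj v sx.
have [Q' EQ] : exists Q' : 'M[C]_7, 'D_v T01_proj x = realify Q'.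
  apply: commutes_realify.
  have e1 := @derive_val _ _ _ _ _ _ _ (is_derive_mulmxl (imaginary_unit R 7) dP).
  have e2 := @derive_val _ _ _ _ _ _ _ (is_derive_mulmxr (imaginary_unit R 7) dP).
  apply: etrans (esym e1) _.
  apply: etrans _ e2; apply: (eq_near_nonzero v x0) => y _; exact: T01_proj_commutes.
exists Q'; first exact: EQ.
split.
  apply: realify_inj; rewrite realify_trC -EQ.
  have e := @derive_val _ _ _ _ _ _ _ (is_derive_trmx dP).
  by apply: etrans (esym e) _; apply: (eq_near_nonzero v x0) => y _; exact: T01_proj_sym.
have dN := derive_T01_oblique sx tv; move: dN; set N' := _ *: _ => dN /=.
apply: realify_inj; rewrite realifyD !realify_mul -EQ.
have e := @derive_val _ _ _ _ _ _ _ (is_derive_mulmx dN dP).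
have eP : T01_proj x = realify (projT x) by rewrite /T01_proj radial_id.
have eN : T01_oblique x = realify (oblique x) by rewrite /T01_oblique radial_id.
apply: etrans (f_equal2 (fun a b => realify N' *m a + b *m 'D_v T01_proj x) (esym eP) (esym eN)) _.
apply: etrans (esym e) _; apply: etrans _ (@derive_val _ _ _ _ _ _ _ dN).
apply: (eq_near_nonzero v x0) => y y0; rewrite /T01_oblique /T01_proj -realify_mul.
have [a b c d] := sphere_facts (radial_sphere y0).
exact: (f_equal (@realify R 7) (projQ_N a b c d)).
Qed.

End Projections.

(** * Integrability and the condition on frames *)
Section Corollary.
Variables (R : realType) (J : 'rV[R]_7 -> 'M[R]_7)
  (nabla : ('rV[R]_7 -> 'rV[R]_7) -> ('rV[R]_7 -> 'rV[R]_7) -> ('rV[R]_7 -> 'rV[R]_7)).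
Hypotheses (hJ : almost_complex J) (LC : Levi_Civita nabla).
Notation E := 'rV[R]_7.
Notation C := R[i].
Notation rad := (@radial R).
Notation dJ := (nablaJ nabla J).
Notation tm := (tangent_algebra nabla J).
Notation projT y := (proj_ortho (T01 J y)).
Implicit Types x X Y Z : E.

Lemma ipJ_ge0 x X : sphere6 x -> tangent x X -> 0 <= ipJ J x X X.
Proof.
move=> sx /tangentP tX; have [a b c d] := sphere_facts hJ sx.
exact: (ipQ_ge0 (projQ_idem J x) (projQ_herm J x) (projQ_N a b c d) tX).
Qed.

Lemma normJ_sqr x X : sphere6 x -> tangent x X -> normJ J x X ^+ 2 = ipJ J x X X.
Proof. by move=> sx tX; rewrite sqr_sqrtr // ipJ_ge0. Qed.

Lemma normJ_gt0 x X : sphere6 x -> tangent x X -> X != 0 -> 0 < normJ J x X.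
Proof.
move=> sx tX X0; rewrite sqrtr_gt0 lt0r ipJ_ge0 // andbT; apply/eqP => e.
move/tangentP: tX => tX; have [a b c d] := sphere_facts hJ sx; move/eqP: X0; apply.
have h := ipQ_eq0 d (projQ_idem J x) (projQ_herm J x) (projQ_N a b c d) (N_projQ J x) tX e. exact: h.
Qed.

Lemma normJ_J x X : sphere6 x -> tangent x X -> normJ J x (X *m J x) = normJ J x X.
Proof.
move=> sx /tangentP tX; have [a b c d] := sphere_facts hJ sx; congr Num.sqrt.
exact: (ipQ_J c (projQ_idem J x) (projQ_herm J x) (projQ_N a b c d) tX tX).
Qed.

Lemma ipJ_cauchy x X Y : sphere6 x -> tangent x X -> tangent x Y ->
  ipJ J x X Y <= normJ J x X * normJ J x Y.
Proof.
move=> sx /tangentP tX /tangentP tY; have [a b c d] := sphere_facts hJ sx.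
exact: (ipQ_cauchy d (projQ_idem J x) (projQ_herm J x) (projQ_N a b c d) (N_projQ J x) tX tY).
Qed.

Lemma frame_derivative_T01 x v Z (Q' : 'M[C]_7) : sphere6 x -> tangent x v -> tangent x Z ->
  (let N' := (2^-1)%:C%C *: (complexify (- (v^T *m x + x^T *m v))
     + ('i%C : C) *: complexify ('D_v (J \o rad) x)) in
    N' *m projT x + cx_proj x (J x) *m Q' = N') ->
  (complexify Z + ('i%C : C) *: complexify (Z *m J x)) *m Q' =
  ('i%C : C) *: Dop (projT x) (dJ x v Z)
    - (dot Z v +i* dot (Z *m J x) v)%C *: complexify x.
Proof.
move=> sx tv tZ hN; have [a b c d] := sphere_facts hJ sx.
have tS := (tangentP x _).1 (nablaJ_tangent LC hJ sx tv tZ).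
exact: (frame_derivative a b c d (projQ_herm J x) (projQ_N a b c d) (N_projQ J x)
  ((tangentP x Z).1 tZ) (derive_acs_sqr hJ sx tv) (erefl _) hN (nablaJE LC hJ sx tv tZ) tS).
Qed.

Hypothesis int : integrable_acs J.

(** The link between the condition on frames and the form.  By definition of the
    tangent algebra the derivative of J along XJ is that along X followed by J, plus
    m (X, Z_k), which is m (Z_k, X) when J is integrable; the rest is the expansion
    of the trace in the frame. *)
Lemma proj_form_frame x X (Z : 'I_3 -> E) : sphere6 x -> tangent x X -> T01_frame J x Z ->
  proj_form (imaginary_unit R 7) (T01_proj J) x X (X *m J x) =
  - 4 * (\sum_(k < 3) ipJ J x (dJ x X (Z k)) (tm x (Z k) X *m J x)
         - (\sum_(k < 3) normJ J x (dJ x X (Z k)) ^+ 2 + normJ J x X ^+ 2)).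
Proof.
move=> sx tX fZ; have [a b c d] := sphere_facts hJ sx; have [tZ _ _] := fZ.
have tY : tangent x (X *m J x) := ac_tangent hJ sx tX.
have [QX EX [hX NX]] := derive_T01_proj hJ sx tX.
have [QY EY [hY NY]] := derive_T01_proj hJ sx tY.
rewrite /proj_form EX EY (_ : T01_proj J x = realify (projT x)); last first.
  by rewrite /T01_proj radial_id.
apply: etrans (frame_trace fZ hX hY) _; congr (- 4 * _).
pose cc V k := (dot (Z k) V +i* dot (Z k *m J x) V)%C.
have term k : complex.Im (herm (frame_vec J x Z k *m QX) (frame_vec J x Z k *m QY)) =
    ipJ J x (dJ x X (Z k)) (tm x (Z k) X *m J x) - normJ J x (dJ x X (Z k)) ^+ 2
    + complex.Im (cc X k * (cc (X *m J x) k)^*).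
  have fX := frame_derivative_T01 sx tX (tZ k) NX.
  have fY := frame_derivative_T01 sx tY (tZ k) NY.
  have tS := nablaJ_tangent LC hJ sx tX (tZ k).
  have tM := tangent_algebra_tangent LC hJ sx (tZ k) tX.
  have SY : dJ x (X *m J x) (Z k) = tm x (Z k) X + dJ x X (Z k) *m J x.
    by rewrite (tangent_algebra_sym hJ LC int sx (tZ k) tX) /tangent_algebra subrK.
  rewrite (normJ_sqr sx tS) /frame_vec fX fY SY.
  exact: (Im_herm_frame a c (projQ_idem J x) (projQ_herm J x) (projQ_N a b c d)
    (N_projQ J x) _ _ ((tangentP x _).1 tS) ((tangentP x _).1 tM)).
rewrite (eq_bigr _ (fun k _ => term k)) big_split sumrB /= (frame_sum_pairing fZ).
by rewrite (normJ_sqr sx tX) opprD addrA.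
Qed.

(** Pairing X with XJ shows that the form is nondegenerate. *)
Lemma no_integrable_of_frames :
  (forall x X (Z : 'I_3 -> E), sphere6 x -> tangent x X -> X != 0 -> T01_frame J x Z ->
     \sum_(k < 3) ipJ J x (dJ x X (Z k)) (tm x (Z k) X *m J x)
     <> \sum_(k < 3) normJ J x (dJ x X (Z k)) ^+ 2 + normJ J x X ^+ 2) -> False.
Proof.
move=> ne; apply: (@no_nondegenerate_proj_form R (7 + 7) (imaginary_unit R 7) (T01_proj J)).
- exact: Ck_T01_proj.
- by move=> y _; exact: T01_proj_idem.
- by move=> y _; exact: T01_proj_commutes.
move=> x X sx tX X0; have [a b c d] := sphere_facts hJ sx.
have [Z fZ] := frame_exists a b c d.
exists (X *m J x); first exact: (ac_tangent hJ sx tX).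
rewrite (proj_form_frame sx tX fZ) mulf_neq0 //.
by rewrite subr_eq0; apply/eqP; exact: ne sx tX X0 fZ.
Qed.

End Corollary.

Theorem corollary5p10 (R : realType) (J : 'rV[R]_7 -> 'M[R]_7)
    (nabla : ('rV[R]_7 -> 'rV[R]_7) -> ('rV[R]_7 -> 'rV[R]_7) ->
             ('rV[R]_7 -> 'rV[R]_7))
    (hJ : almost_complex J) (hnabla : Levi_Civita nabla) :
  [/\ (forall (x X : 'rV[R]_7) (Z : 'I_3 -> 'rV[R]_7),
         sphere6 x -> tangent x X -> X != 0 -> T01_frame J x Z ->
         \sum_(k < 3) ipJ J x (nablaJ nabla J x X (Z k))
                              (tangent_algebra nabla J x (Z k) X *m J x)
         <> \sum_(k < 3) normJ J x (nablaJ nabla J x X (Z k)) ^+ 2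
            + normJ J x X ^+ 2) ->
      ~ integrable_acs J,
      (forall x X Z : 'rV[R]_7,
         sphere6 x -> tangent x X -> tangent x Z ->
         ipJ J x (nablaJ nabla J x X Z)
                 (tangent_algebra nabla J x Z X *m J x)
         <= normJ J x (nablaJ nabla J x X Z) ^+ 2) ->
      ~ integrable_acs J
    & (forall x X Z : 'rV[R]_7,
         sphere6 x -> tangent x X -> tangent x Z ->
         normJ J x (tangent_algebra nabla J x Z X)
         <= normJ J x (nablaJ nabla J x X Z)) ->
      ~ integrable_acs J].
Proof.
have part2 : (forall x X Z : 'rV[R]_7, sphere6 x -> tangent x X -> tangent x Z ->
    ipJ J x (nablaJ nabla J x X Z) (tangent_algebra nabla J x Z X *m J x)
    <= normJ J x (nablaJ nabla J x X Z) ^+ 2) -> ~ integrable_acs J.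
  move=> le int; apply: (no_integrable_of_frames hJ hnabla int) => x X Z sx tX X0 [tZ _ _] e.
  have : \sum_(k < 3) ipJ J x (nablaJ nabla J x X (Z k)) (tangent_algebra nabla J x (Z k) X *m J x)
      <= \sum_(k < 3) normJ J x (nablaJ nabla J x X (Z k)) ^+ 2.
    by apply: ler_sum => k _; exact: le.
  rewrite e gerDl; apply/negP; rewrite -ltNge exprn_gt0 //; exact: (normJ_gt0 hJ).
split=> [ne int|//|le]; first exact: (no_integrable_of_frames hJ hnabla int ne).
apply: part2 => x X Z sx tX tZ.
have tS := nablaJ_tangent hnabla hJ sx tX tZ.
have tM := tangent_algebra_tangent hnabla hJ sx tZ tX.
apply: le_trans (ipJ_cauchy hJ sx tS (ac_tangent hJ sx tM)) _.
rewrite (normJ_J hJ sx tM) expr2; apply: ler_wpM2l; first exact: sqrtr_ge0.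
exact: le.
Qed.
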